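(* Let $L\subset k[x,y]$ be a lex-segment ideal (proper, with $\dim_kk[x,y]/L<\infty$) and let $I\subset k[x,y]$ be a homogeneous ideal with the same Hilbert function as $L$. Set $\beta=(\beta_{0,j}(I))_j$. Then the variety $V(L,\ge\beta)$ is irreducible, it is the closure of $V(L,\beta)$, and it has codimension $\sum_j\beta_{1,j}(I)\,\beta_{0,j}(I)$ in $V(L)$.
   Context: $k$ is a field, $R=k[x,y]$ with the lexicographic term order with $x>y$. $\mathrm{Lt}(I)$ is the ideal generated by the leading monomials of the nonzero elements of $I$. For a proper monomial ideal $E$ with $\dim_kR/E<\infty$ put $t=\min\{j:x^j\in E\}$; $m_i=\min\{j:x^{t-i}y^j\in E\}$ for $0\le i\le t$ (so $0=m_0<m_1\le\dots\le m_t$); $d_i=m_i-m_{i-1}$ for $1\le i\le t$; $u_{ij}=m_j-m_{i-1}+i-j$ for $1\le i\le t+1$, $1\le j\le t$; $\mathcal S(E)=\{(i,j):1\le j<i\le t+1,\ 0\le u_{ij}<d_j\}$. The ideal $E$ is a lex-segment ideal iff $d_i>0$ for all $i=1,\dots,t$. $M_0(E)$ is the $(t+1)\times t$ matrix with $(i,i)$-entry $y^{d_i}$, $(i+1,i)$-entry $-x$ ($1\le i\le t$), and $0$ elsewhere. For $p=(p_{ij})_{(i,j)\in\mathcal S(E)}\in\mathbf A^n$, $n=\#\mathcal S(E)$, let $M(p)=M_0(E)+N$, where $N$ has $(i,j)$-entry $p_{ij}y^{u_{ij}}$ if $(i,j)\in\mathcal S(E)$ and $0$ otherwise. $V(E)$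 is the set of homogeneous ideals $J$ of $R$ with $\mathrm{Lt}(J)=E$. It is identified with $\mathbf A^n$ via the bijection sending $p$ to the ideal of $t\times t$ minors of $M(p)$. For a homogeneous ideal $J$, $\beta_{i,j}(J)=\dim_k\mathrm{Tor}_i^R(J,k)_j$; so $\beta_{0,j}(J)$ is the number of minimal generators of degree $j$. For an integer vector $\beta=(\beta_j)_j$ put $$V(E,\beta)=\{J\in V(E):\beta_{0,j}(J)=\beta_j\ \forall j\},\qquad V(E,\ge\beta)=\{J\in V(E):\beta_{0,j}(J)\ge\beta_j\ \forall j\}.$$ Irreducibility, closure and codimension refer to the Zariski topology of $V(E)=\mathbf A^n$; if $k$ is not algebraically closed, the loci are understood as sets of points over an algebraic closure of $k$. *)

(* Defs.v *)
From HB Require Import structures.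
From mathcomp Require Import all_boot all_order all_algebra.
From mathcomp Require Import mpoly.
From mathcomp Require Import boolp classical_sets functions fsbigop topology.

Set Implicit Arguments.
Unset Strict Implicit.
Unset Printing Implicit Defensive.

Import Order.TTheory GRing.Theory Num.Theory.
Local Open Scope classical_set_scope.
Local Open Scope ring_scope.

(* 0 if A is empty. *)
Definition nat_min (A : set nat) : nat :=
  xget 0%N [set j | A j /\ forall l, A l -> (j <= l)%N].

Section QuotientDimension.
Variables (k : fieldType) (U : lmodType k).

(* For subspaces B of Z: the classes of some e_1, .., e_d form a basis of
   Z/B. *)
Definition has_quot_dim (Z B : set U) (d : nat) : Prop :=
  exists e : 'I_d -> U, (forall i, Z (e i)) /\
    forall z, Z z -> exists! c : 'rV[k]_d, B (z - \sum_i c 0 i *: e i).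

(* 0 if Z/B is infinite dimensional. *)
Definition quot_dim (Z B : set U) : nat := xget 0%N (has_quot_dim Z B).

End QuotientDimension.

(* In {mpoly k[2]} = k[x,y], x is 'X_ix and y is 'X_iy. *)
Notation ix := (@ord0 1).
Notation iy := (@ord_max 1).

Section Ideals.
Variable k : fieldType.
Local Notation R := {mpoly k[2]}.

Definition mon (a b : nat) : R := 'X_ix ^+ a * 'X_iy ^+ b.

Definition is_ideal (J : set R) : Prop :=
  [/\ J 0, (forall f g, J f -> J g -> J (f + g)) &
      forall r f, J f -> J (r * f)].

Definition ideal_gen (S : set R) : set R := smallest is_ideal S.

Definition homogeneous_ideal (J : set R) : Prop :=
  is_ideal J /\ forall f d, J f -> J (pihomog mdeg d f).

Definition monomial_ideal (E : set R) : Prop :=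
  exists S : set 'X_{1..2}, E = ideal_gen [set 'X_[m] | m in S].

Definition finite_colength (E : set R) : Prop :=
  exists d, has_quot_dim setT E d.

Definition lex_segment (E : set R) : Prop :=
  monomial_ideal E /\
  forall a b c d, (a + b = c + d)%N -> (a < c)%N ->
    E (mon a b) -> E (mon c d).

Definition lex_le (m m' : 'X_{1..2}) : bool :=
  (m ix < m' ix)%N || (m ix == m' ix) && (m iy <= m' iy)%N.

Definition is_lead_mon (f : R) (m : 'X_{1..2}) : Prop :=
  m \in msupp f /\ forall m', m' \in msupp f -> lex_le m' m.

Definition Lt (J : set R) : set R :=
  ideal_gen [set 'X_[m] | m in [set m | exists2 f, J f & is_lead_mon f m]].

Definition hilbert_fun (J : set R) (j : nat) : nat :=
  quot_dim [set f : R | f \is j.-homog]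
           [set f : R | J f /\ f \is j.-homog].

End Ideals.

Definition ideal_ext (k K : fieldType) (iota : {rmorphism k -> K})
    (J : set {mpoly k[2]}) : set {mpoly K[2]} :=
  ideal_gen [set map_mpoly iota f | f in J].

Section Tor.
Variable k : fieldType.
Local Notation R := {mpoly k[2]}.

(* R(-e)_j *)
Definition twist (e j : nat) : set R :=
  [set f | forall m, m \in msupp f -> (mdeg m + e)%N = j].

Definition ffmul m n (D : 'M[R]_(m, n)) (v : {ffun 'I_m -> R}) :
    {ffun 'I_n -> R} :=
  [ffun b => \sum_a v a * D a b].

(* Graded free resolutions
     .. -> F_1 -> F_0 -> k -> 0,   F_i = \bigoplus_a R(- gdeg i a),
   of the graded R-module k = R/(x,y). *)
Record free_resolution := FreeResolution {
  grank : nat -> nat;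
  gdeg : forall i, 'I_(grank i) -> nat;
  gdiff : forall i, 'M[R]_(grank i.+1, grank i);
  gaug : 'I_(grank 0) -> k;
  _ : forall i a b, twist (@gdeg i b) (@gdeg i.+1 a) (gdiff i a b);
  _ : forall a, gaug a != 0 -> @gdeg 0%N a = 0%N;
  _ : exists a, gaug a != 0;
  _ : forall v : {ffun 'I_(grank 0) -> R},
        \sum_a (v a)@_0%MM * gaug a = 0 <->
        exists w, v = ffmul (gdiff 0) w;
  _ : forall i (v : {ffun 'I_(grank i.+1) -> R}),
        ffmul (gdiff i) v = 0 <-> exists w, v = ffmul (gdiff i.+1) w
}.

Variables (F : free_resolution) (J : set R).

(* (J \otimes F_i)_j, as a subspace of F_i *)
Definition tor_chain (i j : nat) : set {ffun 'I_(grank F i) -> R} :=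
  [set v | forall a, J (v a) /\ twist (@gdeg F i a) j (v a)].

Arguments tor_chain : clear implicits.

Definition tor_cycle (i j : nat) : set {ffun 'I_(grank F i) -> R} :=
  match i with
  | 0 => tor_chain 0 j
  | i'.+1 => [set v | tor_chain i'.+1 j v /\ ffmul (gdiff F i') v = 0]
  end.

Arguments tor_cycle : clear implicits.

Definition tor_boundary (i j : nat) : set {ffun 'I_(grank F i) -> R} :=
  [set ffmul (gdiff F i) w | w in tor_chain i.+1 j].

Arguments tor_boundary : clear implicits.

(* dim_k Tor_i(J, k)_j, Tor being computed from the resolution F of k *)
Definition tor_dim (i j : nat) : nat :=
  quot_dim (tor_cycle i j) (tor_boundary i j).

End Tor.

Section Koszul.
Variable k : fieldType.
Local Notation R := {mpoly k[2]}.

Definition kdeg (i : nat) (a : 'I_'C(2, i)) : nat := i.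

Definition kdiff (i : nat) : 'M[R]_('C(2, i.+1), 'C(2, i)) :=
  match i with
  | 0 => \matrix_(a < 2, b < 1) 'X_a
  | 1 => \matrix_(a < 1, b < 2)
           (if b == ix then 'X_iy else - 'X_ix)
  | _ => 0
  end.

Definition kaug (a : 'I_'C(2, 0)) : k := 1.

Lemma coefMX0 (i : 'I_2) (p : R) (m : 'X_{1..2}) :
  m i = 0%N -> (p * 'X_i)@_m = 0.
Proof.
move=> mi; rewrite [p]mpolyE mulr_suml raddf_sum /= big1_seq // => m' _.
rewrite -scalerAl -mpolyXD mcoeffZ mcoeffX; case: eqP => [E|]; last first.
  by rewrite mulr0.
by move: mi; rewrite -E mnmDE mnm1E eqxx addn1.
Qed.

Lemma divX (i : 'I_2) (p : R) : exists q r : R,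
  p = q * 'X_i + r /\ forall m, r@_m = if m i == 0%N then p@_m else 0.
Proof.
exists (\sum_(m <- msupp p | (0 < m i)%N) p@_m *: 'X_[m - U_(i)]).
set q := (X in X * _); exists (p - q * 'X_i).
have E : p - q * 'X_i = \sum_(m <- msupp p | ~~ (0 < m i)%N) p@_m *: 'X_[m].
  rewrite {1}[p]mpolyE (bigID (fun m : 'X_{1..2} => (0 < m i)%N)) /=.
  rewrite addrAC -[RHS]add0r; congr (_ + _).
  apply/eqP; rewrite subr_eq0 /q mulr_suml; apply/eqP/eq_bigr => m mi.
  rewrite -scalerAl -mpolyXD submK //.
  by apply/mnm_lepP => j; rewrite mnm1E; case: eqP => [<-|].
split=> [|m]; first by rewrite addrC subrK.
case: eqP => [mi|mi]; first by rewrite mcoeffB coefMX0 // subr0.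
rewrite E raddf_sum /= big1_seq // => m' /andP[m'i _].
rewrite mcoeffZ mcoeffX; case: eqP => [mm|]; last by rewrite mulr0.
by move: m'i; rewrite mm lt0n negbK => /eqP.
Qed.

Lemma kaugP (p : R) :
  p@_0%MM = 0 <-> exists a b : R, p = a * 'X_ix + b * 'X_iy.
Proof.
split=> [p0|[a [b ->]]]; last first.
  by rewrite mcoeffD !coefMX0 ?mnm0E // addr0.
have [a [r [pE rE]]] := divX ix p; have [b [s [rE' sE]]] := divX iy r.
exists a, b; rewrite {1}pE {1}rE'; suff -> : s = 0 by rewrite addr0.
apply/mpolyP => m; rewrite mcoeff0 sE rE.
case: eqP => // m1; case: eqP => // m0; suff -> : m = 0%MM by [].
apply/mnmP => j; rewrite mnm0E.
by case: j => [[|[|j]]] //= lj; [apply: etrans m0 | apply: etrans m1];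
  congr (fun_of_multinom m _); apply: val_inj.
Qed.

Lemma mulXI (i : 'I_2) (p q : R) : p * 'X_i = q * 'X_i -> p = q.
Proof.
apply: mulIf; apply/eqP => /(congr1 (mcoeff U_(i))).
by rewrite mcoeffXU eqxx mcoeff0 => /eqP; rewrite oner_eq0.
Qed.

Lemma ksyzP (a b : R) : a * 'X_ix + b * 'X_iy = 0 <->
  exists c, a = c * 'X_iy /\ b = - (c * 'X_ix).
Proof.
split=> [ab0|[c [-> ->]]]; last first.
  by rewrite mulNr -!mulrA [X in c * X]mulrC subrr.
have [q [r [bE rE]]] := divX ix b.
have r0 : r = 0.
  apply/mpolyP => m; rewrite mcoeff0 rE; case: eqP => // m0.
  have := congr1 (mcoeff (U_(iy) + m)%MM) ab0.
  rewrite mcoeff0 mcoeffD mcoeffMX coefMX0 ?add0r //.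
  by rewrite mnmDE m0 mnm1E.
rewrite r0 addr0 in bE; exists (- q); rewrite bE; split; last first.
  by rewrite mulNr opprK.
apply: (@mulXI ix); rewrite mulNr mulNr -[LHS]addr0; apply/eqP.
rewrite addr0 -addr_eq0 -ab0 bE; apply/eqP; congr (_ + _).
by rewrite mulrAC.
Qed.

Lemma kdiff_twist i a b : twist (@kdeg i b) (@kdeg i.+1 a) (kdiff i a b).
Proof.
move=> m; rewrite /kdeg; case: i a b => [|[|i]] a b /=; rewrite mxE.
- by rewrite msuppX inE => /eqP ->; rewrite mdeg1.
- by case: ifP => _; rewrite ?(perm_mem (msuppN _)) msuppX inE => /eqP ->;
  rewrite mdeg1.
- by rewrite msupp0.
Qed.

Lemma kaug_neq0 : exists a, kaug a != 0.
Proof. by exists ord0; rewrite oner_neq0. Qed.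

Lemma kaug_exact (v : {ffun 'I_'C(2, 0) -> R}) :
  \sum_a (v a)@_0%MM * kaug a = 0 <-> exists w, v = ffmul (kdiff 0) w.
Proof.
rewrite (@big_ord1 _ _ _ (fun a => (v a)@_0%MM * kaug a)) mulr1 kaugP.
have mulE (w : {ffun 'I_'C(2, 1) -> R}) :
    ffmul (kdiff 0) w ord0 = w ix * 'X_ix + w iy * 'X_iy.
  rewrite ffunE (@big_ord_recl _ _ _ 1) (@big_ord1 _ _ _ (fun a => w _ * _)).
  by rewrite !mxE; congr (_ + w _ * 'X__); apply: val_inj.
split=> [[a [b vE]]|[w ->]]; last by exists (w ix), (w iy).
exists [ffun i => if i == ix then a else b].
by apply/ffunP => i; rewrite [i]ord1 mulE !ffunE.
Qed.

Lemma kexact i (v : {ffun 'I_'C(2, i.+1) -> R}) :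
  ffmul (kdiff i) v = 0 <-> exists w, v = ffmul (kdiff i.+1) w.
Proof.
case: i v => [|[|i]] v.
- have mulE (w : {ffun 'I_'C(2, 1) -> R}) :
      ffmul (kdiff 0) w ord0 = w ix * 'X_ix + w iy * 'X_iy.
    rewrite ffunE (@big_ord_recl _ _ _ 1) (@big_ord1 _ _ _ (fun a => w _ * _)).
    by rewrite !mxE; congr (_ + w _ * 'X__); apply: val_inj.
  have mulE' (w : {ffun 'I_'C(2, 2) -> R}) j :
      ffmul (kdiff 1) w j = w ord0 * (if j == ix then 'X_iy else - 'X_ix).
    by rewrite ffunE (@big_ord1 _ _ _ (fun a => w a * _)) mxE.
  have -> : ffmul (kdiff 0) v = 0 <-> v ix * 'X_ix + v iy * 'X_iy = 0.
    split=> [|v0]; first by move/ffunP/(_ ord0); rewrite mulE ffunE.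
    by apply/ffunP => j; rewrite [j]ord1 mulE v0 ffunE.
  rewrite ksyzP; split=> [[c [v0 v1]]|[w ->]].
    exists [ffun=> c]; apply/ffunP => j; rewrite mulE' ffunE.
    case: eqP => [->//|]; case: j => [[|[|j]]] //= lj jN.
      by case: jN; apply: val_inj.
    by rewrite mulrN -v1; congr (v _); apply: val_inj.
  by exists (w ord0); rewrite !mulE' /= mulrN.
- split=> [/ffunP/(_ ix)|[w ->]]; last first.
    rewrite (_ : ffmul _ w = 0).
      by apply/ffunP => j; rewrite !ffunE big1 // => a _; rewrite ffunE mul0r.
    by apply/ffunP => j; rewrite !ffunE big1 // => a _; rewrite mxE mulr0.
  rewrite !ffunE (@big_ord1 _ _ _ (fun a => v a * _)) mxE /= => v0.
  exists 0; apply/ffunP => j; rewrite [j]ord1 ffunE big1 => [|a _].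
    apply: (@mulXI iy); rewrite mul0r -[RHS]v0; congr (v _ * _).
  by rewrite mxE mulr0.
- split=> _; last first.
    by apply/ffunP => j; rewrite !ffunE big1 // => a _; rewrite mxE mulr0.
  by exists 0; apply/ffunP => -[].
Qed.

(* 0 -> R(-2) -> R(-1)^2 -> R -> k -> 0 *)
Definition koszul : free_resolution k :=
  @FreeResolution k (fun i => 'C(2, i)) kdeg kdiff kaug
    kdiff_twist (fun _ _ => erefl) kaug_neq0 kaug_exact kexact.

End Koszul.

Definition betti (k : fieldType) (J : set {mpoly k[2]}) (i j : nat) : nat :=
  tor_dim (koszul k) J i j.

Definition affine_space (K : fieldType) (n : nat) : Type := 'rV[K]_n.

Section Zariski.
Variables (K : fieldType) (n : nat).

HB.instance Definition _ := Choice.on (affine_space K n).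

Definition zero_locus (S : set {mpoly K[n]}) : set (affine_space K n) :=
  [set v | forall f, S f -> f.@[fun i => v 0 i] = 0].

Definition zariski_open (U : set (affine_space K n)) : Prop :=
  exists S, U = ~` zero_locus S.

Lemma zariski_openT : zariski_open setT.
Proof.
exists [set 1]; apply/seteqP; split=> // v _ /(_ 1 erefl)/eqP.
by rewrite meval1 oner_eq0.
Qed.

Lemma zariski_openI : setI_closed zariski_open.
Proof.
move=> _ _ [S ->] [T ->]; rewrite -setCU.
exists [set h | exists f g, [/\ S f, T g & h = f * g]]; congr (~` _).
apply/seteqP; split=> v.
  by move=> vST _ [f [g [Sf Tg ->]]]; rewrite mevalM;
    case: vST => [/(_ _ Sf)|/(_ _ Tg)] ->; rewrite ?mul0r ?mulr0.
move=> vST; have [vS|vS] := pselect (zero_locus S v); [by left|right].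
move: vS => /existsNP[f /not_implyP[Sf /eqP fv]] g Tg.
have := vST (f * g); rewrite mevalM => /(_ _)/eqP.
by rewrite mulf_eq0 (negbTE fv) => H; apply/eqP/H; exists f, g.
Qed.

Lemma zariski_open_bigU (I : Type) (U : I -> set (affine_space K n)) :
  (forall i, zariski_open (U i)) -> zariski_open (\bigcup_i U i).
Proof.
move=> Uo; exists [set f : {mpoly K[n]} |
  forall v, (forall i, ~ U i v) -> f.@[fun i => v 0 i] = 0].
apply/seteqP; split=> v.
  move=> [i _ Uiv] vz; have [S US] := Uo i; move: (Uiv); rewrite US; apply.
  by move=> f Sf; apply: vz => w /(_ i); rewrite US => /contrapT; apply.
move=> nz; apply: contrapT => nU; apply: nz => f; apply=> i Uiv.
by apply: nU; exists i.
Qed.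

HB.instance Definition _ := isOpenTopological.Build (affine_space K n)
  zariski_openT zariski_openI zariski_open_bigU.

Lemma zariski_closedP (Z : set (affine_space K n)) :
  closed Z <-> exists S, Z = zero_locus S.
Proof.
rewrite -openC; split=> [[S /(congr1 setC)]|[S ->]]; last by exists S.
by rewrite !setCK => ->; exists S.
Qed.

End Zariski.

Definition irreducible_set (T : topologicalType) (A : set T) : Prop :=
  A !=set0 /\ forall F G, closed F -> closed G -> A `<=` F `|` G ->
    A `<=` F \/ A `<=` G.

Definition irreducible_chain (T : topologicalType) (A : set T) (c : nat)
    (Z : nat -> set T) : Prop :=
  [/\ Z 0%N = A,
      forall i, (i <= c)%N -> closed (Z i) /\ irreducible_set (Z i) &
      forall i, (i < c)%N -> Z i `<` Z i.+1].

(* Supremum of the lengths of chains of irreducible closed sets that start at A;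
   this is the codimension of A in T when A is closed and irreducible. *)
Definition has_codim (T : topologicalType) (A : set T) (c : nat) : Prop :=
  (exists Z, irreducible_chain A c Z) /\
  forall c' Z, irreducible_chain A c' Z -> (c' <= c)%N.

Section CanonicalHilbertBurch.
Variables (k : fieldType) (E : set {mpoly k[2]}).
Local Notation R := {mpoly k[2]}.

(* ht, hm i, hd i, hu i j and hS are t, m_i, d_i, u_ij and S(E). *)
Definition ht : nat := nat_min [set j | E (mon k j 0)].

Definition hm (i : nat) : nat := nat_min [set j | E (mon k (ht - i) j)].

Definition hd (i : nat) : nat := hm i - hm i.-1.

(* i and j are the 1-based row and column indices. *)
Definition hu (i j : nat) : int :=
  (hm j)%:Z - (hm i.-1)%:Z + i%:Z - j%:Z.

(* Rows and columns of matrices are indexed from 0, so that the entry of row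
   i and column j is the one with 1-based indices (i.+1, j.+1). *)
Definition hS : {set 'I_ht.+1 * 'I_ht} :=
  [set ij : 'I_ht.+1 * 'I_ht |
    [&& (ij.2 < ij.1)%N, 0 <= hu ij.1.+1 ij.2.+1 &
        hu ij.1.+1 ij.2.+1 < (hd ij.2.+1)%:Z]]%SET.

Definition hM0 : 'M[R]_(ht.+1, ht) :=
  \matrix_(i, j) (if i == j :> nat then 'X_iy ^+ hd j.+1
                  else if i == j.+1 :> nat then - 'X_ix else 0).

(* The coordinates of a point p are indexed by the elements of hS in the order
   of their enumeration. *)
Definition hM (p : affine_space k #|hS|) : 'M[R]_(ht.+1, ht) :=
  hM0 + \matrix_(i, j) \sum_(s < #|hS| | enum_val s == (i, j))
          p 0 s *: 'X_iy ^+ `|hu i.+1 j.+1|%N.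

Definition hb_ideal (p : affine_space k #|hS|) : set R :=
  ideal_gen [set \det (row' i (hM p)) | i in [set: 'I_ht.+1]].

Definition V : set (set R) := [set J | homogeneous_ideal J /\ Lt J = E].

Definition V_eq (b : nat -> nat) : set (set R) :=
  [set J | V J /\ forall j, betti J 0 j = b j].

Definition V_ge (b : nat -> nat) : set (set R) :=
  [set J | V J /\ forall j, (betti J 0 j >= b j)%N].

End CanonicalHilbertBurch.

(* Main.v *)
Require Import Defs.
From HB Require Import structures.
From mathcomp Require Import all_boot all_order all_algebra.
From mathcomp Require Import mpoly.
From mathcomp Require Import boolp classical_sets functions fsbigop topology.
From mathcomp Require Import zify ring.

Set Implicit Arguments.
Unset Strict Implicit.
Unset Printing Implicit Defensive.

Import Order.TTheory GRing.Theory Num.Theory.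
Local Open Scope classical_set_scope.
Local Open Scope ring_scope.

(** The ideals [hb_ideal p] are understood degree by degree, through univariate
    polynomials: setting y = 1 turns the piece of degree [e] of a homogeneous
    ideal into a space of polynomials of degree at most [e], and multiplication
    by x and y into multiplication by ['X] and inclusion.

    Let [wt a] be the least degree of a monomial of the lex-segment ideal whose
    exponent in x is [a]. The Cramer relations between the maximal minors of the
    matrix at [p] say that, up to sign, these become monic polynomials [hess a]
    of degree [a <= t] which satisfy the recursion
    [hess a.+1 = 'X * hess a - \sum_(b <= a) q b a *: hess b], whose coefficients
    are coordinates of [p] ([sminor_hess]). Extend the recursion by zero
    coefficients. Because [wt] does not increase on [0, t], the polynomials
    [hess a] with [wt a <= e] form a basis of the piece of degree [e]
    ([hb_ideal_hess]). Leading monomials can be read off this basis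
    ([V_hb_ideal]), and so can the products with x and y: if [m e] generators and
    [n e] syzygies of the canonical resolution have degree [e], then
    [betti (hb_ideal p) 0 e] is [m e] minus the rank of an [m e] by [n e] block of
    coordinates of [p] ([betti_hb_ideal]). As [wt] does not increase, every
    position between generators and syzygies of equal degree lies in [hS]
    ([unit_entry_hS]), so these blocks are matrices of independent variables.

    For the given ideal [I], the Euler characteristic of the Koszul complex and
    the minimal growth of lex segments give a number [r e] between [0] and the
    minimum of [m e] and [n e] such that [betti I 0 e = m e - r e] and
    [betti I 1 e = n e - r e] ([betti_same_hilbert]). So the locus of the theorem
    is a product of determinantal varieties, given by [rank <= r e] in the block
    of degree [e], and of an affine space.

    Two points of this locus are joined by a polynomial curve in it, since both
    factors of a product of an [m e] by [r e] and an [r e] by [n e] matrix can be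
    moved along segments. This gives irreducibility ([irreducible_path]) and the
    density of the points of maximal rank ([closure_rank_eq_locus]). A chain of
    the expected length [\sum_e (m e - r e) * (n e - r e)] is obtained by letting
    the entries of the lower right corners of the blocks vary freely, one after
    the other; a bordered minor separates consecutive terms ([chain_strict]). No
    chain is longer: the remaining coordinates are algebraically independent on
    the locus ([base_alg_indep]), every step of a chain of irreducible closed sets
    adds an independent function ([alg_indep_extend]), and more than [N]
    polynomials in [N] variables are dependent ([alg_indep_leq]). *)

(** * Dimensions of quotients *)

Section QuotDim.
Variables (k : fieldType) (U : lmodType k).

Definition is_subspace (B : set U) : Prop :=
  B 0 /\ forall c u v, B u -> B v -> B (c *: u + v).

Lemma subspaceD (B : set U) u v : is_subspace B -> B u -> B v -> B (u + v).
Proof. by case=> _ HB Bu Bv; rewrite -[u]scale1r; apply: HB. Qed.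

Lemma subspaceZ (B : set U) c u : is_subspace B -> B u -> B (c *: u).
Proof. by case=> B0 HB Bu; rewrite -[c *: u]addr0; apply: HB. Qed.

Lemma subspaceN (B : set U) u : is_subspace B -> B u -> B (- u).
Proof. by move=> HB Bu; rewrite -scaleN1r; apply: subspaceZ. Qed.

Lemma subspaceB (B : set U) u v : is_subspace B -> B u -> B v -> B (u - v).
Proof. by move=> HB Bu Bv; apply: subspaceD => //; apply: subspaceN. Qed.

Lemma subspace_sum (B : set U) (I : Type) (r : seq I) (P : pred I)
    (F : I -> U) :
  is_subspace B -> (forall i, P i -> B (F i)) -> B (\sum_(i <- r | P i) F i).
Proof.
move=> HB BF; apply: (big_ind B) => //; first by case: HB.
by move=> u v; apply: subspaceD.
Qed.

(** Express each of two bases in the other one: the product of the matrices is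
    the identity, because coordinates in a basis are unique. *)
Lemma has_quot_dim_leq (Z B : set U) d d' : is_subspace B ->
  has_quot_dim Z B d -> has_quot_dim Z B d' -> (d <= d')%N.
Proof.
move=> HB [e [Ze He]] [e' [Ze' He']].
have /choice[A HA] : forall i, exists c : 'rV[k]_d',
    B (e i - \sum_j c 0 j *: e' j).
    by move=> i; have [c [Bc _]] := He' _ (Ze i); exists c.
have /choice[A' HA'] : forall i, exists c : 'rV[k]_d,
    B (e' i - \sum_j c 0 j *: e j).
    by move=> i; have [c [Bc _]] := He _ (Ze' i); exists c.
pose M := \matrix_i A i; pose M' := \matrix_i A' i.
suff M1 : M *m M' = 1%:M.
  by rewrite -(@mxrank1 k d) -M1 (leq_trans (mxrankM_maxl _ _)) ?rank_leq_col.
apply/row_matrixP => i; rewrite row1.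
have [c [_ cU]] := He _ (Ze i).
transitivity c; last first.
  apply: cU; rewrite (bigD1 i) //= mxE !eqxx scale1r big1 ?addr0 ?subrr.
    by case: HB.
  by move=> j ji; rewrite mxE eqxx (negbTE ji) scale0r.
symmetry; apply: cU.
have -> : e i - \sum_j row i (M *m M') 0 j *: e j =
    (e i - \sum_l A i 0 l *: e' l) +
    \sum_l A i 0 l *: (e' l - \sum_j A' l 0 j *: e j).
  have -> : \sum_l A i 0 l *: (e' l - \sum_j A' l 0 j *: e j) =
     \sum_l A i 0 l *: e' l - \sum_l A i 0 l *: \sum_j A' l 0 j *: e j.
    by rewrite -sumrB; apply: eq_bigr => l _; rewrite scalerBr.
  rewrite addrA subrK; congr (_ - _).
  under [RHS]eq_bigr do rewrite scaler_sumr.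
  rewrite exchange_big /=; apply: eq_bigr => j _.
  rewrite !mxE scaler_suml; apply: eq_bigr => l _.
  by rewrite !mxE scalerA.
apply: subspaceD => //; apply: subspace_sum => // l _.
exact: subspaceZ.
Qed.

Lemma quot_dimE (Z B : set U) d :
  is_subspace B -> has_quot_dim Z B d -> quot_dim Z B = d.
Proof.
move=> HB Hd; rewrite /quot_dim; case: xgetP => [d' -> Hd'|/(_ d)//].
by apply/eqP; rewrite eqn_leq !(@has_quot_dim_leq Z B).
Qed.

(** The dimension is computed in coordinates: the conditions on [psi] say that it
    identifies the quotient of the row spaces [vz] and [vb] with [Z/B]. *)
Lemma quot_dim_coord (Z B : set U) n p q (psi : {linear 'rV[k]_n -> U})
    (vz : 'M[k]_(p, n)) (vb : 'M[k]_(q, n)) :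
  is_subspace B -> (vb <= vz)%MS ->
  (forall v : 'rV_n, (v <= vz)%MS -> Z (psi v)) ->
  (forall z, Z z -> exists2 v : 'rV_n, (v <= vz)%MS & B (z - psi v)) ->
  (forall v : 'rV_n, (v <= vz)%MS -> B (psi v) <-> (v <= vb)%MS) ->
  quot_dim Z B = (\rank vz - \rank vb)%N.
Proof.
move=> HB vbz psiZ Zpsi psiB; apply: quot_dimE => //.
have -> : (\rank vz - \rank vb)%N = \rank (vz :\: vb)%MS.
  by rewrite -(mxrank_cap_compl vz vb) (capmx_idPr vbz) addKn.
set C := (vz :\: vb)%MS; set E := row_base C.
have EC : (E :=: C)%MS := eq_row_base C.
have Evz : (E <= vz)%MS by rewrite EC diffmxSl.
pose e i := psi (row i E).
have eE (c : 'rV_(\rank C)) : \sum_i c 0 i *: e i = psi (c *m E).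
  rewrite mulmx_sum_row linear_sum; apply: eq_bigr => i _.
  by rewrite linearZ.
exists e; split=> [i|z /Zpsi[v vvz Bv]].
  by apply: psiZ; apply: submx_trans Evz; apply: row_sub.
have /sub_addsmxP[[c1 c2] /= vE] : (v <= vz :&: vb + C)%MS.
  by rewrite addsmxC addsmx_diff_cap_eq.
have {c1 vE}[v1 v1b vE] : exists2 v1, (v1 <= vb)%MS & v = v1 + c2 *m C.
  exists (c1 *m (vz :&: vb)%MS) => //.
  by apply: submx_trans (capmxSr vz vb); apply: submxMl.
have /submxP[c cE] : (c2 *m C <= E)%MS by rewrite EC submxMl.
exists c; split=> [|c' Bc'].
  rewrite /= eE -cE -[psi _](addrK (psi v1)) -linearD [_ + v1]addrC -vE.
  rewrite opprB addrCA addrC; apply: subspaceD => //.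
  by apply/psiB => //; apply: submx_trans vbz.
have : ((c - c') *m E <= vb :&: C)%MS.
  have -> : ((c - c') *m E <= vb :&: C)%MS = ((c - c') *m E <= vb)%MS.
    by rewrite sub_capmx andb_idr // => _; apply: submx_trans (submxMl _ _) _;
      rewrite EC.
  apply/psiB.
    by apply: submx_trans Evz; rewrite submxMl.
  rewrite mulmxBl linearB -!eE.
  have -> : \sum_i c 0 i *: e i - \sum_i c' 0 i *: e i =
    (z - \sum_i c' 0 i *: e i) - (z - psi v) - psi v1.
    rewrite opprB [z - _ + _]addrC subrKA eE -cE vE linearD.
    by rewrite [psi v1 + _]addrC addrAC addrK.
  apply: subspaceB => //; first exact: subspaceB.
  by apply/psiB => //; apply: submx_trans vbz.
rewrite capmxC capmx_diff submx0 => /eqP E0.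
have: row_free E by rewrite row_base_free.
by move/row_free_inj => /(_ _ (c - c') 0); rewrite mul0mx E0 => /(_ erefl)/eqP;
  rewrite subr_eq0 => /eqP.
Qed.

End QuotDim.

(** Start from the zero matrix, and add a vector of the subspace to the row space
    as long as one is missing. *)
Lemma subspace_mx (k : fieldType) n (A : set 'rV[k]_n) : is_subspace A ->
  exists M : 'M[k]_n, forall v : 'rV_n, (v <= M)%MS <-> A v.
Proof.
move=> HA.
suff H d (M : 'M[k]_n) : (n - \rank M <= d)%N ->
    (forall v : 'rV_n, (v <= M)%MS -> A v) ->
    exists M : 'M[k]_n, forall v : 'rV_n, (v <= M)%MS <-> A v.
  apply: (H n 0); first exact: leq_subr.
  by move=> v; rewrite submx0 => /eqP ->; case: HA.
elim: d M => [|d IH] M rM MA.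
  exists M => v; split; [exact: MA|move=> _].
  by apply: submx_full; rewrite -col_leq_rank -subn_eq0 -leqn0.
have [AM|/existsNP[v /not_implyP[Av /negP vM]]] :=
  pselect (forall v : 'rV_n, A v -> (v <= M)%MS).
  by exists M => v; split; [apply: MA|apply: AM].
apply: (IH (M + v)%MS) => [|u /sub_addsmxP[[c1 c2] /= ->]]; last first.
  apply: subspaceD => //; first by apply: MA; rewrite submxMl.
  by rewrite [c2]mx11_scalar mul_scalar_mx; apply: subspaceZ.
have: (M < M + v)%MS by rewrite ltmxE addsmxSl /= addsmx_sub submx_refl.
by rewrite ltmxErank => /andP[_ lt]; lia.
Qed.

(** * Homogeneous polynomials in two variables *)

Section Bivariate.
Variable F : fieldType.
Local Notation R := {mpoly F[2]}.

Definition mnm2 (a b : nat) : 'X_{1..2} := [multinom [tuple a; b]].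

Lemma mnm2x a b : mnm2 a b ix = a. Proof. by []. Qed.

Lemma mnm2y a b : mnm2 a b iy = b. Proof. by []. Qed.

Lemma ord2P (P : 'I_2 -> Prop) : P ix -> P iy -> forall i, P i.
Proof.
move=> Px Py; case=> [[|[|i]]] // lt2.
  by have <- : ix = Ordinal lt2 by apply: val_inj.
by have <- : iy = Ordinal lt2 by apply: val_inj.
Qed.

Lemma sum_ord2 (V : zmodType) (f : 'I_2 -> V) : \sum_i f i = f ix + f iy.
Proof.
rewrite big_ord_recl big_ord1; congr (f _ + f _); exact: val_inj.
Qed.

Lemma mnm2_eta (m : 'X_{1..2}) : m = mnm2 (m ix) (m iy).
Proof. by apply/mnmP; apply: ord2P; rewrite ?mnm2x ?mnm2y. Qed.

Lemma mnm2_inj a b c d : mnm2 a b = mnm2 c d -> a = c /\ b = d.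
Proof. by move=> E; rewrite -(mnm2x a b) -{2}(mnm2y a b) E. Qed.

Lemma mnm2_eq a b c d : (mnm2 a b == mnm2 c d) = (a == c) && (b == d).
Proof. by apply/eqP/andP=> [/mnm2_inj[-> ->]|[/eqP-> /eqP->]]. Qed.

Lemma mdeg2 (m : 'X_{1..2}) : mdeg m = (m ix + m iy)%N.
Proof.
rewrite mdegE big_ord_recl big_ord1.
by congr (m _ + m _)%N; apply: val_inj.
Qed.

Lemma monE a b : mon F a b = 'X_[mnm2 a b].
Proof.
rewrite /mon [RHS]mpolyXE_id big_ord_recl big_ord1.
have -> : lift ord0 ord0 = iy :> 'I_2 by apply: val_inj.
by rewrite mnm2x mnm2y.
Qed.

Lemma mulX_mon a b : 'X_ix * mon F a b = mon F a.+1 b.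
Proof. by rewrite /mon exprS mulrA. Qed.

Lemma mulY_mon a b : 'X_iy * mon F a b = mon F a b.+1.
Proof. by rewrite /mon exprS mulrCA. Qed.

Lemma mcoeff_mon a b c d : (mon F a b)@_(mnm2 c d) = ((a == c) && (b == d))%:R.
Proof. by rewrite monE mcoeffX mnm2_eq. Qed.

(** [hz e q] is [y ^ e * q(x / y)], truncated in degrees above [e]; [dh e f]
    is the univariate polynomial of the degree [e] component of [f]. *)
Definition hz (e : nat) (q : {poly F}) : R := \sum_(a < e.+1) q`_a *: mon F a (e - a).

Definition dh (e : nat) (f : R) : {poly F} := \poly_(a < e.+1) f@_(mnm2 a (e - a)).

Lemma hz_is_linear e : linear (hz e).
Proof.
move=> c p q; rewrite /hz scaler_sumr -big_split; apply: eq_bigr => a _ /=.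
by rewrite coefD coefZ scalerDl scalerA.
Qed.
HB.instance Definition _ e := GRing.isLinear.Build F {poly F} R _ (hz e) (hz_is_linear e).

Lemma dh_is_linear e : linear (dh e).
Proof.
move=> c p q; apply/polyP => a; rewrite coefD coefZ !coef_poly.
by case: ifP; rewrite ?mulr0 ?addr0 // mcoeffD mcoeffZ.
Qed.
HB.instance Definition _ e := GRing.isLinear.Build F R {poly F} _ (dh e) (dh_is_linear e).

Lemma size_dh e f : (size (dh e f) <= e.+1)%N.
Proof. exact: size_poly. Qed.

Lemma mcoeff_hz e q a b :
  (hz e q)@_(mnm2 a b) = if (a + b == e)%N then q`_a else 0.
Proof.
rewrite /hz raddf_sum /=; under eq_bigr do rewrite mcoeffZ mcoeff_mon.
have [ae|ae] := ltnP a e.+1; last first.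
  rewrite big1; first by case: eqP => // E; lia.
  move=> i _; case: eqP => [E|]; last by rewrite mulr0.
  by have := ltn_ord i; lia.
rewrite (bigD1 (Ordinal ae)) //= eqxx big1 ?addr0 => [|i ia].
  by rewrite (_ : (_ == b) = (a + b == e)%N); [case: eqP; rewrite ?mulr1 ?mulr0|lia].
case: eqP => [E|]; last by rewrite mulr0.
by case/eqP: ia; apply: val_inj.
Qed.

Lemma hz_homog e q : hz e q \is e.-homog.
Proof.
apply/dhomogP => m; rewrite mcoeff_msupp [m in _@_m]mnm2_eta mcoeff_hz -mdeg2.
by case: ifP => [/eqP //|_]; rewrite eqxx.
Qed.

Lemma dh_hz e e' (q : {poly F}) : dh e (hz e' q) = if e == e' then take_poly e.+1 q else 0.
Proof.
apply/polyP => a; rewrite coef_poly; case: (eqVneq e e') => [<-|ee'].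
  rewrite coef_take_poly; case: ifP => // ae.
  by rewrite mcoeff_hz subnKC ?eqxx.
rewrite coef0; case: ifP => // ae.
by rewrite mcoeff_hz subnKC // (negbTE ee').
Qed.

Lemma hzK e (q : {poly F}) : (size q <= e.+1)%N -> dh e (hz e q) = q.
Proof. by move=> sq; rewrite dh_hz eqxx take_poly_id. Qed.

Lemma mcoeff_hz_dh e f m : (hz e (dh e f))@_m = if mdeg m == e then f@_m else 0.
Proof.
rewrite [m]mnm2_eta mcoeff_hz mdeg2 !mnm2x !mnm2y; case: eqP => // <-.
by rewrite coef_poly addKn ltnS leq_addr.
Qed.

Lemma dhK e f : f \is e.-homog -> hz e (dh e f) = f.
Proof.
move=> fe; apply/mpolyP => m; rewrite mcoeff_hz_dh; case: eqP => // /eqP me.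
by rewrite (dhomog_nemf_coeff fe).
Qed.

Lemma sum_hz_dh f : f = \sum_(e < msize f) hz e (dh e f).
Proof.
apply/mpolyP => m; rewrite raddf_sum /=.
under eq_bigr do rewrite mcoeff_hz_dh.
have [mf|mf] := ltnP (mdeg m) (msize f).
  rewrite (bigD1 (Ordinal mf)) //= eqxx big1 ?addr0 // => i im.
  by rewrite ifN // eq_sym.
rewrite big1 ?memN_msupp_eq0 ?msize_mdeg_ge // => i _.
by rewrite ifN //; apply: contraTN mf => /eqP ->; rewrite -ltnNge.
Qed.

Lemma coef_dh e f a : (dh e f)`_a = if (a < e.+1)%N then f@_(mnm2 a (e - a)) else 0.
Proof. exact: coef_poly. Qed.

Lemma dh_mulX e f : dh e.+1 ('X_ix * f) = 'X * dh e f.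
Proof.
apply/polyP => a; rewrite coefXM !coef_dh mulrC; case: a => [|a] /=.
  by apply: coefMX0.
rewrite ltnS subSS; case: ifP => // _.
rewrite (_ : mnm2 a.+1 (e - a) = (U_(ix) + mnm2 a (e - a))%MM) ?mcoeffMX //.
by apply/mnmP; apply: ord2P; rewrite mnmDE mnm1E ?mnm2x ?mnm2y.
Qed.

Lemma dh_mulY e f : dh e.+1 ('X_iy * f) = dh e f.
Proof.
apply/polyP => a; rewrite !coef_dh mulrC; case: (ltnP a e.+1) => ae.
  rewrite ltnW // (_ : mnm2 a (e.+1 - a) = (U_(iy) + mnm2 a (e - a))%MM) ?mcoeffMX //.
  by apply/mnmP; apply: ord2P; rewrite mnmDE mnm1E ?mnm2x ?mnm2y // subSn.
case: ifP => // ae2; rewrite (_ : (e.+1 - a)%N = 0%N); last by lia.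
exact: coefMX0.
Qed.

Lemma dh0_mulX f : dh 0 ('X_ix * f) = 0.
Proof.
apply/polyP => a; rewrite coef_dh coef0; case: ifP => // a0.
by rewrite mulrC coefMX0 // mnm2x; lia.
Qed.

Lemma dh0_mulY f : dh 0 ('X_iy * f) = 0.
Proof.
apply/polyP => a; rewrite coef_dh coef0; case: ifP => // a0.
by rewrite mulrC coefMX0 // mnm2y; lia.
Qed.

Lemma hz_mulX e (q : {poly F}) : hz e.+1 ('X * q) = 'X_ix * hz e q.
Proof.
rewrite /hz big_ord_recl coefXM scale0r add0r mulr_sumr; apply: eq_bigr => a _.
by rewrite coefXM -scalerAr mulX_mon subSS.
Qed.

Lemma hz_mulY e (q : {poly F}) : (size q <= e.+1)%N -> hz e.+1 q = 'X_iy * hz e q.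
Proof.
move=> sq; rewrite /hz big_ord_recr /= (_ : q`_e.+1 = 0) ?scale0r ?addr0; last first.
  by rewrite nth_default.
rewrite mulr_sumr; apply: eq_bigr => a _.
by rewrite -scalerAr mulY_mon subSn // -ltnS.
Qed.

Lemma hz_mulYn e n (q : {poly F}) : (size q <= e.+1)%N -> hz (e + n) q = 'X_iy ^+ n * hz e q.
Proof.
move=> sq; elim: n => [|n IH]; first by rewrite addn0 mul1r.
by rewrite addnS hz_mulY ?IH ?exprS ?mulrA // (leq_trans sq) // ltnS leq_addr.
Qed.

Lemma dh_pihomog e d f : dh e (pihomog mdeg d f) = if e == d then dh e f else 0.
Proof.
have H m : (pihomog mdeg d f)@_m = if mdeg m == d then f@_m else 0.
  have -> : pihomog mdeg d f = hz d (dh d f).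
    rewrite {1}[f]sum_hz_dh raddf_sum /=.
    have [df|df] := ltnP d (msize f).
      rewrite (bigD1 (Ordinal df)) //= pihomog_dE ?hz_homog // big1 ?addr0 // => i id.
      by apply: pihomog_ne0 (hz_homog _ _).
    rewrite big1 => [|i _].
      apply/mpolyP => m'; rewrite mcoeff_hz_dh mcoeff0; case: eqP => // E.
      by rewrite memN_msupp_eq0 // msize_mdeg_ge // E.
    by apply: pihomog_ne0 (hz_homog _ _); rewrite neq_ltn (leq_trans (ltn_ord i)).
  by rewrite mcoeff_hz_dh.
apply/polyP => a; rewrite coef_dh H mdeg2 mnm2x mnm2y.
case: (ltnP a e.+1) => ae; last by case: ifP; rewrite ?coef_dh ?coef0 // ltnNge ae.
rewrite subnKC //; case: ifP => _; last by rewrite coef0.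
by rewrite coef_dh ae.
Qed.

Lemma mem_msupp_dh f m : (m \in msupp f) = ((dh (mdeg m) f)`_(m ix) != 0).
Proof. by rewrite mcoeff_msupp coef_dh mdeg2 ltnS leq_addr addKn -mnm2_eta. Qed.

End Bivariate.

(** * Hilbert function and Betti numbers of an ideal *)

Section Ideal.
Variable F : fieldType.
Local Notation R := {mpoly F[2]}.
Implicit Types (J : set R) (f : R).

Lemma ideal_subspace J : is_ideal J -> is_subspace J.
Proof.
case=> J0 JD JM; split=> // c u v Ju Jv; apply: JD => //.
by rewrite -mul_mpolyC; apply: JM.
Qed.

Lemma is_ideal_gen (S : set R) : is_ideal (ideal_gen S).
Proof.
split=> [T [[]]//|f g Sf Sg T TS|r f Sf T TS].
  by have [[_ TD _] _] := TS; apply: TD; [apply: Sf|apply: Sg].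
by have [[_ _ TM] _] := TS; apply: TM; apply: Sf.
Qed.

Lemma sub_ideal_gen (S : set R) : S `<=` ideal_gen S.
Proof. by move=> f Sf T [_]; apply. Qed.

Lemma ideal_gen_min (S J : set R) : is_ideal J -> S `<=` J -> ideal_gen S `<=` J.
Proof. by move=> HJ SJ f; apply. Qed.

Lemma twist0P e f : twist 0 e f <-> f \is e.-homog.
Proof.
split=> [H|/dhomogP H m mf]; last by rewrite addn0 (H m mf).
by apply/dhomogP => m mf; rewrite -(H m mf) addn0.
Qed.

Lemma twistS d e f : twist d.+1 e.+1 f <-> twist d e f.
Proof.
by split=> H m /H; rewrite addnS; [case|move=> ->].
Qed.

Lemma twist_gt d e f : (e < d)%N -> twist d e f -> f = 0.
Proof.
move=> ed H; apply/mpolyP => m; rewrite mcoeff0; apply: memN_msupp_eq0.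
by apply/negP => /H E; move: ed; rewrite -E; lia.
Qed.

Lemma ffmul_kdiff0 (w : {ffun 'I_'C(2, 1) -> R}) i :
  ffmul (kdiff F 0) w i = 'X_ix * w ix + 'X_iy * w iy.
Proof.
rewrite ffunE (@sum_ord2 _ (fun a => w a * _)) !mxE.
by rewrite mulrC [w iy * _]mulrC.
Qed.

Lemma ffmul_kdiff1 (w : {ffun 'I_'C(2, 2) -> R}) j :
  ffmul (kdiff F 1) w j = w ord0 * (if j == ix then 'X_iy else - 'X_ix).
Proof. by rewrite ffunE (@big_ord1 _ _ _ (fun a => w a * _)) mxE. Qed.

Lemma ffmul_subspace m n (D : 'M[R]_(m, n)) (A : set {ffun 'I_m -> R}) :
  is_subspace A -> is_subspace [set ffmul D w | w in A].
Proof.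
move=> HA; split=> [|c _ _ [u Au <-] [v Av <-]].
  exists 0; first by case: HA.
  by apply/ffunP => i; rewrite !ffunE big1 // => j _; rewrite ffunE mul0r.
exists (c *: u + v); first by case: HA => _; apply.
apply/ffunP => i; rewrite !ffunE scaler_sumr -big_split; apply: eq_bigr => j _.
by rewrite !ffunE mulrDl scalerAl.
Qed.

Lemma tor_chain_subspace J i e : is_ideal J ->
  is_subspace (@tor_chain F (koszul F) J i e).
Proof.
move=> HJ; have [J0 JL] := ideal_subspace HJ.
split=> [a|c u v Hu Hv a]; rewrite !ffunE.
  by split=> // m; rewrite msupp0.
have [[Ju Tu] [Jv Tv]] := (Hu a, Hv a); split; first exact: JL.
by move=> m /msuppD_le; rewrite mem_cat => /orP[/msuppZ_le|]; [apply: Tu|apply: Tv].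
Qed.

Lemma tor_boundary_subspace J i e : is_ideal J ->
  is_subspace (@tor_boundary F (koszul F) J i e).
Proof. by move=> HJ; apply: ffmul_subspace; apply: tor_chain_subspace. Qed.

(** The pieces of degree [e] of [J] and of the product of [J] with the ideal
    generated by x and y, where y is set to 1. *)
Definition piece J e : set {poly F} := [set q : {poly F} | (size q <= e.+1)%N /\ J (hz e q)].

Definition mpiece J e : set {poly F} :=
  if e is e'.+1 then
    [set q | exists q1 q2, [/\ piece J e' q1, piece J e' q2 & q = 'X * q1 + q2]]
  else [set 0].

Definition cst_hz n e (psi : 'rV[F]_n -> {poly F}) v : {ffun 'I_'C(2, 0) -> R} :=
  [ffun=> hz e (psi v)].

Lemma cst_hz_is_linear n e (psi : {linear 'rV[F]_n -> {poly F}}) :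
  linear (cst_hz e psi).
Proof. by move=> c u v; apply/ffunP => i; rewrite !ffunE !linearP. Qed.
HB.instance Definition _ n e (psi : {linear 'rV[F]_n -> {poly F}}) :=
  GRing.isLinear.Build F 'rV[F]_n {ffun 'I_'C(2, 0) -> R} _ (cst_hz e psi)
    (cst_hz_is_linear e psi).

Lemma tor_boundary0E J e (q : {poly F}) : is_ideal J -> (size q <= e.+1)%N ->
  @tor_boundary F (koszul F) J 0 e [ffun=> hz e q] <-> mpiece J e q.
Proof.
move=> HJ sq; case: e sq => [|e] sq /=; split.
- case=> w Hw /ffunP/(_ ord0); rewrite ffmul_kdiff0 ffunE.
  have w0 i : w i = 0 by have [_] := Hw i; apply: twist_gt.
  by rewrite !w0 !mulr0 addr0 => /(congr1 (@dh F 0)); rewrite hzK // raddf0.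
- move=> ->; exists 0; first by case: (tor_chain_subspace 1 0 HJ).
  by apply/ffunP => i; rewrite ffmul_kdiff0 !ffunE raddf0 !mulr0 addr0.
- case=> w Hw /ffunP/(_ ord0); rewrite ffmul_kdiff0 ffunE.
  have Hwi i : piece J e (dh e (w i)) /\ w i = hz e (dh e (w i)).
    have [Jw /twistS/twist0P hw] := Hw i.
    by rewrite /piece /= dhK // size_dh.
  have [[H0 E0] [H1 E1]] := (Hwi ix, Hwi iy).
  move=> /(congr1 (@dh F e.+1)); rewrite hzK // => <-.
  exists (dh e (w ix)), (dh e (w iy)); split=> //.
  by rewrite raddfD /= dh_mulX dh_mulY.
- case=> q1 [q2 [[s1 J1] [s2 J2] ->]].
  exists [ffun i : 'I_2 => if i == ix then hz e q1 else hz e q2].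
    move=> i; rewrite ffunE; split; first by case: ifP.
    by apply/twistS/twist0P; case: ifP => _; apply: hz_homog.
  apply/ffunP => i; rewrite ffmul_kdiff0 !ffunE /=.
  by rewrite raddfD /= hz_mulX hz_mulY.
Qed.

(** The form in which [betti J 0 e] is computed below: coordinates for the
    quotient of [piece J e] by [mpiece J e]. *)
Lemma betti0_coord J e n p r (psi : {linear 'rV[F]_n -> {poly F}})
    (vz : 'M[F]_(p, n)) (vb : 'M[F]_(r, n)) :
  is_ideal J -> (vb <= vz)%MS ->
  (forall v : 'rV_n, (v <= vz)%MS -> piece J e (psi v)) ->
  (forall q, piece J e q ->
    exists2 v : 'rV_n, (v <= vz)%MS & mpiece J e (q - psi v)) ->
  (forall v : 'rV_n, (v <= vz)%MS -> mpiece J e (psi v) <-> (v <= vb)%MS) ->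
  betti J 0 e = (\rank vz - \rank vb)%N.
Proof.
move=> HJ vbz psiZ Zpsi psiB; rewrite /betti /tor_dim.
apply: (quot_dim_coord (psi := cst_hz e psi)) => //.
- exact: tor_boundary_subspace.
- move=> v vvz i; rewrite ffunE; have [_ Jv] := psiZ v vvz.
  by split=> //; apply/twist0P; apply: hz_homog.
- move=> z /(_ ord0)[Jz /twist0P zh].
  have [v vvz Bv] : exists2 v : 'rV_n, (v <= vz)%MS & mpiece J e (dh e (z ord0) - psi v).
    by apply: Zpsi; rewrite /piece /= size_dh dhK.
  exists v => //; have [sv _] := psiZ v vvz.
  have -> : z - cst_hz e psi v = [ffun=> hz e (dh e (z ord0) - psi v)].
    by apply/ffunP => i; rewrite [i]ord1 !ffunE raddfB /= dhK.
  apply/tor_boundary0E => //.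
  by rewrite (leq_trans (size_polyD _ _)) // size_polyN geq_max size_dh.
- move=> v vvz; rewrite -psiB //; apply: tor_boundary0E => //.
  by case: (psiZ v vvz).
Qed.

(** Multiplication by x and by y from degree [e] to degree [e.+1], in the
    monomial bases ordered by the exponent of x. *)
Definition mxX e : 'M[F]_(e.+1, e.+2) := lin1_mx (fun v => poly_rV ('X * rVpoly v)).
Definition mxY e : 'M[F]_(e.+1, e.+2) := lin1_mx (fun v => poly_rV (rVpoly v)).

Lemma size_rVpoly n (v : 'rV[F]_n) : (size (rVpoly v) <= n)%N.
Proof. exact: size_poly. Qed.

Lemma rVpoly_mxX e v : rVpoly (v *m mxX e) = 'X * rVpoly v.
Proof.
have lX : linear (fun v : 'rV[F]_e.+1 => poly_rV ('X * rVpoly v) : 'rV[F]_e.+2).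
  by move=> c u w; rewrite linearP mulrDr -scalerAr linearP.
pose fX := GRing.isLinear.Build F _ _ _ _ lX.
pose f : {linear _ -> _} :=
  HB.pack (fun v : 'rV[F]_e.+1 => poly_rV ('X * rVpoly v) : 'rV[F]_e.+2) fX.
rewrite (mul_rV_lin1 f) poly_rV_K //.
by rewrite (leq_trans (size_polyMleq _ _)) // size_polyX /= ltnS size_rVpoly.
Qed.

Lemma rVpoly_mxY e v : rVpoly (v *m mxY e) = rVpoly v.
Proof.
have lY : linear (fun v : 'rV[F]_e.+1 => poly_rV (rVpoly v) : 'rV[F]_e.+2).
  by move=> c u w; rewrite !linearP.
pose fY := GRing.isLinear.Build F _ _ _ _ lY.
pose f : {linear _ -> _} := HB.pack (fun v : 'rV[F]_e.+1 => poly_rV (rVpoly v) : 'rV[F]_e.+2) fY.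
by rewrite (mul_rV_lin1 f) poly_rV_K // (leq_trans (size_rVpoly _)).
Qed.

Lemma rVpoly_inj n : injective (@rVpoly F n).
Proof. exact: can_inj rVpolyK. Qed.

Lemma mxX_free e : row_free (mxX e).
Proof.
rewrite -kermx_eq0; apply/rowV0P => v /sub_kermxP vX.
apply: rVpoly_inj; rewrite raddf0; apply: (@mulfI _ 'X); first by rewrite polyX_eq0.
by rewrite mulr0 -rVpoly_mxX vX raddf0.
Qed.

Lemma mxY_free e : row_free (mxY e).
Proof.
rewrite -kermx_eq0; apply/rowV0P => v /sub_kermxP vY.
by apply: rVpoly_inj; rewrite -rVpoly_mxY vY !raddf0.
Qed.

End Ideal.

Definition hzrow (F : fieldType) e (v : 'rV[F]_e.+1) : {mpoly F[2]} := hz e (rVpoly v).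

Lemma hzrow_is_linear (F : fieldType) e : linear (@hzrow F e).
Proof. by move=> c u v; rewrite /hzrow !linearP. Qed.
HB.instance Definition _ (F : fieldType) e :=
  GRing.isLinear.Build F 'rV[F]_e.+1 {mpoly F[2]} _ (@hzrow F e) (@hzrow_is_linear F e).

(** The cycles of the Koszul complex in homological degree 1. *)
Definition syz_hz (F : fieldType) e (v : 'rV[F]_e.+1) : {ffun 'I_'C(2, 1) -> {mpoly F[2]}} :=
  [ffun i : 'I_2 => hzrow v * (if i == ix then 'X_iy else - 'X_ix)].

Lemma syz_hz_is_linear (F : fieldType) e : linear (@syz_hz F e).
Proof.
by move=> c u v; apply/ffunP => i; rewrite !ffunE linearP mulrDl scalerAl.
Qed.
HB.instance Definition _ (F : fieldType) e :=
  GRing.isLinear.Build F 'rV[F]_e.+1 {ffun 'I_'C(2, 1) -> {mpoly F[2]}} _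
    (@syz_hz F e) (@syz_hz_is_linear F e).

Section Pieces.
Variables (F : fieldType) (J : set {mpoly F[2]}) (HJ : is_ideal J).
Local Notation R := {mpoly F[2]}.
Variable M : forall e, 'M[F]_e.+1.
Hypothesis HM : forall e (v : 'rV_e.+1), (v <= M e)%MS <-> J (hz e (rVpoly v)).

Local Notation MX e := (M e *m mxX F e).
Local Notation MY e := (M e *m mxY F e).

Lemma pieceP e (q : {poly F}) :
  piece J e q <-> (size q <= e.+1)%N /\ (poly_rV q <= M e)%MS.
Proof. by split=> -[sq H]; split=> //; move: H; rewrite HM poly_rV_K. Qed.

Lemma piece_rVpoly e (v : 'rV_e.+1) : piece J e (rVpoly v) <-> (v <= M e)%MS.
Proof. by rewrite HM; split=> [[]//|Jv]; split=> //; apply: size_rVpoly. Qed.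

Lemma piece_mulX e (q : {poly F}) : piece J e q -> piece J e.+1 ('X * q).
Proof.
case=> sq Jq; split; last by rewrite hz_mulX; case: HJ => _ _; apply.
by rewrite (leq_trans (size_polyMleq _ _)) // size_polyX.
Qed.

Lemma piece_mulY e (q : {poly F}) : piece J e q -> piece J e.+1 q.
Proof.
case=> sq Jq; split; last by rewrite hz_mulY //; case: HJ => _ _; apply.
exact: leq_trans sq _.
Qed.

Lemma mpiece_rVpoly e (v : 'rV_e.+2) :
  mpiece J e.+1 (rVpoly v) <-> (v <= MX e + MY e)%MS.
Proof.
split=> [[q1 [q2 [/pieceP[s1 H1] /pieceP[s2 H2] E]]]|].
  have -> : v = poly_rV q1 *m mxX F e + poly_rV q2 *m mxY F e.
    by apply: rVpoly_inj; rewrite raddfD /= rVpoly_mxX rVpoly_mxY !poly_rV_K.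
  by apply: addmx_sub_adds; apply: submxMr.
case/sub_addsmxP => -[c1 c2] /= ->; exists (rVpoly (c1 *m M e)), (rVpoly (c2 *m M e)).
split; try (by apply/piece_rVpoly; apply: submxMl).
by rewrite raddfD /= !mulmxA rVpoly_mxX rVpoly_mxY.
Qed.

Lemma MXY_sub e : (MX e + MY e <= M e.+1)%MS.
Proof.
apply/rV_subP => v /mpiece_rVpoly[q1 [q2 [H1 H2 E]]].
have [s1 J1] := piece_mulX H1; have [s2 J2] := piece_mulY H2.
by apply/HM; rewrite E raddfD /=; case: HJ => _ HD _; apply: HD.
Qed.

Lemma betti00 : betti J 0 0 = \rank (M 0).
Proof.
rewrite (betti0_coord (psi := @rVpoly F 1) (vz := M 0) (vb := 0 : 'M_1)) //.
- by rewrite mxrank0 subn0.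
- exact: sub0mx.
- by move=> v /piece_rVpoly.
- move=> q /pieceP[sq qM]; exists (poly_rV q) => //=.
  by rewrite poly_rV_K // subrr.
- move=> v _ /=; rewrite submx0; split=> [v0|/eqP ->]; last by rewrite raddf0.
  by apply/eqP/rVpoly_inj; rewrite raddf0.
Qed.

Lemma betti0S e : betti J 0 e.+1 = (\rank (M e.+1) - \rank (MX e + MY e)%MS)%N.
Proof.
apply: (betti0_coord (psi := @rVpoly F e.+2)) => //.
- exact: MXY_sub.
- by move=> v /piece_rVpoly.
- move=> q /pieceP[sq qM]; exists (poly_rV q) => //.
  have -> : q - rVpoly (poly_rV q : 'rV_e.+2) = rVpoly (0 : 'rV_e.+2).
    by rewrite poly_rV_K // subrr raddf0.
  exact/mpiece_rVpoly/sub0mx.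
- by move=> v _; apply: mpiece_rVpoly.
Qed.

Lemma hilbert_funE e : hilbert_fun J e = (e.+1 - \rank (M e))%N.
Proof.
rewrite /hilbert_fun.
rewrite (quot_dim_coord (psi := @hzrow F e) (vz := 1%:M : 'M_e.+1) (vb := M e)) ?mxrank1 //.
- have [J0 JL] := ideal_subspace HJ.
  split=> [|c u v [Ju hu] [Jv hv]]; first by split=> //; apply: dhomog0.
  by split; [apply: JL|apply: dhomogD => //; apply: dhomogZ].
- exact: submx1.
- by move=> v _; apply: hz_homog.
- move=> z hz; exists (poly_rV (dh e z)); first exact: submx1.
  rewrite /= /hzrow poly_rV_K ?size_dh // dhK // subrr; split; last exact: dhomog0.
  by case: HJ.
- move=> v _; rewrite HM; split=> [[]//|Jv]; split=> //; exact: hz_homog.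
Qed.

(** Multiplication by x strictly raises the largest degree in x, so a nonzero
    space of forms grows when it is multiplied by the linear forms. *)
Lemma mx_growth e (W : 'M[F]_e.+1) : W != 0 ->
  (\rank W < \rank (W *m mxX F e + W *m mxY F e)%MS)%N.
Proof.
move=> W0; rewrite ltnNge; apply/negP => H.
have XY : (W *m mxX F e <= W *m mxY F e)%MS.
  apply: (submx_trans (addsmxSl _ (W *m mxY F e))).
  have /mxrank_leqif_sup : (W *m mxY F e <= W *m mxX F e + W *m mxY F e)%MS.
    exact: addsmxSr.
  move=> [_ <-]; rewrite eqn_leq mxrankS ?addsmxSr //=.
  by rewrite [X in (_ <= X)%N]mxrankMfree ?mxY_free.
have [v vW v0] := rowV0Pn W0.
(* As x * W is contained in y * W, all products of an element of W by powers of x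
   have the bounded degree of W, where y is set to 1. *)
have H1 n : exists2 w : 'rV_e.+1, (w <= W)%MS & rVpoly w = 'X^n * rVpoly v.
  elim: n => [|n [w wW E]]; first by exists v; rewrite ?mul1r.
  have /submxP[c cE] : (w *m mxX F e <= W *m mxY F e)%MS.
    by apply: submx_trans XY; apply: submxMr.
  exists (c *m W); first exact: submxMl.
  by rewrite -rVpoly_mxY -mulmxA -cE rVpoly_mxX E exprS mulrA.
have [w _ E] := H1 e.+1; have := size_rVpoly w.
rewrite E mulrC size_mulXn; last first.
  by apply: contraNneq v0 => vE; apply/eqP/rVpoly_inj; rewrite vE raddf0.
rewrite -[X in (_ <= X)%N]addn0 leq_add2l leqn0 size_poly_eq0 => /eqP v0'.
by case/eqP: v0; apply: rVpoly_inj; rewrite v0' raddf0.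
Qed.

Lemma quot_dim_sub0 (U : lmodType F) (Z B : set U) :
  is_subspace B -> Z `<=` B -> quot_dim Z B = 0%N.
Proof.
move=> HB ZB; apply: quot_dimE => //; exists (fun=> 0); split=> [[]//|z Zz].
exists 0; split=> [|c _]; last by apply/rowP => -[].
by rewrite big_ord0 subr0; apply: ZB.
Qed.

(** The forms [h] with [x * h] and [y * h] in [J] give the cycles, and those in [J]
    the boundaries. Multiplication by [x * y] identifies the former with the
    intersection of [x * J] and [y * J], whose dimension follows from that of
    the sum. *)
Lemma betti1E e :
  (betti J 1 e.+2 + \rank (MX e.+1 + MY e.+1)%MS + \rank (M e) =
     2 * \rank (M e.+1))%N.
Proof.
have [N HN] : exists N : 'M[F]_e.+1, forall v : 'rV_e.+1, (v <= N)%MS <->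
    (v *m mxX F e <= M e.+1)%MS /\ (v *m mxY F e <= M e.+1)%MS.
  apply: subspace_mx; split=> [|c u v [u1 u2] [v1 v2]]; first by rewrite !mul0mx !sub0mx.
  by rewrite !mulmxDl -!scalemxAl !addmx_sub ?scalemx_sub.
have XYC : mxX F e *m mxY F e.+1 = mxY F e *m mxX F e.+1.
  apply/row_matrixP => i; rewrite !rowE !mulmxA; apply: rVpoly_inj.
  by rewrite rVpoly_mxY rVpoly_mxX rVpoly_mxX rVpoly_mxY.
have capE : (N *m (mxX F e *m mxY F e.+1) == MX e.+1 :&: MY e.+1)%MS.
  apply/andP; split.
    apply/rV_subP => v /submxP[c ->]; rewrite mulmxA sub_capmx.
    have /HN[cX cY] : (c *m N <= N)%MS by apply: submxMl.
    by rewrite {1}XYC !mulmxA in cX cY *; rewrite !submxMr.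
  apply/rV_subP => u; rewrite sub_capmx => /andP[/submxP[c cE] /submxP[d dE]].
  rewrite !mulmxA in cE dE.
  have E : 'X * rVpoly (c *m M e.+1) = rVpoly (d *m M e.+1).
    by rewrite -(rVpoly_mxX (c *m _)) -(rVpoly_mxY (d *m _)) -cE -dE.
  have sc : (size (rVpoly (c *m M e.+1)) <= e.+1)%N.
    have [->|c0] := eqVneq (rVpoly (c *m M e.+1)) 0; first by rewrite size_poly0.
    by have := size_rVpoly (d *m M e.+1); rewrite -E mulrC size_mulX.
  pose h : 'rV_e.+1 := poly_rV (rVpoly (c *m M e.+1)).
  have hY : h *m mxY F e = c *m M e.+1.
    by apply: rVpoly_inj; rewrite rVpoly_mxY poly_rV_K.
  have hX : h *m mxX F e = d *m M e.+1.
    by apply: rVpoly_inj; rewrite rVpoly_mxX poly_rV_K.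
  rewrite dE -hX -mulmxA; apply: submxMr; apply/HN.
  by rewrite hX hY !submxMl.
have rN : (\rank N + \rank (MX e.+1 + MY e.+1)%MS = 2 * \rank (M e.+1))%N.
  have := mxrank_sum_cap (MX e.+1) (MY e.+1).
  rewrite -(eqmx_rank capE) addnC !mxrankMfree ?mxX_free ?mxY_free //.
    by rewrite addnn mul2n.
  rewrite /row_free mxrankMfree ?mxY_free //; exact: mxX_free.
have MN : (M e <= N)%MS.
  apply/rV_subP => v vM; apply/HN.
  split; [apply: submx_trans (MXY_sub e)|apply: submx_trans (MXY_sub e)].
    by apply: submx_trans (addsmxSl _ _); apply: submxMr.
  by apply: submx_trans (addsmxSr _ _); apply: submxMr.
suff -> : betti J 1 e.+2 = (\rank N - \rank (M e))%N.
  by have := mxrankS MN; rewrite -rN; lia.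
rewrite /betti /tor_dim.
apply: (quot_dim_coord (psi := @syz_hz F e)) => //.
- exact: tor_boundary_subspace.
- move=> v /HN[/HM vX /HM vY]; split=> [i|].
    rewrite ffunE; split.
      case: ifP => _; rewrite /hzrow mulrC.
        by rewrite -hz_mulY ?size_rVpoly // -rVpoly_mxY.
      rewrite mulNr -hz_mulX -rVpoly_mxX.
      by have [_ _ JM] := HJ; rewrite -mulN1r; apply: JM.
    apply/twistS/twist0P.
    case: ifP => _; rewrite /hzrow mulrC.
      by rewrite -hz_mulY ?size_rVpoly //; apply: hz_homog.
    by rewrite mulNr -hz_mulX -rVpoly_mxX dhomogN; apply: hz_homog.
  apply/ffunP => i; rewrite ffmul_kdiff0 !ffunE /= mulrN; ring.
- move=> z [Hz /ffunP/(_ ord0)]; rewrite ffmul_kdiff0 ffunE [X in X + _]mulrC [X in _ + X]mulrC.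
  case/ksyzP => c [zx zy].
  have [Jx /twistS/twist0P hx] := Hz ix; have [Jy /twistS/twist0P hy] := Hz iy.
  pose h := dh e c.
  have zxE : z ix = hz e.+1 h.
    by rewrite -[LHS](dhK hx) zx mulrC dh_mulY.
  have cE : c = hz e h.
    apply: (@mulXI _ iy); rewrite -zx zxE hz_mulY ?size_dh //.
    by rewrite mulrC.
  have zyE : z iy = - hz e.+1 ('X * h) by rewrite zy cE hz_mulX mulrC.
  exists (poly_rV h).
    apply/HN; split; apply/HM; rewrite ?rVpoly_mxX ?rVpoly_mxY poly_rV_K ?size_dh //.
      have [_ _ JM] := HJ; have := JM (-1) _ Jy.
      by rewrite zyE mulN1r opprK.
    by rewrite -zxE.
  have -> : z - syz_hz (poly_rV h : 'rV_e.+1) = 0.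
    apply/eqP; rewrite subr_eq0; apply/eqP/ffunP; apply: ord2P;
      rewrite ffunE /hzrow poly_rV_K ?size_dh //= -cE //.
    by rewrite zy mulrN.
  by case: (tor_boundary_subspace 1 e.+2 HJ).
- move=> v _; split=> [[w Hw E]|/HM vM].
    have [Jw /twistS/twistS/twist0P hw] := Hw ord0.
    have E1 : hz e (rVpoly v) = w ord0.
      move/ffunP/(_ ix): E; rewrite ffmul_kdiff1 ffunE /= /hzrow.
      by move/mulXI.
    by apply/HM; rewrite E1.
  exists [ffun=> hzrow v].
    move=> i; rewrite ffunE; split=> //; apply/twistS/twistS/twist0P; exact: hz_homog.
  by apply/ffunP => i; rewrite ffmul_kdiff1 !ffunE.
Qed.

Lemma betti10 : betti J 1 0 = 0%N.
Proof.
apply: quot_dim_sub0; first exact: tor_boundary_subspace.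
move=> z [Hz _]; have -> : z = 0.
  by apply/ffunP => i; rewrite ffunE; have [_] := Hz i; apply: twist_gt.
by case: (tor_boundary_subspace 1 0 HJ).
Qed.

Lemma betti11 : M 0 = 0 -> betti J 1 1 = 0%N.
Proof.
move=> M0; apply: quot_dim_sub0; first exact: tor_boundary_subspace.
move=> z [Hz _]; have -> : z = 0; last by case: (tor_boundary_subspace 1 1 HJ).
apply/ffunP => i; rewrite ffunE; have [Jz /twistS/twist0P hi] := Hz i.
have : piece J 0 (dh 0 (z i)) by split; rewrite ?dhK // size_dh.
case/pieceP => s; rewrite M0 submx0 => /eqP E.
by rewrite -[LHS](dhK hi) -(poly_rV_K s) E !raddf0.
Qed.

End Pieces.

(** * Staircases of lex-segment ideals *)

(** The exponents of the monomials of a proper lex-segment ideal of finite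
    colength. [stair_lex] is the lex condition for consecutive monomials of the
    same degree. *)
Record lex_stair (P : nat -> nat -> bool) : Prop := LexStair {
  stairX : forall a b, P a b -> P a.+1 b;
  stairY : forall a b, P a b -> P a b.+1;
  stair_lex : forall a b, P a b.+1 -> P a.+1 b;
  stair_proper : ~~ P 0 0;
  stair_fin : exists b, P 0 b }.

Definition stair_ideal (F : fieldType) (P : nat -> nat -> bool) : set {mpoly F[2]} :=
  [set f | forall m, m \in msupp f -> P (m ix) (m iy)].
Arguments stair_ideal : clear implicits.

Lemma stair_ideal_mon (F : fieldType) P a b : stair_ideal F P (mon F a b) <-> P a b.
Proof.
split=> [/(_ (mnm2 a b))|Pab m]; rewrite monE msuppX mem_seq1; last by move/eqP ->.
by apply; rewrite eqxx.
Qed.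

Lemma stair_leq P a b c d : lex_stair P -> (a <= c)%N -> (b <= d)%N -> P a b -> P c d.
Proof.
move=> HP /subnKC <- /subnKC <- Pab.
elim: (c - a)%N => [|n IH]; last by rewrite addnS; apply: (stairX HP).
by rewrite addn0; elim: (d - b)%N => [|n IH]; rewrite ?addn0 // addnS; apply: (stairY HP).
Qed.

Lemma stair_ideal_ideal (F : fieldType) P : lex_stair P -> is_ideal (stair_ideal F P).
Proof.
move=> HP; split=> [m|f g Pf Pg m|r f Pf m]; first by rewrite msupp0.
  by move=> /msuppD_le; rewrite mem_cat => /orP[/Pf|/Pg].
move=> /msuppM_le/allpairsP[[m1 m2] /= [_ /Pf H ->]].
by apply: stair_leq H => //; rewrite mnmDE leq_addl.
Qed.

Lemma ideal_sum_mon (F : fieldType) (J : set {mpoly F[2]}) f : is_ideal J ->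
  (forall m, m \in msupp f -> J 'X_[m]) -> J f.
Proof.
move=> HJ Jm; rewrite [f]mpolyE big_seq; apply: subspace_sum.
  exact: ideal_subspace.
by move=> m mf; apply: subspaceZ; [apply: ideal_subspace|apply: Jm].
Qed.

Lemma monomial_ideal_msupp (F : fieldType) (E : set {mpoly F[2]}) f m :
  monomial_ideal E -> E f -> m \in msupp f -> E 'X_[m].
Proof.
case=> S SE; have HE : is_ideal E by rewrite SE; apply: is_ideal_gen.
pose T := [set f : {mpoly F[2]} | forall m, m \in msupp f -> E 'X_[m]].
suff ET : E `<=` T by move=> /ET; apply.
rewrite {1}SE; apply: ideal_gen_min => [|_ [m' Sm' <-] m'']; last first.
  rewrite msuppX mem_seq1 => /eqP ->; rewrite SE.
  by apply: sub_ideal_gen; exists m'.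
split=> [m'|g h Tg Th m'|r g Tg m']; first by rewrite msupp0.
  by move=> /msuppD_le; rewrite mem_cat => /orP[/Tg|/Th].
move=> /msuppM_le/allpairsP[[m1 m2] /= [_ /Tg H ->]].
by rewrite mpolyXD; case: HE => _ _; apply.
Qed.

(** More powers of y than the colength are dependent modulo [E], and a monomial
    ideal contains every monomial of each of its elements. *)
Lemma finite_colength_powY (F : fieldType) (E : set {mpoly F[2]}) :
  monomial_ideal E -> finite_colength E -> exists b, E (mon F 0 b).
Proof.
move=> HE [d [e [_ He]]].
have HI : is_ideal E by case: HE => S ->; apply: is_ideal_gen.
have /choice[c Hc] : forall i : 'I_d.+1, exists c : 'rV[F]_d,
    E (mon F 0 i - \sum_j c 0 j *: e j).
  by move=> i; have [c [Ec _]] := He (mon F 0 i) Logic.I; exists c.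
pose C := \matrix_i c i.
have /rowV0Pn[u uC u0] : kermx C != 0.
  rewrite kermx_eq0 /row_free; apply: contraTneq (rank_leq_col C) => ->.
  by rewrite -ltnNge.
have {uC} uC : u *m C = 0 by apply/sub_kermxP.
have Eu : E (\sum_i u 0 i *: mon F 0 i).
  have -> : \sum_i u 0 i *: mon F 0 i =
      \sum_i u 0 i *: (mon F 0 i - \sum_j c i 0 j *: e j).
    under [RHS]eq_bigr do rewrite scalerBr.
    rewrite sumrB -[LHS]subr0; congr (_ - _).
    under eq_bigr do rewrite scaler_sumr.
    rewrite exchange_big /= big1 // => j _.
    under eq_bigr do rewrite scalerA.
    have uCj : \sum_i u 0 i * c i 0 j = (u *m C) 0 j.
      by rewrite mxE; apply: eq_bigr => i _; rewrite !mxE.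
    by rewrite -scaler_suml uCj uC mxE scale0r.
  apply: subspace_sum; first exact: ideal_subspace.
  by move=> i _; apply: subspaceZ; [apply: ideal_subspace|].
have [i ui] : exists i, u 0 i != 0.
  by apply/existsP; apply: contraNT u0; rewrite negb_exists => /forallP u0;
    apply/eqP/rowP => i; rewrite mxE; apply/eqP; have := u0 i; rewrite negbK.
exists i; rewrite monE; apply: monomial_ideal_msupp HE Eu _.
rewrite mcoeff_msupp raddf_sum (bigD1 i) //= mcoeffZ mcoeff_mon !eqxx mulr1.
rewrite big1 ?addr0 // => j ji.
by rewrite mcoeffZ mcoeff_mon /= (inj_eq val_inj) (negbTE ji) mulr0.
Qed.

Lemma lex_segment_stair (F : fieldType) (L : set {mpoly F[2]}) :
  lex_segment L -> ~ L 1 -> finite_colength L ->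
  exists2 P, lex_stair P & L = stair_ideal F P.
Proof.
move=> [Lmon Llex] L1 Lfin; pose P a b := `[< L (mon F a b) >].
have HL : is_ideal L by case: Lmon => S ->; apply: is_ideal_gen.
have [_ _ LM] := HL.
exists P.
  split=> [a b /asboolP H|a b /asboolP H|a b /asboolP H||].
  - by apply/asboolP; rewrite -mulX_mon; apply: LM.
  - by apply/asboolP; rewrite -mulY_mon; apply: LM.
  - by apply/asboolP; apply: Llex H; rewrite ?addnS.
  - by apply/asboolPn; rewrite /mon mulr1.
  - by have [b Lb] := finite_colength_powY Lmon Lfin; exists b; apply/asboolP.
apply/seteqP; split=> f Lf.
  move=> m mf; apply/asboolP; rewrite monE -mnm2_eta.
  exact: monomial_ideal_msupp Lmon Lf mf.
apply: ideal_sum_mon => // m /Lf/asboolP.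
by rewrite monE -mnm2_eta.
Qed.

Lemma ideal_ext_stair (k K : fieldType) (iota : {rmorphism k -> K}) P : lex_stair P ->
  ideal_ext iota (stair_ideal k P) = stair_ideal K P.
Proof.
move=> HP; apply/seteqP; split.
  apply: ideal_gen_min; first exact: stair_ideal_ideal.
  move=> _ [f Pf <-] m.
  by rewrite mcoeff_msupp mcoeff_map_mpoly fmorph_eq0 -mcoeff_msupp; apply: Pf.
move=> f Pf; apply: ideal_sum_mon; first exact: is_ideal_gen.
move=> m /Pf Pm; apply: sub_ideal_gen; exists 'X_[m].
  by move=> m'; rewrite msuppX mem_seq1 => /eqP ->.
by rewrite map_mpolyX.
Qed.

Lemma nat_minP (A : set nat) : A !=set0 ->
  A (nat_min A) /\ forall j, A j -> (nat_min A <= j)%N.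
Proof.
move=> [n An]; have exA : exists n, `[< A n >] by exists n; apply/asboolP.
rewrite /nat_min; case: xgetP => [j -> //|/(_ (ex_minn exA))[]].
case: ex_minnP => j /asboolP Aj minj; split=> // l Al.
by apply: minj; apply/asboolP.
Qed.

Section Staircase.
Variables (F : fieldType) (P : nat -> nat -> bool) (HP : lex_stair P).
Local Notation E := (stair_ideal F P).
Local Notation t := (ht E).
Local Notation hm := (hm E).

Lemma stair_powX : exists a, P a 0.
Proof.
suff H a b : P a b -> exists a, P a 0 by have [b /H] := stair_fin HP.
by elim: b a => [|b IH] a Pab; [exists a|apply: IH (stair_lex HP Pab)].
Qed.

Lemma htP : P t 0 /\ forall a, P a 0 -> (t <= a)%N.
Proof.
have [|H1 H2] := @nat_minP [set j | E (mon F j 0)].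
  by have [a Pa] := stair_powX; exists a; apply/stair_ideal_mon.
split=> [|a Pa]; first exact/(stair_ideal_mon F).
by apply: H2; apply/stair_ideal_mon.
Qed.

Lemma hmP i : P (t - i) (hm i) /\ forall b, P (t - i) b -> (hm i <= b)%N.
Proof.
have [|H1 H2] := @nat_minP [set j | E (mon F (t - i) j)].
  have [b Pb] := stair_fin HP; exists b; apply/stair_ideal_mon.
  exact: (stair_leq HP) Pb.
split=> [|b Pb]; first exact/(stair_ideal_mon F).
by apply: H2; apply/stair_ideal_mon.
Qed.

Lemma ht_gt0 : (0 < t)%N.
Proof.
rewrite lt0n; apply: contraNneq (stair_proper HP) => t0.
by have [] := htP; rewrite t0.
Qed.

Lemma hm0 : hm 0 = 0%N.
Proof.
have [_ H] := hmP 0; apply/eqP; rewrite -leqn0; apply: H.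
by rewrite subn0; case: htP.
Qed.

(** The degree of the minimal generator of [E] whose exponent in x is [a], if
    [a <= t]; in general the least degree of a monomial of [E] with that
    exponent. *)
Definition wt a := (a + hm (t - a))%N.

Lemma wtE a : wt a = (a + hm (t - a))%N. Proof. by []. Qed.

Lemma stair_wt a e : (a <= e)%N -> P a (e - a) = (wt a <= e)%N.
Proof.
move=> ae; have [at_|ta] := leqP a t; last first.
  rewrite /wt (_ : t - a = 0)%N ?hm0 ?addn0 ?ae; last by lia.
  by apply: (stair_leq HP) (proj1 htP) => //; apply: ltnW.
have [H1 H2] := hmP (t - a); rewrite subKn // in H1 H2.
rewrite /wt -{2}(subnKC ae) leq_add2l; apply/idP/idP => [/H2//|H].
exact: (stair_leq HP) H1.
Qed.

Lemma wt_ge a : (a <= wt a)%N. Proof. exact: leq_addr. Qed.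

Lemma wt_id a : (t <= a)%N -> wt a = a.
Proof. by rewrite -subn_eq0 /wt => /eqP ->; rewrite hm0 addn0. Qed.

Lemma wtS a : (a < t)%N -> (wt a.+1 <= wt a)%N.
Proof.
move=> at_; have : P a (wt a - a) by rewrite stair_wt ?wt_ge.
have [E0|] := posnP (wt a - a)%N.
  rewrite E0 => Pa; have [_ /(_ _ Pa)] := htP; lia.
move=> H; rewrite -[(wt a - a)%N]prednK // => /(stair_lex HP) Pa.
have := @stair_wt a.+1 (wt a); rewrite (_ : wt a - a.+1 = (wt a - a).-1)%N; last by lia.
by rewrite Pa => <- //; lia.
Qed.

Lemma wt_leq a b : (a <= b <= t)%N -> (wt b <= wt a)%N.
Proof.
case/andP=> /subnKC <-; elim: (b - a)%N => [|n IH]; first by rewrite addn0.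
by rewrite addnS => H; apply: leq_trans (wtS H) (IH (ltnW H)).
Qed.

Lemma wt_ge_t a : (t <= wt a)%N.
Proof.
have [at_|/ltnW ta] := leqP a t; last exact: leq_trans ta (wt_ge a).
by rewrite -{1}(wt_id (leqnn t)); apply: wt_leq; rewrite at_ leqnn.
Qed.

(** The dimension of the piece of degree [e] of the staircase ideal. *)
Definition stair_dim e := #|[set a : 'I_e.+1 | (wt a <= e)%N]%SET|.
(** The rows and the columns of the canonical matrix that carry generators, and
    syzygies, of degree [e]. *)
Definition hrows e : {set 'I_t.+1} := [set i : 'I_t.+1 | wt (t - i) == e]%SET.
Definition hcols e : {set 'I_t} := [set j : 'I_t | (wt (t - j.+1)).+1 == e]%SET.

Lemma stair_dimE e T : (e < T)%N -> stair_dim e = (\sum_(a < T) (wt a <= e))%N.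
Proof.
move=> eT; rewrite /stair_dim -sum1_card big_mkcond /=.
under eq_bigr do rewrite inE /=.
rewrite (big_ord_widen T (fun a => if (wt a <= e)%N then 1 else 0)%N eT) big_mkcond /=.
apply: eq_bigr => a _; case: ltnP; first by case: ifP.
by move=> ea; rewrite leqNgt (leq_trans ea) ?wt_ge.
Qed.

Lemma card_hrows e : #|hrows e| = (\sum_(a < t.+1) (wt a == e))%N.
Proof.
rewrite -sum1_card big_mkcond /= (reindex_inj rev_ord_inj) /=; apply: eq_bigr => a _.
by rewrite inE /= ?subSS subKn -1?ltnS //; case: eqP.
Qed.

Lemma card_hcolsS e : #|hcols e.+1| = (\sum_(a < t) (wt a == e))%N.
Proof.
rewrite -sum1_card big_mkcond /= (reindex_inj rev_ord_inj) /=; apply: eq_bigr => a _.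
rewrite inE /= -subSn // subSS subKn 1?ltnW // eqSS; by case: eqP.
Qed.

Lemma card_hcols0 : #|hcols 0| = 0%N.
Proof. by apply/eqP; rewrite cards_eq0; apply/eqP/setP => j; rewrite !inE. Qed.

Lemma card_hrows_hcols e : #|hrows e| = (#|hcols e.+1| + (t == e))%N.
Proof. by rewrite card_hrows card_hcolsS big_ord_recr /= wt_id. Qed.

(** In degree [e.+1], the monomials whose exponent [a] in x is at most [t] and
    which are not multiples by y are the generators; beyond [t] there is one new
    monomial, the power of x. *)
Lemma stair_dimS e : stair_dim e.+1 = (stair_dim e + #|hrows e.+1| + (t <= e))%N.
Proof.
pose T := (t.+1 + (e - t).+1)%N.
rewrite (@stair_dimE e.+1 T) ?(@stair_dimE e T) ?card_hrows; try by rewrite /T; lia.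
have -> : (\sum_(a < T) (wt a <= e.+1) = \sum_(a < T) (wt a <= e) + \sum_(a < T) (wt a == e.+1))%N.
  rewrite -big_split; apply: eq_bigr => a _ /=.
  by case: ltngtP; lia.
rewrite -addnA; congr (_ + _)%N.
rewrite /T big_split_ord /=; congr (_ + _)%N.
have -> : (\sum_(i < (e - t).+1) (wt (t.+1 + i) == e.+1) = \sum_(i < (e - t).+1) (i + t == e))%N.
  apply: eq_bigr => i _; rewrite wt_id; last by lia.
    by rewrite addSn eqSS addnC.
case: leqP => te; last first.
  by rewrite big1 // => i _; case: eqP => // E1; lia.
have e_t : (e - t < (e - t).+1)%N by [].
rewrite (bigD1 (Ordinal e_t)) //= subnK // eqxx big1 // => i ie.
case: eqP => // E1; case/eqP: ie; apply: val_inj => /=; lia.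
Qed.

Lemma stair_dim_eq0 e : (stair_dim e == 0%N) = (e < t)%N.
Proof.
rewrite cards_eq0; apply/eqP/idP => [/setP K|et]; last first.
  by apply/setP => a; rewrite !inE leqNgt (leq_trans et) // wt_ge_t.
rewrite ltnNge; apply/negP => te.
have := K (Ordinal (te : t < e.+1)%N); rewrite !inE /= wt_id // te.
by [].
Qed.

Lemma card_hrows0 : #|hrows 0| = 0%N.
Proof.
apply/eqP; rewrite cards_eq0; apply/eqP/setP => i; rewrite !inE.
by have := wt_ge_t (t - i); have := ht_gt0; lia.
Qed.

Lemma card_hrows_eq0 e : (wt 0 < e)%N -> #|hrows e| = 0%N.
Proof.
move=> we; apply/eqP; rewrite cards_eq0; apply/eqP/setP => i; rewrite !inE.
have : (wt (t - i) <= wt 0)%N by apply: wt_leq; rewrite leq_subr.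
by move=> H; apply/negP => /eqP H1; lia.
Qed.

Lemma hilbert_stair e : hilbert_fun E e = (e.+1 - stair_dim e)%N.
Proof.
pose N := [set a : 'I_e.+1 | ~~ (wt a <= e)%N]%SET.
have -> : (e.+1 - stair_dim e)%N = #|N|.
  have := cardsC [set a : 'I_e.+1 | (wt a <= e)%N]%SET.
  rewrite card_ord -/(stair_dim e) (_ : ~: _ = N)%SET; first by lia.
  by apply/setP => a; rewrite !inE.
pose S : 'M[F]_(#|N|, e.+1) := \matrix_(i, a) (enum_val i == a)%:R.
have SE (v : 'rV_#|N|) a : (v *m S) 0 a = \sum_(i | enum_val i == a) v 0 i.
  rewrite mxE [RHS]big_mkcond; apply: eq_bigr => i _; rewrite mxE.
  by case: eqP; rewrite ?mulr1 ?mulr0.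
have HE := stair_ideal_ideal F HP.
have memE f : f \is e.-homog -> E f <-> forall a : 'I_e.+1, a \in N -> (dh e f)`_a = 0.
  move=> fe; split=> [Ef a|H m].
    rewrite inE; apply: contraNeq => fa; rewrite -stair_wt -1?ltnS //.
    have [m1 m2] : mdeg (mnm2 a (e - a)) = e /\ mnm2 a (e - a) ix = a.
      by rewrite mdeg2 mnm2x mnm2y subnKC // -ltnS.
    have := Ef (mnm2 a (e - a)); apply.
    by rewrite mem_msupp_dh m1 m2.
  move=> mf; have me : mdeg m = e := dhomog_mf fe mf.
  rewrite mdeg2 in me; have mxe : (m ix < e.+1)%N by lia.
  rewrite (_ : m iy = e - m ix)%N ?stair_wt; try lia.
  apply: contraTT mf => H1; rewrite mem_msupp_dh mdeg2 me negbK.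
  by apply/eqP; apply: (H (Ordinal mxe)); rewrite inE.
rewrite /hilbert_fun.
rewrite (quot_dim_coord (psi := (@hzrow F e \o mulmxr S)%FUN) (vz := 1%:M : 'M_#|N|)
  (vb := 0 : 'M_#|N|)) ?mxrank1 ?mxrank0 ?subn0 //.
- have [J0 JL] := ideal_subspace HE.
  split=> [|c u v [Ju hu] [Jv hv]]; first by split=> //; apply: dhomog0.
  by split; [apply: JL|apply: dhomogD => //; apply: dhomogZ].
- exact: sub0mx.
- by move=> v _; apply: hz_homog.
- move=> z zh; pose w : 'rV[F]_#|N| := \row_i (dh e z)`_(enum_val i : 'I_e.+1).
  exists w; first exact: submx1.
  have h : z - hzrow (w *m S) \is e.-homog.
    by apply: rpredB => //; apply: hz_homog.
  split=> //; apply/memE => // a aN.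
  rewrite linearB coefB /= /hzrow hzK ?size_rVpoly // coef_rVpoly_ord SE.
  rewrite (bigD1 (enum_rank_in aN a)) ?enum_rankK_in //= big1 ?addr0.
    by rewrite mxE enum_rankK_in // subrr.
  move=> i /andP[/eqP iE ia]; case/eqP: ia.
  by apply: enum_val_inj; rewrite enum_rankK_in.
- move=> v _; rewrite submx0; split=> [[Ev hv]|/eqP ->]; last first.
    by rewrite linear0; split; [case: HE|apply: dhomog0].
  apply/eqP/rowP => i; rewrite mxE.
  have /memE := Ev => /(_ hv (enum_val i) (enum_valP i)).
  rewrite /= /hzrow hzK ?size_rVpoly // coef_rVpoly_ord SE => <-.
  rewrite (big_pred1 i) // => j; exact: (inj_eq enum_val_inj).
Qed.

End Staircase.

Lemma ht_stairE (F : fieldType) P : ht (stair_ideal F P) = nat_min [set j | P j 0].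
Proof.
by rewrite /ht; congr nat_min; apply/funext => j; apply/propext/stair_ideal_mon.
Qed.

Lemma wt_stairE (F F' : fieldType) P a : wt F P a = wt F' P a.
Proof.
rewrite /wt /hm !ht_stairE; congr (_ + nat_min _)%N.
by apply/funext => j; rewrite /= !(propext (stair_ideal_mon _ _ _ _)).
Qed.

Lemma card_hrowsE (F F' : fieldType) P e : #|hrows F P e| = #|hrows F' P e|.
Proof.
rewrite !card_hrows !ht_stairE; apply: eq_bigr => a _.
by rewrite (wt_stairE F F').
Qed.

Lemma card_hcolsE (F F' : fieldType) P e : #|hcols F P e| = #|hcols F' P e|.
Proof.
case: e => [|e]; first by rewrite !card_hcols0.
rewrite !card_hcolsS !ht_stairE; apply: eq_bigr => a _.
by rewrite (wt_stairE F F').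
Qed.

(** The difference [betti I 0 - betti I 1] is determined by the Hilbert function,
    so it is the same for [I] and for the lex-segment ideal; and among all spaces
    of forms of given dimension, the lex segments grow the least when multiplied
    by the linear forms. *)
Lemma betti_same_hilbert (F : fieldType) P (I : set {mpoly F[2]}) e :
  lex_stair P -> is_ideal I ->
  (forall e, hilbert_fun I e = hilbert_fun (stair_ideal F P) e) ->
  (betti I 0 e <= #|hrows F P e|)%N /\
  (betti I 1 e + #|hrows F P e| = betti I 0 e + #|hcols F P e|)%N.
Proof.
move=> HP HI HH.
have HM' e' : exists M : 'M[F]_e'.+1, forall v : 'rV_e'.+1,
    (v <= M)%MS <-> I (hz e' (rVpoly v)).
  apply: subspace_mx; have [I0 IL] := ideal_subspace HI.
  by split=> [|c u v Iu Iv] /=; [rewrite !raddf0|rewrite !linearP; apply: IL].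
pose N e' := sval (cid (HM' e')).
have HN e' (v : 'rV_e'.+1) : (v <= N e')%MS <-> I (hz e' (rVpoly v)).
  exact: (svalP (cid (HM' e'))).
have rN e' : \rank (N e') = stair_dim F P e'.
  have := HH e'; rewrite (hilbert_funE HI HN) hilbert_stair //.
  have := rank_leq_row (N e').
  have : (stair_dim F P e' <= e'.+1)%N by rewrite -[X in (_ <= X)%N]card_ord max_card.
  by lia.
have k0 : stair_dim F P 0 = 0%N by apply/eqP; rewrite stair_dim_eq0 // ht_gt0.
have kS e' := stair_dimS F HP e'.
have k_eq0 e' := stair_dim_eq0 F HP e'.
have rc e' := card_hrows_hcols F HP e'.
pose s e' := \rank (N e' *m mxX F e' + N e' *m mxY F e')%MS.
have b0S e' : betti I 0 e'.+1 = (stair_dim F P e'.+1 - s e')%N.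
  by rewrite (betti0S HI HN) rN.
have b1S e' : (betti I 1 e'.+2 + s e'.+1 + stair_dim F P e' = 2 * stair_dim F P e'.+1)%N.
  by have := betti1E HI HN e'; rewrite !rN.
have growth e' : (stair_dim F P e' + (ht (stair_ideal F P) <= e') <= s e')%N.
  rewrite /s [(ht _ <= _)%N]leqNgt -k_eq0 -rN mxrank_eq0; case: eqP => [->|/eqP N0] /=.
    by rewrite mxrank0.
  by rewrite addn1; apply: mx_growth.
have sub e' : (s e' <= stair_dim F P e'.+1)%N.
  by rewrite /s -rN; exact: mxrankS (MXY_sub HI HN e').
case: e => [|[|e]].
- rewrite (betti00 HI HN) rN k0 card_hrows0 // card_hcols0 betti10 //.
- have N0 : N 0%N = 0 by apply/eqP; rewrite -mxrank_eq0 rN k0.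
  have s0 : s 0%N = 0%N by rewrite /s N0 !mul0mx addsmx0 mxrank0.
  rewrite b0S (betti11 HI HN N0) s0.
  have t0 := ht_gt0 F HP; have := kS 0%N; have := rc 0%N.
  by rewrite k0 card_hrows0 // eqn0Ngt [(_ <= 0)%N]leqNgt t0; lia.
- have := growth e.+1; have := sub e.+1; have := b1S e; rewrite b0S.
  have := kS e; have := kS e.+1; have := rc e.+1.
  by case: (ltngtP (ht (stair_ideal F P)) e.+1); lia.
Qed.

(** * Monic bases adapted to a Hessenberg recursion *)

Section Hessenberg.
Variables (F : fieldType) (q : nat -> nat -> F).

Fixpoint hess_upto n : nat -> {poly F} :=
  if n is n'.+1 then
    fun a => if (a <= n')%N then hess_upto n' a
      else 'X * hess_upto n' n' - \sum_(b < n'.+1) q b n' *: hess_upto n' b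
  else fun=> 1.

(** The polynomials with [hess 0 = 1] and
    [hess a.+1 = 'X * hess a - \sum_(b <= a) q b a *: hess b]. *)
Definition hess a := hess_upto a a.

Lemma hess_uptoE n a : (a <= n)%N -> hess_upto n a = hess a.
Proof.
elim: n => [|n IH] an; first by move: an; rewrite leqn0 => /eqP ->.
have [an'|] := leqP a n; first by rewrite /= an' IH.
by move=> na; have -> : a = n.+1 by apply/eqP; rewrite eqn_leq an.
Qed.

Lemma hess0 : hess 0 = 1. Proof. by []. Qed.

Lemma hessS a : hess a.+1 = 'X * hess a - \sum_(b < a.+1) q b a *: hess b.
Proof.
rewrite /hess /= ltnn; congr (_ - _); apply: eq_bigr => b _.
by rewrite hess_uptoE // -ltnS.
Qed.

Lemma size_sum_leq n (I : finType) (G : I -> {poly F}) :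
  (forall i, size (G i) <= n)%N -> (size (\sum_i G i)%R <= n)%N.
Proof.
by move=> H; apply: leq_trans (size_sum _ _ _) _; apply/bigmax_leqP => i _.
Qed.

Lemma hess_monic_size a : hess a \is monic /\ size (hess a) = a.+1.
Proof.
have [n an] := ubnP a; elim: n => // n IH in a an *.
case: a an => [|a] an; first by rewrite hess0 monic1 size_poly1.
have [mon_a size_a] := IH a an.
rewrite hessS; set s := - _.
have ss : (size s < size ('X * hess a)%R)%N.
  rewrite size_monicM ?monicX ?monic_neq0 // size_polyX size_a /= /s size_polyN ltnS.
  apply: size_sum_leq => b; apply: leq_trans (size_scale_leq _ _) _.
  by have [_ ->] := IH b (leq_trans (ltn_ord b) an); apply: ltn_ord.
split; first by rewrite monicE lead_coefDl // lead_coefM lead_coefX mul1r -monicE.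
by rewrite size_polyDl // size_monicM ?monicX ?monic_neq0 // size_polyX size_a.
Qed.

Lemma hess_monic a : hess a \is monic. Proof. by case: (hess_monic_size a). Qed.
Lemma size_hess a : size (hess a) = a.+1. Proof. by case: (hess_monic_size a). Qed.

Lemma hess_lead a : (hess a)`_a = 1.
Proof. by have := monicP (hess_monic a); rewrite lead_coefE size_hess. Qed.

(** Change of basis, from the powers of ['X] to the polynomials [hess a]. *)
Definition hcomb (c : {poly F}) : {poly F} := \sum_(a < size c) c`_a *: hess a.

Lemma hcombE n (c : {poly F}) : (size c <= n)%N -> hcomb c = \sum_(a < n) c`_a *: hess a.
Proof.
move=> cn; rewrite /hcomb (big_ord_widen n (fun a => c`_a *: hess a) cn) big_mkcond /=.
apply: eq_bigr => a _; case: ltnP => // ca.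
by rewrite nth_default ?scale0r.
Qed.

Lemma hcomb_is_linear : linear hcomb.
Proof.
move=> k u v; pose n := maxn (size u) (size v).
rewrite !(@hcombE n) ?leq_maxl ?leq_maxr //; last first.
  apply: leq_trans (size_polyD _ _) _; rewrite geq_max leq_maxr andbT.
  by apply: leq_trans (size_scale_leq _ _) _; rewrite leq_maxl.
rewrite scaler_sumr -big_split; apply: eq_bigr => a _ /=.
by rewrite coefD coefZ scalerDl scalerA.
Qed.
HB.instance Definition _ := GRing.isLinear.Build F {poly F} {poly F} _ hcomb hcomb_is_linear.

Lemma hcombXn a : hcomb 'X^a = hess a.
Proof.
rewrite (@hcombE a.+1) ?size_polyXn // big_ord_recr /= coefXn eqxx scale1r.
rewrite big1 ?add0r // => b _; rewrite coefXn.
by rewrite (ltn_eqF (ltn_ord b)) scale0r.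
Qed.

Lemma size_hcomb c : size (hcomb c) = size c.
Proof.
have [->|c0] := eqVneq c 0; first by rewrite raddf0.
have : c`_(size c).-1 != 0 by rewrite -lead_coefE lead_coef_eq0.
have : (0 < size c)%N by rewrite size_poly_gt0.
rewrite /hcomb; case: (size c) => // n _ cn.
have cN : size (c`_n *: hess n) = n.+1 by rewrite size_scale ?size_hess.
rewrite big_ord_recr /= addrC size_polyDl cN // ltnS.
apply: size_sum_leq => a; apply: leq_trans (size_scale_leq _ _) _.
by rewrite size_hess ltn_ord.
Qed.

Lemma hcomb_inj : injective hcomb.
Proof.
move=> c d /eqP; rewrite -subr_eq0 -raddfB -size_poly_eq0 size_hcomb size_poly_eq0.
by rewrite subr_eq0 => /eqP.
Qed.

(** Multiplication by ['X], in the coordinates given by [hcomb]. *)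
Definition hshift (c : {poly F}) : {poly F} :=
  'X * c + \sum_(a < size c) c`_a *: \poly_(b < a.+1) q b a.

Lemma hcomb_shift c : hcomb (hshift c) = 'X * hcomb c.
Proof.
have -> : hshift c = \sum_(a < size c) c`_a *: ('X^(a.+1) + \poly_(b < a.+1) q b a).
  under [RHS]eq_bigr do rewrite scalerDr.
  rewrite big_split /=; congr (_ + _).
  rewrite -{1}[c]coefK poly_def mulr_sumr; apply: eq_bigr => a _.
  by rewrite -scalerAr exprS.
rewrite raddf_sum /hcomb mulr_sumr; apply: eq_bigr => a _ /=.
rewrite linearZ -scalerAr; congr (_ *: _); rewrite linearD /= hcombXn hessS.
rewrite (@hcombE a.+1) ?size_poly //.
rewrite [X in _ + X](eq_bigr (fun b : 'I_a.+1 => q b a *: hess b)) ?subrK // => b _.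
by rewrite coef_poly ltn_ord.
Qed.

Hypothesis q_le : forall b a, q b a != 0 -> (b <= a)%N.

Lemma coef_hshift n (c : {poly F}) b : (size c <= n)%N ->
  (hshift c)`_b = (if b == 0 then 0 else c`_b.-1) + \sum_(a < n) c`_a * q b a.
Proof.
move=> cn; rewrite coefD coefXM; congr (_ + _).
rewrite coef_sum (big_ord_widen n (fun a => (c`_a *: \poly_(b < a.+1) q b a)`_b) cn).
rewrite big_mkcond; apply: eq_bigr => a _ /=.
case: ltnP => ca; last by rewrite nth_default // mul0r.
rewrite coefZ coef_poly ltnS; case: leqP => // ab.
by have [->|/q_le] := eqVneq (q b a) 0; rewrite // leqNgt ab.
Qed.

End Hessenberg.

(** * The homogeneous ideal attached to a Hessenberg recursion *)

Lemma subnS_inj n a b : (a < n)%N -> (b < n)%N -> (n - a.+1 = n - b.+1)%N -> a = b.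
Proof. lia. Qed.

Section HessIdeal.
Variables (F : fieldType) (P : nat -> nat -> bool) (HP : lex_stair P).
Local Notation E := (stair_ideal F P).
Local Notation t := (ht E).
Local Notation wt := (wt F P).
Local Notation hrows := (hrows F P).
Local Notation hcols := (hcols F P).
Variable q : nat -> nat -> F.
(** These are the conditions that make the spans of the [hess a] with
    [wt a <= e] stable under multiplication by the variables. *)
Hypothesis qP : forall b a, q b a != 0 -> [/\ (a < t)%N, (b <= a)%N & (wt b <= (wt a).+1)%N].
Local Notation hess := (hess q).
Local Notation hcomb := (hcomb q).
Local Notation hshift := (hshift q).

Let q_le b a : q b a != 0 -> (b <= a)%N. Proof. by case/qP. Qed.

Definition wsupp e (c : {poly F}) := forall a, c`_a != 0 -> (wt a <= e)%N.

Lemma wsupp_subspace e : is_subspace (wsupp e).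
Proof.
split=> [a|k c d Hc Hd a]; first by rewrite coef0 eqxx.
rewrite coefD coefZ; apply: contraNT => wa.
have -> : c`_a = 0 by apply/eqP; apply: contraNT wa => /Hc.
have -> : d`_a = 0 by apply/eqP; apply: contraNT wa => /Hd.
by rewrite mulr0 addr0.
Qed.

Lemma wsupp_eq0 e c a : wsupp e c -> (e < wt a)%N -> c`_a = 0.
Proof. by move=> Hc; rewrite ltnNge => wa; apply/eqP; apply: contraNT wa => /Hc. Qed.

Lemma wsuppS e c : wsupp e c -> wsupp e.+1 c.
Proof. by move=> Hc a /Hc; apply: leqW. Qed.

Lemma size_wsupp e c : wsupp e c -> (size c <= e.+1)%N.
Proof.
move=> Hc; apply/leq_sizeP => a ea; apply: wsupp_eq0 Hc _.
exact: leq_trans ea (wt_ge _ _ _).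
Qed.

Lemma wt_predS b : (0 < b)%N -> (wt b <= (wt b.-1).+1)%N.
Proof.
case: b => // b _ /=; have [bt|tb] := ltnP b t; first exact: leqW (wtS HP bt).
by rewrite !wt_id // ltnW.
Qed.

Lemma wsupp_hshift e c : wsupp e c -> wsupp e.+1 (hshift c).
Proof.
move=> Hc b; apply: contraNT; rewrite -ltnNge => eb.
rewrite (coef_hshift q_le b (leqnn _)) big1 ?addr0.
  case: (b =P 0%N) => [_|/eqP b0]; first exact: eqxx.
  rewrite (wsupp_eq0 Hc) //.
  by rewrite -ltnS (leq_trans eb) // wt_predS // lt0n.
move=> a _; have [->|/Hc wa] := eqVneq c`_a 0; first by rewrite mul0r.
have [->|/qP[_ _ wb]] := eqVneq (q b a) 0; first by rewrite mulr0.
by have := leq_trans eb wb; rewrite ltnS ltnNge wa.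
Qed.

(** The span of the polynomials [hess a] with [wt a <= e]. *)
Definition hpiece e : set {poly F} := [set f | exists2 c, wsupp e c & f = hcomb c].

Lemma hpiece_subspace e : is_subspace (hpiece e).
Proof.
have [w0 wL] := wsupp_subspace e.
split=> [|k _ _ [c Hc ->] [d Hd ->]]; first by exists 0; rewrite ?raddf0.
by exists (k *: c + d); [apply: wL|rewrite linearP].
Qed.

Lemma hpieceS e f : hpiece e f -> hpiece e.+1 f.
Proof. by case=> c Hc ->; exists c => //; apply: wsuppS. Qed.

Lemma hpiece_mulX e f : hpiece e f -> hpiece e.+1 ('X * f).
Proof.
by case=> c Hc ->; exists (hshift c); [apply: wsupp_hshift|rewrite hcomb_shift].
Qed.

Lemma size_hpiece e (f : {poly F}) : hpiece e f -> (size f <= e.+1)%N.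
Proof. by case=> c Hc ->; rewrite size_hcomb size_wsupp. Qed.

Definition hess_ideal : set {mpoly F[2]} := [set f | forall e, hpiece e (dh e f)].

Lemma hess_ideal_mulX f : hess_ideal f -> hess_ideal ('X_ix * f).
Proof.
move=> Hf [|e]; first by rewrite dh0_mulX; case: (hpiece_subspace 0).
by rewrite dh_mulX; apply: hpiece_mulX.
Qed.

Lemma hess_ideal_mulY f : hess_ideal f -> hess_ideal ('X_iy * f).
Proof.
move=> Hf [|e]; first by rewrite dh0_mulY; case: (hpiece_subspace 0).
by rewrite dh_mulY; apply: hpieceS.
Qed.

Lemma hess_ideal_subspace : is_subspace hess_ideal.
Proof.
split=> [e|k f g Hf Hg e]; first by rewrite raddf0; case: (hpiece_subspace e).
by rewrite linearP; case: (hpiece_subspace e) => _; apply.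
Qed.

Lemma hess_ideal_ideal : is_ideal hess_ideal.
Proof.
split=> [|f g Hf Hg|r f Hf]; first by case: hess_ideal_subspace.
  exact: subspaceD hess_ideal_subspace Hf Hg.
rewrite [r]mpolyE mulr_suml; apply: subspace_sum hess_ideal_subspace _ => m _.
rewrite -scalerAl; apply: subspaceZ hess_ideal_subspace _.
rewrite (mnm2_eta m) -monE; elim: (m ix) => [|a IH].
  elim: (m iy) => [|b IH]; first by rewrite /mon !mul1r.
  by rewrite -mulY_mon -mulrA; apply: hess_ideal_mulY.
by rewrite -mulX_mon -mulrA; apply: hess_ideal_mulX.
Qed.

Lemma hess_ideal_homogeneous : homogeneous_ideal hess_ideal.
Proof.
split; first exact: hess_ideal_ideal.
move=> f d Hf e; rewrite dh_pihomog; case: eqP => // _.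
by case: (hpiece_subspace e).
Qed.

Lemma hess_ideal_hz e (f : {poly F}) :
  (size f <= e.+1)%N -> hess_ideal (hz e f) <-> hpiece e f.
Proof.
move=> sf; split=> [/(_ e)|Hf e']; first by rewrite hzK.
rewrite dh_hz; case: eqP => [->|_]; first by rewrite take_poly_id.
by case: (hpiece_subspace e').
Qed.

Lemma piece_hess_ideal e (f : {poly F}) : piece hess_ideal e f <-> hpiece e f.
Proof.
split=> [[sf]|Hf]; first by move/hess_ideal_hz; apply.
have sf := size_hpiece Hf.
by split=> //; apply/hess_ideal_hz.
Qed.

Lemma hpiece_hess e a : (wt a <= e)%N -> hpiece e (hess a).
Proof.
move=> wa; exists 'X^a; last by rewrite hcombXn.
by move=> b; rewrite coefXn; case: (b =P a) => [->|]; rewrite ?eqxx.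
Qed.

(** Since [hess a] is monic of degree [a], an element of the piece of degree [e]
    has the same degree as its vector of coordinates, which is some [a] with
    [wt a <= e]; and all these degrees occur. *)
Lemma Lt_hess_ideal : Lt hess_ideal = E.
Proof.
apply/seteqP; split.
  apply: ideal_gen_min; first exact: stair_ideal_ideal.
  move=> _ [m [f Hf [mf mmax]] <-]; set e := mdeg m.
  have [c Hc fE] := Hf e.
  have sf : size (dh e f) = (m ix).+1.
    apply/eqP; rewrite eqn_leq ltnNge; apply/andP; split; last first.
      by apply/negP => /leq_sizeP/(_ _ (leqnn _)) H; move: mf; rewrite mem_msupp_dh H eqxx.
    apply/leq_sizeP => b mb; apply/eqP/negP => /negP fb.
    have be : (b <= e)%N.
      by rewrite -ltnS; apply: contraTT fb; rewrite -leqNgt => eb;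
        rewrite nth_default ?eqxx // (leq_trans (size_dh _ _)).
    have dm : mdeg (mnm2 b (e - b)) = e by rewrite mdeg2 mnm2x mnm2y subnKC.
    have /mmax : mnm2 b (e - b) \in msupp f by rewrite mem_msupp_dh dm.
    by rewrite /lex_le mnm2x ltnNge (ltnW mb) /= (gtn_eqF mb).
  have /Hc wm : c`_(m ix) != 0.
    have sc : size c = (m ix).+1 by rewrite -sf fE size_hcomb.
    by rewrite -[m ix]/((m ix).+1.-1) -sc -lead_coefE lead_coef_eq0 -size_poly_eq0 sc.
  move=> m'; rewrite msuppX mem_seq1 => /eqP ->.
  have em : (m ix <= e)%N by rewrite /e mdeg2 leq_addr.
  by have := stair_wt F HP em; rewrite wm {1}/e mdeg2 addKn.
move=> f Ef; apply: ideal_sum_mon; first exact: is_ideal_gen.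
move=> m /Ef Pm; apply: sub_ideal_gen; exists m => //; set e := mdeg m.
have em : (m ix <= e)%N by rewrite /e mdeg2 leq_addr.
have wm : (wt (m ix) <= e)%N by rewrite -(stair_wt F HP em) /e mdeg2 addKn.
have sN : (size (hess (m ix)) <= e.+1)%N by rewrite size_hess.
exists (hz e (hess (m ix))); first by apply/hess_ideal_hz => //; apply: hpiece_hess.
split=> [|m' m'f].
  by rewrite mem_msupp_dh hzK // hess_lead oner_eq0.
have dm' : mdeg m' = e := dhomog_mf (hz_homog e (hess (m ix))) m'f.
have m'le : (m' ix <= m ix)%N.
  rewrite -ltnS -(size_hess q (m ix)); apply: contraTT m'f; rewrite -leqNgt => H.
  by rewrite mem_msupp_dh dm' hzK // nth_default // eqxx.
rewrite /lex_le; move: dm'; rewrite /e !mdeg2 => dm'.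
by case: ltngtP m'le => //= H _; lia.
Qed.

(** The combination of the generators of degree [e] with coefficients [v], in the
    coordinates given by [hcomb]. *)
Definition row_poly e (v : 'rV[F]_#|hrows e|) : {poly F} :=
  \sum_i v 0 i *: 'X^(t - (enum_val i : 'I_t.+1)).

Lemma row_poly_is_linear e : linear (@row_poly e).
Proof.
move=> k u v; rewrite /row_poly scaler_sumr -big_split; apply: eq_bigr => i _.
by rewrite !mxE scalerDl scalerA.
Qed.
HB.instance Definition _ e := GRing.isLinear.Build F 'rV[F]_#|hrows e| {poly F} _
  (@row_poly e) (@row_poly_is_linear e).

Lemma coef_row_poly e v (i : 'I_#|hrows e|) :
  (row_poly v)`_(t - (enum_val i : 'I_t.+1)) = v 0 i.
Proof.
rewrite coef_sum (bigD1 i) //= coefZ coefXn eqxx mulr1 big1 ?addr0 // => j ji.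
rewrite coefZ coefXn; case: eqP => [E1|]; last by rewrite mulr0.
case/eqP: ji; apply: enum_val_inj; apply: val_inj => /=.
by have := ltn_ord (enum_val i); have := ltn_ord (enum_val j); lia.
Qed.

Lemma coef_row_poly_nz e (v : 'rV[F]_#|hrows e|) a :
  (row_poly v)`_a != 0 -> (a <= t)%N /\ wt a = e.
Proof.
move=> H; have [i <-] : exists i : 'I_#|hrows e|, (t - (enum_val i : 'I_t.+1))%N = a.
  apply: contrapT => nH; case/eqP: H; rewrite coef_sum big1 // => i _.
  rewrite coefZ coefXn; case: eqP => [E1|]; last by rewrite mulr0.
  by case: nH; exists i; rewrite E1.
by have := enum_valP i; rewrite inE => /eqP ->; rewrite leq_subr.
Qed.

Lemma hrowsP e a : (a <= t)%N -> wt a = e ->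
  exists i : 'I_#|hrows e|, (t - (enum_val i : 'I_t.+1))%N = a.
Proof.
move=> at_ wa; have lt_a : (t - a < t.+1)%N by rewrite ltnS leq_subr.
have Hi : Ordinal lt_a \in hrows e by rewrite inE /= subKn // wa.
by exists (enum_rank_in Hi (Ordinal lt_a)); rewrite enum_rankK_in //= subKn.
Qed.

Definition unit_block e : 'M[F]_(#|hrows e|, #|hcols e|) :=
  \matrix_(i, j) q (t - (enum_val i : 'I_t.+1))%N (t - (enum_val j : 'I_t).+1)%N.

(** Modulo [hpiece e], a product by ['X] of an element of [hpiece e] only involves
    the columns of degree [e.+1]: the coefficient of [hess a] contributes to
    [hess b] with [wt b = e.+1] only if [wt a = e]. *)
Lemma coef_hshift_row e (c : {poly F}) i : wsupp e c ->
  (hshift c)`_(t - (enum_val i : 'I_t.+1)) =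
  ((\row_j c`_(t - (enum_val j : 'I_t).+1)) *m (unit_block e.+1)^T) 0 i.
Proof.
move=> Hc; set b := (t - _)%N.
have wb : wt b = e.+1 by have := enum_valP i; rewrite inE => /eqP.
have bt : (b <= t)%N by rewrite leq_subr.
rewrite (coef_hshift q_le b (leqnn _)) [X in X + _](_ : _ = 0) ?add0r; last first.
  case: eqP => // /eqP b0; apply: wsupp_eq0 Hc _.
  rewrite -wb -{1}[b]prednK ?lt0n //; apply: wtS => //.
  by rewrite prednK ?lt0n.
rewrite mxE.
have -> : \sum_(a < size c) c`_a * q b a = \sum_(a < t) c`_a * q b a.
  pose n := maxn (size c) t.
  rewrite (big_ord_widen n (fun a => c`_a * q b a)) ?leq_maxl //.
  rewrite [RHS](big_ord_widen n (fun a => c`_a * q b a)) ?leq_maxr //.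
  rewrite big_mkcond [RHS]big_mkcond; apply: eq_bigr => a _.
  case: ltnP => [ca|ca]; case: ltnP => [ta|ta] //.
    have [->|/qP[]] := eqVneq (q b a) 0; first by rewrite mulr0.
    by rewrite ltnNge ta.
  by rewrite nth_default // mul0r.
rewrite (reindex_inj rev_ord_inj) (bigID (mem (hcols e.+1))) /= [X in _ + X]big1 ?addr0.
  by rewrite big_enum_val; apply: eq_bigr => j _; rewrite !mxE.
move=> j; rewrite inE eqSS => wj.
have [->|/Hc wc] := eqVneq c`_(t - j.+1) 0; first by rewrite mul0r.
have [->|/qP[_ _]] := eqVneq (q b (t - j.+1)%N) 0; first by rewrite mulr0.
by rewrite wb ltnS leq_eqVlt eq_sym (negbTE wj) ltnNge wc.
Qed.

Lemma mpiece_row_poly e (v : 'rV[F]_#|hrows e|) :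
  mpiece hess_ideal e (hcomb (row_poly v)) <-> (v <= (unit_block e)^T)%MS.
Proof.
case: e v => [|e] v.
  have v0 : v = 0.
    apply/eqP; rewrite -mxrank_eq0 -leqn0; apply: leq_trans (rank_leq_col v) _.
    by rewrite card_hrows0.
  by rewrite v0 sub0mx !raddf0.
split.
  case=> _ [_ [/piece_hess_ideal[c1 H1 ->] /piece_hess_ideal[c2 H2 ->]]].
  rewrite -hcomb_shift -raddfD => /hcomb_inj E1.
  rewrite (_ : v = (\row_j c1`_(t - (enum_val j : 'I_t).+1)) *m (unit_block e.+1)^T) ?submxMl //.
  apply/rowP => i; rewrite -coef_hshift_row // -coef_row_poly E1 coefD.
  rewrite (wsupp_eq0 H2) ?addr0 //.
  by have := enum_valP i; rewrite inE => /eqP ->.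
case/submxP => u vE.
pose c := \sum_j u 0 j *: 'X^(t - (enum_val j : 'I_t).+1).
have cj j : c`_(t - (enum_val j : 'I_t).+1) = u 0 j.
  rewrite coef_sum (bigD1 j) //= coefZ coefXn eqxx mulr1 big1 ?addr0 // => l lj.
  rewrite coefZ coefXn; case: eqP => [E1|]; last by rewrite mulr0.
  case/eqP: lj; apply: enum_val_inj; apply: val_inj => /=.
  exact: subnS_inj (ltn_ord _) (ltn_ord _) (esym E1).
have Hc : wsupp e c.
  move=> a ca; have [j <-] : exists j : 'I_#|hcols e.+1|, (t - (enum_val j : 'I_t).+1)%N = a.
    apply: contrapT => nH; case/eqP: ca; rewrite coef_sum big1 // => j _.
    rewrite coefZ coefXn; case: eqP => [E1|]; last by rewrite mulr0.
    by case: nH; exists j; rewrite E1.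
  by have := enum_valP j; rewrite inE eqSS => /eqP ->.
exists (hcomb c), (hcomb (row_poly v - hshift c)); split.
- by apply/piece_hess_ideal; exists c.
- apply/piece_hess_ideal; exists (row_poly v - hshift c) => // b.
  rewrite coefB => Hb; rewrite -ltnS ltn_neqAle; apply/andP; split.
    apply: contraNneq Hb => wb; have [bt|tb] := leqP b t.
      have [i <-] := hrowsP bt wb.
      rewrite coef_row_poly coef_hshift_row // vE.
      rewrite (_ : u = \row_j c`_(t - (enum_val j : 'I_t).+1)) ?subrr //.
      by apply/rowP => j; rewrite mxE cj.
    rewrite (coef_hshift q_le b (leqnn _)).
    have -> : (row_poly v)`_b = 0.
      by apply/eqP; apply: contraTT tb => /coef_row_poly_nz[]; rewrite -leqNgt.
    rewrite big1 => [|a _].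
      rewrite addr0 sub0r oppr_eq0 gtn_eqF ?(leq_trans _ tb) //.
      apply/eqP; rewrite /c coef_sum big1 // => j _.
      rewrite coefZ coefXn; case: eqP => [E1|]; last by rewrite mulr0.
      by have := ltn_ord (enum_val j); lia.
    have [->|/qP[]] := eqVneq (q b a) 0; first by rewrite mulr0.
    by lia.
  have [r0|/coef_row_poly_nz[_ ->]//] := eqVneq (row_poly v)`_b 0.
  by move: Hb; rewrite r0 sub0r oppr_eq0; apply: wsupp_hshift.
- by rewrite raddfB /= hcomb_shift addrC subrK.
Qed.

(** The generators of degree [e] span the piece of degree [e] modulo the product
    with the variables, and [mpiece_row_poly] describes the relations. *)
Lemma betti_hess_ideal e : betti hess_ideal 0 e = (#|hrows e| - \rank (unit_block e))%N.
Proof.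
rewrite (betti0_coord (psi := (hcomb \o @row_poly e)%FUN)
  (vz := 1%:M : 'M_#|hrows e|) (vb := (unit_block e)^T)) ?mxrank1 ?mxrank_tr //.
- exact: hess_ideal_ideal.
- exact: submx1.
- move=> v _; apply/piece_hess_ideal; exists (row_poly v) => //.
  by move=> a /coef_row_poly_nz[_ ->].
- move=> _ /piece_hess_ideal[c Hc ->].
  pose v := \row_i c`_(t - (enum_val (i : 'I_#|hrows e|) : 'I_t.+1)).
  exists v; first exact: submx1.
  rewrite -raddfB /=; set d := c - row_poly v.
  have Hd a : d`_a != 0 -> (wt a < e)%N \/ (t < a)%N /\ wt a = e.
    move=> Hda; have wa : (wt a <= e)%N.
      move: Hda; rewrite coefB; have [->|/coef_row_poly_nz[_ ->]//] := eqVneq (row_poly v)`_a 0.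
      by rewrite subr0; apply: Hc.
    move: wa; rewrite leq_eqVlt => /orP[/eqP wa|]; last by left.
    right; split=> //; rewrite ltnNge; apply: contraNN Hda => at_.
    have [i <-] := hrowsP at_ wa.
    by rewrite coefB coef_row_poly mxE subrr.
  case: e => [|e] in c Hc v d Hd *.
    suff -> : d = 0 by rewrite raddf0.
    apply/polyP => a; rewrite coef0; apply/eqP; apply: contrapT => /negP/Hd[]//.
    by case=> ta wa; have := wt_ge F P a; rewrite wa leqn0 => /eqP a0; rewrite a0 in ta.
  (* Beyond t, the basis element of degree e.+1 is the product by 'X of the one
     of degree e. *)
  pose al := if (t <= e)%N then d`_e.+1 else 0.
  exists (hcomb (al *: 'X^e)), (hcomb (d - al *: 'X^(e.+1))); split.
  + apply/piece_hess_ideal; exists (al *: 'X^e) => // a.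
    rewrite coefZ coefXn; case: (a =P e) => [->|]; last by rewrite mulr0 eqxx.
    by rewrite /al; case: (leqP t e) => te; rewrite ?mul0r ?eqxx // wt_id.
  + apply/piece_hess_ideal; exists (d - al *: 'X^(e.+1)) => // a.
    rewrite coefB coefZ coefXn; have [->|ae] := eqVneq a e.+1.
      rewrite mulr1 /al; case: (leqP t e) => te; first by rewrite subrr eqxx.
      by rewrite subr0 => /Hd[|[]]; rewrite ?ltnS //; lia.
    rewrite mulr0 subr0 => /Hd[|[ta wa]]; first by rewrite ltnS.
    by case/eqP: ae; rewrite -wa wt_id // ltnW.
  + rewrite -hcomb_shift -raddfD.
    have -> : hshift (al *: 'X^e) = al *: 'X^(e.+1) :> {poly F}.
      apply/polyP => b; rewrite (coef_hshift q_le b (n := e.+1)); last first.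
        by apply: leq_trans (size_scale_leq _ _) _; rewrite size_polyXn.
      rewrite big1 => [|a _].
        rewrite addr0 !coefZ !coefXn; case: b => [|b] /=; first by rewrite mulr0.
        by rewrite eqSS.
      rewrite coefZ coefXn /al; case: (leqP t e) => te; last by rewrite !mul0r.
      have [->|/qP[at_ _ _]] := eqVneq (q b a) 0; first by rewrite mulr0.
      by rewrite (ltn_eqF (leq_trans at_ te)) mulr0 mul0r.
    by rewrite addrC subrK.
- by move=> v _; apply: mpiece_row_poly.
Qed.

End HessIdeal.

(** * The maximal minors of the canonical Hilbert-Burch matrix *)

(** Expansion, along its first column, of the determinant of [M] bordered by a
    second copy of its column [j]. *)
Lemma sum_minors (R : comNzRingType) n (M : 'M[R]_(n.+1, n)) (j : 'I_n) :
  \sum_(i < n.+1) (-1) ^+ i * \det (row' i M) * M i j = 0.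
Proof.
pose A : 'M[R]_n.+1 := \matrix_(i, l) (if unlift ord0 l is Some l' then M i l' else M i j).
have A0 i : A i ord0 = M i j by rewrite mxE unlift_none.
have AS i l : A i (lift ord0 l) = M i l by rewrite mxE liftK.
have : \det A = 0.
  rewrite -det_tr; apply: (@determinant_alternate _ _ _ ord0 (lift ord0 j)).
    exact: neq_lift.
  by move=> i; rewrite [LHS]mxE [RHS]mxE A0 AS.
rewrite (expand_det_col _ ord0) => H; rewrite -[RHS]H; apply: eq_bigr => i _.
rewrite A0 mulrC /cofactor addn0; congr (_ * (_ * \det _)).
by apply/matrixP => i' l; rewrite [LHS]mxE [RHS]mxE [RHS]mxE AS.
Qed.

Section HilbertBurch.
Variables (F : fieldType) (P : nat -> nat -> bool) (HP : lex_stair P).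
Local Notation R := {mpoly F[2]}.
Local Notation E := (stair_ideal F P).
Local Notation t := (ht E).
Local Notation hm := (hm E).
Local Notation wt := (wt F P).
Local Notation hrows := (hrows F P).
Local Notation hcols := (hcols F P).
Variable p : affine_space F #|hS E|.

(** The coordinate of [p] in row [i] and column [j], zero outside [hS E]. *)
Definition pcoef (i j : nat) : F :=
  \sum_(s < #|hS E| | ((enum_val s).1 == i :> nat) && ((enum_val s).2 == j :> nat)) p 0 s.

(** The coefficients of the recursion: row [i] and column [j] are indexed by
    [t - i] and [t - j.+1], the degrees in x of the minors obtained by deleting
    rows [i] and [j.+1]. *)
Definition hbq (b a : nat) : F :=
  if (a < t)%N && (b <= t)%N then pcoef (t - b) (t - a.+1) else 0.

Lemma wt_sub i : (i <= t)%N -> wt (t - i) = (t - i + hm i)%N.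
Proof. by move=> it; rewrite wtE subKn. Qed.

Lemma hmS i : (i < t)%N -> (hm i < hm i.+1)%N.
Proof.
move=> it; have := @wtS F P HP (t - i.+1)%N; rewrite -subSn // subSS.
rewrite !wt_sub ?(ltnW it) //; have := it; lia.
Qed.

(** The degree of the entry in row [i] and column [j] is the degree of the
    syzygy [j] minus that of the generator [i]. *)
Lemma huE i j : (i <= t)%N -> (j < t)%N ->
  hu E i.+1 j.+1 = (wt (t - j.+1)).+1%:Z - (wt (t - i))%:Z.
Proof. by move=> it jt; rewrite /hu !wt_sub ?(ltnW jt) //=; lia. Qed.

Lemma pcoef_nz i j : pcoef i j != 0 ->
  [/\ (j < i <= t)%N, (j < t)%N & 0 <= hu E i.+1 j.+1].
Proof.
move=> H; have [s /andP[/eqP si /eqP sj]] : exists s : 'I_#|hS E|,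
    ((enum_val s).1 == i :> nat) && ((enum_val s).2 == j :> nat).
  apply/existsP; apply: contraNT H; rewrite negb_exists => /forallP H.
  by rewrite /pcoef big_pred0 // => s; apply/negbTE/H.
have := enum_valP s; rewrite inE si sj => /and3P[ji u0 _].
by split; rewrite // ?ji -?si -?sj -1?ltnS; apply: ltn_ord.
Qed.

Lemma hbqP b a : hbq b a != 0 -> [/\ (a < t)%N, (b <= a)%N & (wt b <= (wt a).+1)%N].
Proof.
rewrite /hbq; case: ifP => [/andP[at_ bt]|]; last by rewrite eqxx.
case/pcoef_nz => /andP[ji _] jt u0; split=> //; first by lia.
move: u0; rewrite huE ?leq_subr // subKn // -subSn // subSS subKn ?(ltnW at_) //.
by lia.
Qed.

Lemma hM_entry (i : 'I_t.+1) (j : 'I_t) : hM p i j =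
  (if i == j :> nat then 'X_iy ^+ hd E j.+1 else if i == j.+1 :> nat then - 'X_ix else 0)
  + pcoef i j *: 'X_iy ^+ `|hu E i.+1 j.+1|%N.
Proof. by rewrite !mxE scaler_suml. Qed.

Lemma prod_diag : \prod_(i < t) ('X_iy : R) ^+ hd E i.+1 = 'X_iy ^+ hm t.
Proof.
have H n : (n <= t)%N -> \prod_(i < n) ('X_iy : R) ^+ hd E i.+1 = 'X_iy ^+ hm n.
  elim: n => [_|n IH nt]; first by rewrite big_ord0 hm0.
  rewrite big_ord_recr IH ?(ltnW nt) //= -exprD /hd /=.
  by rewrite subnKC // ltnW // hmS.
exact: H.
Qed.

Lemma det_hM_last : \det (row' ord_max (hM p)) = 'X_iy ^+ hm t.
Proof.
have lt_ij (i j : 'I_t) : (i <= j)%N -> pcoef i j = 0.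
  move=> ij; apply/eqP; apply/negP => /negP/pcoef_nz[/andP[ji _] _ _].
  by move: ji; rewrite ltnNge ij.
have liftE (i : 'I_t) : lift ord_max i = i :> nat by rewrite lift_max.
rewrite det_trig -?prod_diag.
  apply: eq_bigr => i _; rewrite mxE hM_entry liftE eqxx.
  by rewrite lt_ij // scale0r addr0.
apply/is_trig_mxP => i j ij; rewrite mxE hM_entry liftE (ltn_eqF ij).
by rewrite ltn_eqF ?(leq_trans ij) // lt_ij ?scale0r ?addr0 // ltnW.
Qed.

(** With these signs the last minor is a power of y with coefficient 1. *)
Definition sminor (i : 'I_t.+1) : R := (-1) ^+ t * ((-1) ^+ i * \det (row' i (hM p))).

(** The relation of column [j] between the minors is the recursion that defines
    [hess], multiplied by a power of y. *)
Lemma sminor_hess a (i : 'I_t.+1) : i = (t - a)%N :> nat -> (a <= t)%N ->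
  sminor i = hz (wt a) (hess hbq a).
Proof.
have [n an] := ubnP a; elim: n => // n IH in a i an *.
case: a an => [_|a an] ia at_.
  have -> : i = ord_max by apply: val_inj; rewrite /= ia subn0.
  rewrite /sminor det_hM_last mulrA -exprD /= addnn -signr_odd odd_double mul1r.
  rewrite hess0 wtE subn0 hz_mulYn ?size_poly1 // /hz big_ord1.
  by rewrite coef1 scale1r /mon !mulr1.
have jt : (t - a.+1 < t)%N by lia.
pose j : 'I_t := Ordinal jt.
have rel : \sum_i sminor i * hM p i j = 0.
  have := congr1 (fun x => (-1) ^+ t * x) (sum_minors (hM p) j).
  rewrite mulr0 mulr_sumr => H; rewrite -[RHS]H; apply: eq_bigr => l _.
  by rewrite /sminor !mulrA.
have i'P : (t - a < t.+1)%N by rewrite ltnS leq_subr.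
pose i' : 'I_t.+1 := Ordinal i'P.
have minor_i' : sminor i' = hz (wt a) (hess hbq a) by apply: IH => //; lia.
have hdE : (hd E j.+1 + wt a.+1 = (wt a).+1)%N.
  have := hmS jt; rewrite /hd !wtE /= (_ : t - a = (t - a.+1).+1)%N; lia.
(* The entries given by the coordinates of p. *)
have tail : \sum_l sminor l * (pcoef l j *: 'X_iy ^+ `|hu E l.+1 j.+1|%N) =
    hz (wt a).+1 (\sum_(b < a.+1) hbq b a *: hess hbq b).
  rewrite (reindex_inj rev_ord_inj) /= raddf_sum /=.
  have a1t : (a.+1 <= t.+1)%N by lia.
  rewrite (big_ord_widen t.+1 (fun b => hz (wt a).+1 (hbq b a *: hess hbq b)) a1t).
  rewrite [RHS]big_mkcond; apply: eq_bigr => b _ /=.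
  have bt : (b <= t)%N by rewrite -ltnS.
  have [q0|qn0] := eqVneq (pcoef (t.+1 - b.+1) (t - a.+1)) 0.
    rewrite q0 scale0r mulr0; case: ifP => // ba.
    by rewrite /hbq bt at_ -[(t - b)%N]subSS q0 scale0r raddf0.
  have [/andP[ab _] _ u0] := pcoef_nz qn0; rewrite subSS in ab qn0 u0 *.
  have ba : (b < a.+1)%N by lia.
  rewrite ba {1}/hbq bt at_ /= linearZ /= -scalerAr; congr (_ *: _).
  have -> : sminor (rev_ord b) = hz (wt b) (hess hbq b).
    exact: (IH b (rev_ord b) (leq_trans ba an) (subSS _ _) bt).
  rewrite mulrC -hz_mulYn ?size_hess ?ltnS ?wt_ge //; congr (hz _ _).
  move: u0; rewrite huE ?leq_subr // subKn // -subSn // subSS subKn ?(ltnW at_) //.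
  by lia.
(* The entries y ^ d and - x of the column; sminor is abstracted, its only relevant
   value being the one at row j.+1. *)
have head (sm : 'I_t.+1 -> R) : sm i' = hz (wt a) (hess hbq a) ->
    \sum_l sm l * (if l == j :> nat then 'X_iy ^+ hd E j.+1
    else if l == j.+1 :> nat then - 'X_ix else 0) =
    'X_iy ^+ hd E j.+1 * sm i - hz (wt a).+1 ('X * hess hbq a).
  move=> smi'; have ij : i = j :> nat by rewrite ia.
  have i'i : i' != i by apply/eqP => /(congr1 val) /=; rewrite ia; lia.
  rewrite (bigD1 i) //= (bigD1 i') //= big1 ?addr0 => [|l /andP[li li']].
    have i'j : (i' == j :> nat) = false by apply/eqP; rewrite /=; lia.
    have i'j1 : (i' == j.+1 :> nat) = true by apply/eqP; rewrite /=; lia.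
    have {}ij : (i == j :> nat) = true by apply/eqP.
    rewrite i'j i'j1 ij [sm i * _]mulrC.
    by rewrite mulrN hz_mulX smi' [hz (wt a) _ * _]mulrC.
  case: eqP => [E1|_]; first by case/eqP: li; apply: val_inj; rewrite /= ia.
  case: eqP => [E1|_]; last by rewrite mulr0.
  by case/eqP: li'; apply: val_inj => /=; rewrite E1 /=; lia.
have : ('X_iy : R) ^+ hd E j.+1 != 0 by rewrite expf_neq0 // -msize_poly_eq0 msizeX.
move/mulfI; apply.
have -> : 'X_iy ^+ hd E j.+1 * hz (wt a.+1) (hess hbq a.+1) =
    hz (wt a).+1 (hess hbq a.+1).
  by rewrite -hdE addnC hz_mulYn // size_hess ltnS wt_ge.
rewrite hessS raddfB /= -tail.
move: rel; under eq_bigr do rewrite hM_entry mulrDr.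
rewrite big_split /= (head _ minor_i') => /eqP; rewrite addr_eq0 subr_eq => /eqP ->.
by rewrite addrC.
Qed.

(** Both ideals contain the forms of degree [e >= wt a] attached to [hess a]: for
    [a <= t] these are multiples of a minor by a power of y, and then one
    multiplies by powers of x. *)
Lemma hb_ideal_hess : hb_ideal p = hess_ideal P hbq.
Proof.
have HI : is_ideal (hb_ideal p) by apply: is_ideal_gen.
have [_ _ IM] := HI; have SI := ideal_subspace HI.
have HH := hess_ideal_ideal HP hbqP.
have sgn (n : nat) (f : R) : (-1) ^+ n * ((-1) ^+ n * f) = f.
  by rewrite mulrA -exprD addnn -signr_odd odd_double mul1r.
have minorE (i : 'I_t.+1) : \det (row' i (hM p)) = (-1) ^+ i * ((-1) ^+ t * sminor i).
  by rewrite /sminor !sgn.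
apply/seteqP; split.
  apply: ideal_gen_min => // _ [i _ <-].
  rewrite minorE; case: (HH) => _ _ HM; do 2 apply: (HM).
  rewrite (@sminor_hess (t - i)) ?leq_subr ?subKn -1?ltnS //.
  apply/hess_ideal_hz; first by rewrite size_hess ltnS wt_ge.
  exact: hpiece_hess.
have hz_in a e : (wt a <= e)%N -> hb_ideal p (hz e (hess hbq a)).
  have [at_|/ltnW] := leqP a t.
    move=> /subnKC <-; have it : (t - a < t.+1)%N by rewrite ltnS leq_subr.
    rewrite hz_mulYn ?size_hess ?ltnS ?wt_ge //.
    rewrite -(@sminor_hess a (Ordinal it)) //; do 3 apply: (IM).
    by apply: sub_ideal_gen; exists (Ordinal it).
  move=> /subnKC <-; elim: (a - t)%N e => [|n IH] e.
    rewrite addn0 => /subnKC <-; rewrite hz_mulYn ?size_hess ?ltnS ?wt_ge //.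
    rewrite -(@sminor_hess t ord0) ?subnn //; do 3 apply: (IM).
    by apply: sub_ideal_gen; exists ord0.
  rewrite wt_id ?leq_addr // addnS; case: e => // e ne.
  rewrite hessS big1 ?subr0 => [|b _]; last by rewrite /hbq ltnNge leq_addr /= scale0r.
  by rewrite hz_mulX; apply: (IM); apply: IH; rewrite wt_id ?leq_addr.
move=> f Hf; rewrite (sum_hz_dh f); apply: subspace_sum => // e _.
have [c Hc ->] := Hf e.
rewrite /hcomb raddf_sum; apply: subspace_sum => // a _; rewrite /= linearZ /=.
have [->|ca] := eqVneq c`_a 0; first by rewrite scale0r; case: HI.
exact: subspaceZ SI (hz_in _ _ (Hc _ ca)).
Qed.

Lemma V_hb_ideal : V E (hb_ideal p).
Proof.
split; first by rewrite hb_ideal_hess; exact: (hess_ideal_homogeneous HP hbqP).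
by rewrite hb_ideal_hess; exact: Lt_hess_ideal.
Qed.

Lemma betti_hb_ideal e :
  betti (hb_ideal p) 0 e = (#|hrows e| - \rank (\matrix_(i < #|hrows e|, j < #|hcols e|)
    pcoef (enum_val i : 'I_t.+1) (enum_val j : 'I_t)))%N.
Proof.
rewrite hb_ideal_hess (betti_hess_ideal HP hbqP); congr (_ - \rank _)%N.
apply/matrixP => i j; rewrite !mxE /hbq.
rewrite leq_subr andbT ifT; last by have := ltn_ord (enum_val j : 'I_t); lia.
rewrite subKn -1?ltnS // -subSn // subSS subKn //; exact: ltnW.
Qed.

End HilbertBurch.

(** * Algebraic independence and chains of irreducible closed sets *)

Lemma widen_lift m (i : 'I_m) : widen_ord (leqnSn m) i = lift ord_max i.
Proof. by apply: val_inj; rewrite /= /bump leqNgt ltn_ord. Qed.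

Section Independence.
Variables (K : closedFieldType) (N : nat).
Local Notation A := (affine_space K N).
Local Notation ev z f := (meval (fun i => z 0 i) f).

Definition mcomp m (g : 'I_m -> {mpoly K[N]}) (Q : {mpoly K[m]}) : {mpoly K[N]} :=
  mmap (@mpolyC N K) g Q.

Lemma meval_mcomp m (g : 'I_m -> {mpoly K[N]}) (Q : {mpoly K[m]}) v :
  (mcomp g Q).@[v] = Q.@[fun i => (g i).@[v]].
Proof.
rewrite /mcomp /mmap raddf_sum /= mevalE; apply: eq_bigr => l _.
rewrite mevalM mevalC; congr (_ * _); rewrite /mmap1 rmorph_prod.
by apply: eq_bigr => i _; rewrite rmorphXn.
Qed.

Lemma meval_muni m (Q : {mpoly K[m.+1]}) (v : 'I_m.+1 -> K) :
  Q.@[v] = (map_poly (meval (fun i => v (widen_ord (leqnSn m) i))) (muni Q)).[v ord_max].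
Proof.
rewrite muniE raddf_sum /= horner_sum mevalE; apply: eq_bigr => l _.
rewrite -mul_polyC rmorphM /= map_polyC map_polyXn /= hornerM hornerC hornerXn.
rewrite mevalZ mevalX -mulrA; congr (_ * _).
by rewrite big_ord_recr /=; congr (_ * _); apply: eq_bigr => i _; rewrite mnmE.
Qed.

Lemma muni_eq0 m (Q : {mpoly K[m.+1]}) : muni Q = 0 -> Q = 0.
Proof.
move=> Q0; apply/mpolyP => l; rewrite mcoeff0.
pose r (l : 'X_{1..m.+1}) := [multinom l (widen_ord (leqnSn m) i) | i < m].
have : ((muni Q)`_(l ord_max))@_(r l) = 0 by rewrite Q0 coef0 mcoeff0.
rewrite muniE coef_sum raddf_sum /=.
have E l' : (((Q@_l' *: 'X_[r l']) *: 'X^(l' ord_max) : {poly {mpoly K[m]}})`_(l ord_max))@_(r l) =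
    if l' == l then Q@_l' else 0.
  rewrite coefZ coefXn; case: eqP => [lE|ln]; last first.
    rewrite mulr0 mcoeff0; case: eqP => // E; by rewrite E in ln.
  rewrite mulr1 mcoeffZ mcoeffX; case: eqP => [rE|rn]; last first.
    rewrite mulr0; case: eqP => // E; by rewrite E in rn.
  rewrite mulr1; case: eqP => // nl; case: nl; apply/mnmP => i.
  have [i' ->|->//] := unliftP ord_max i.
  have := congr1 (fun l : 'X_{1..m} => l i') rE; rewrite !mnmE.
  rewrite widen_lift.
  by [].
under eq_bigr do rewrite E.
rewrite -big_mkcond /=; have [lQ|lQ] := boolP (l \in msupp Q).
  by rewrite (big_rem l lQ) eqxx /= big_seq_cond big1 ?addr0 // => l' /andP[];
    rewrite mem_rem_uniq ?msupp_uniq // inE => /andP[/negbTE ->].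
by rewrite memN_msupp_eq0.
Qed.

Definition alg_indep (Z : set A) m (g : 'I_m -> {mpoly K[N]}) : Prop :=
  forall Q : {mpoly K[m]},
    (forall z : A, Z z -> Q.@[fun i => ev z (g i)] = 0) -> Q = 0.

Lemma closed_root (f : {mpoly K[N]}) : closed [set z : A | ev z f = 0].
Proof.
apply/zariski_closedP; exists [set f]; apply/seteqP; split=> z; last by apply.
by move=> fz _ ->.
Qed.

Lemma irreducible_mul (Z : set A) (f g : {mpoly K[N]}) : irreducible_set Z ->
  (forall z : A, Z z -> ev z f * ev z g = 0) ->
  (forall z : A, Z z -> ev z f = 0) \/ (forall z : A, Z z -> ev z g = 0).
Proof.
case=> _ Zirr fg0.
apply: (Zirr [set z | ev z f = 0] [set z | ev z g = 0]); try exact: closed_root.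
by move=> z /fg0/eqP; rewrite mulf_eq0 => /orP[]/eqP; [left|right].
Qed.

Definition extend m (g : 'I_m -> {mpoly K[N]}) f (i : 'I_m.+1) :=
  if unlift ord_max i is Some j then g j else f.

(** A function which vanishes on [Z] but not on the larger irreducible set [Z']
    is transcendental, on [Z'], over any functions that are independent on
    [Z]: divide a relation by the highest possible power of that function, and
    restrict it to [Z]. *)
Lemma alg_indep_extend (Z Z' : set A) m (g : 'I_m -> {mpoly K[N]}) f :
  alg_indep Z g -> Z `<=` Z' -> irreducible_set Z' ->
  (forall z : A, Z z -> ev z f = 0) -> (exists2 z : A, Z' z & ev z f != 0) ->
  alg_indep Z' (extend g f).
Proof.
move=> indZ ZZ' Z'irr fZ [z' Z'z' fz'] Q Q0; apply: muni_eq0.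
pose evp (z : A) := map_poly (meval (fun i => ev z (g i))) : {poly {mpoly K[m]}} -> {poly K}.
have {Q0} : forall z : A, Z' z -> (evp z (muni Q)).[ev z f] = 0.
  move=> z /Q0; rewrite meval_muni /extend unlift_none => H; rewrite -[RHS]H /evp.
  congr (_.[_]); apply/polyP => i; rewrite !coef_map /=; apply: meval_eq => j.
  by rewrite widen_lift liftK.
move: (muni Q) => q; have [n] := ubnP (size q); elim: n => // n IH in q *.
rewrite ltnS => sq qZ'; have [//|q0] := eqVneq q 0.
have q00 : q`_0 = 0.
  apply: indZ => z Zz; have := qZ' z (ZZ' z Zz).
  by rewrite fZ // horner_coef0 coef_map.
pose q1 := drop_poly 1 q.
have qE : q = q1 * 'X.
  rewrite -[LHS](poly_take_drop 1) (_ : take_poly 1 q = 0) ?add0r //.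
  by apply/polyP => i; rewrite coef_take_poly coef0; case: i.
pose h := \sum_(i < size q1) mcomp g q1`_i * f ^+ i.
have evh (z : A) : ev z h = (evp z q1).[ev z f].
  rewrite /h raddf_sum /= (@horner_coef_wide _ (size q1)) ?size_poly //.
  by apply: eq_bigr => i _; rewrite mevalM meval_mcomp rmorphXn coef_map.
have [hf|h0] : (forall z : A, Z' z -> ev z f = 0) \/ (forall z : A, Z' z -> ev z h = 0).
  apply: irreducible_mul => // z /qZ'.
  rewrite evh mulrC -hornerMX => H; rewrite -[RHS]H qE; congr (_.[_]).
  by rewrite /evp rmorphM /= map_polyX.
  by rewrite hf ?eqxx in fz'.
rewrite qE (IH q1) ?mul0r //.
  have q10 : q1 != 0 by apply: contraNneq q0 => q10; rewrite qE q10 mul0r.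
  by rewrite (leq_trans _ sq) // qE size_mulX.
by move=> z Z'z; rewrite -evh h0.
Qed.

Definition degle d (f : {mpoly K[N]}) := forall l, l \in msupp f -> (mdeg l <= d)%N.

Lemma degle_msize f : degle (msize f) f.
Proof. by move=> l /msize_mdeg_lt/ltnW. Qed.

Lemma degle_leq d e f : (d <= e)%N -> degle d f -> degle e f.
Proof. by move=> de Hf l /Hf/leq_trans; apply. Qed.

Lemma degle1 : degle 0 1.
Proof. by move=> l; rewrite msupp1 mem_seq1 => /eqP ->; rewrite mdeg0. Qed.

Lemma degleM d e f g : degle d f -> degle e g -> degle (d + e) (f * g).
Proof.
move=> Hf Hg l /msuppM_le/allpairsP[[l1 l2] /= [/Hf H1 /Hg H2 ->]].
by rewrite mdegD leq_add.
Qed.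

Lemma degleX d f n : degle d f -> degle (n * d) (f ^+ n).
Proof.
move=> Hf; elim: n => [|n IH]; first exact: degle1.
by rewrite exprS mulSn; apply: degleM.
Qed.

Lemma degle_prod (I : Type) (r : seq I) (d : I -> nat) (g : I -> {mpoly K[N]}) :
  (forall i, degle (d i) (g i)) -> degle (\sum_(i <- r) d i) (\prod_(i <- r) g i).
Proof.
move=> H; elim: r => [|i r IH]; first by rewrite !big_nil; apply: degle1.
by rewrite !big_cons; apply: degleM.
Qed.

(** Count monomials: [m] polynomials of degree at most [d] have [T ^ m] monomials
    with exponents below [T], which are combinations of at most
    [(m * (T * d)).+1 ^ N] monomials in the variables. If [N < m], the first number
    exceeds the second for large [T], which gives a relation. *)
Lemma alg_indep_leq (Z : set A) m (g : 'I_m -> {mpoly K[N]}) :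
  alg_indep Z g -> (m <= N)%N.
Proof.
move=> ind; rewrite leqNgt; apply/negP => Nm.
pose d := (\sum_i msize (g i))%N.
have gd i : degle d (g i).
  apply: degle_leq (@degle_msize (g i)).
  by rewrite /d (bigD1 i) //= leq_addr.
pose T := ((m * d).+1 ^ N).+1; pose D := (m * (T * d)).+1.
pose a := {ffun 'I_m -> 'I_T}; pose b := {ffun 'I_N -> 'I_D}.
have ab : (#|b| < #|a|)%N.
  rewrite !card_ffun !card_ord.
  apply: (@leq_trans (T ^ N.+1)); last by rewrite leq_pexp2l.
  apply: (@leq_ltn_trans (T ^ N * (m * d).+1 ^ N)); last first.
    by rewrite expnSr ltn_pmul2l ?expn_gt0.
  have leq_expl x y e : (x <= y)%N -> (x ^ e <= y ^ e)%N.
    by move=> xy; elim: e => // e IH; rewrite !expnS leq_mul.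
  by rewrite -expnMn leq_expl // /D mulnCA mulnS addnC -addn1 leq_add2l.
pose gm (al : a) := \prod_i g i ^+ (al i : nat).
pose mb (be : b) := [multinom (be i : nat) | i < N].
pose ma (al : a) := [multinom (al i : nat) | i < m].
pose M : 'M[K]_(#|a|, #|b|) := \matrix_(i, j) (gm (enum_val i))@_(mb (enum_val j)).
have /rowV0Pn[u uM u0] : kermx M != 0.
  rewrite kermx_eq0 /row_free; apply: contraTneq (rank_leq_col M) => ->.
  by rewrite -ltnNge.
have {uM} uM : u *m M = 0 by apply/sub_kermxP.
have ug0 : \sum_i u 0 i *: gm (enum_val i) = 0.
  apply/mpolyP => l; rewrite mcoeff0 raddf_sum /=.
  have [lD|] := boolP [forall i, (l i < D)%N].
    pose be : b := [ffun i => inord (l i)].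
    have <- : mb be = l.
      apply/mnmP => i; rewrite mnmE ffunE inordK //.
      by have := forallP lD i.
    have := congr1 (fun v : 'rV_#|b| => v 0 (enum_rank be)) uM.
    rewrite !mxE => H; rewrite -[RHS]H; apply: eq_bigr => i _.
    by rewrite mcoeffZ mxE enum_rankK.
  rewrite negb_forall => /existsP[i0]; rewrite -leqNgt => Di0.
  rewrite big1 // => i _; rewrite mcoeffZ.
  rewrite memN_msupp_eq0 ?mulr0 //; apply/negP => lg.
  have : degle (\sum_j enum_val i j * d) (gm (enum_val i)).
    by apply: degle_prod => j; apply: degleX.
  move=> /(_ _ lg); rewrite leqNgt => /negP; apply.
  apply: (@leq_trans D); last by apply: leq_trans Di0 _; rewrite mdegE (bigD1 i0) //= leq_addr.
  rewrite ltnS -[X in (_ <= X * _)%N]card_ord -sum_nat_const; apply: leq_sum => j _.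
  by rewrite leq_mul2r (ltnW (ltn_ord _)) orbT.
pose Q : {mpoly K[m]} := \sum_i u 0 i *: 'X_[ma (enum_val i)].
have Q0 : Q = 0.
  apply: ind => z _; rewrite /Q raddf_sum /=.
  have := congr1 (meval (fun i => z 0 i)) ug0; rewrite meval0 raddf_sum /= => H.
  rewrite -[RHS]H; apply: eq_bigr => i _; rewrite !mevalZ mevalX; congr (_ * _).
  rewrite rmorph_prod; apply: eq_bigr => j _.
  by rewrite rmorphXn mnmE.
case/eqP: u0; apply/rowP => i; rewrite mxE.
have := congr1 (mcoeff (ma (enum_val i))) Q0; rewrite mcoeff0 raddf_sum /=.
rewrite (bigD1 i) //= mcoeffZ mcoeffX eqxx mulr1 big1 ?addr0 // => j ji.
rewrite mcoeffZ mcoeffX; case: eqP => [E|]; last by rewrite mulr0.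
case/eqP: ji; apply: enum_val_inj; apply/ffunP => l; apply: val_inj.
by have := congr1 (fun m : 'X_{1..m} => m l) E; rewrite !mnmE.
Qed.

(** A chain above [Z] cannot be longer than [N - m] if [m] functions are
    independent on [Z], since each step adds an independent function. *)
Lemma chain_leq (Z0 : set A) m (g : 'I_m -> {mpoly K[N]}) c Z :
  alg_indep Z0 g -> irreducible_chain Z0 c Z -> (m + c <= N)%N.
Proof.
move=> ind [Z00 Zci Zlt].
suff H i : (i <= c)%N -> exists g : 'I_(m + i) -> {mpoly K[N]}, alg_indep (Z i) g.
  by have [h /alg_indep_leq] := H c (leqnn c).
elim: i => [_|i IH ic].
  by rewrite addn0 Z00; exists g.
rewrite addnS; have [h hind] := IH (ltnW ic); have [ZZ' nZ'Z] := Zlt i ic.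
have [Zicl _] := Zci i (ltnW ic); have [_ Z'irr] := Zci i.+1 ic.
have /zariski_closedP[S ZS] := Zicl.
have /existsNP[z /not_implyP[Z'z nZz]] : ~ (forall z, Z i.+1 z -> Z i z) by [].
have [f Sf fz] : exists2 f, S f & ev z f != 0.
  apply: contrapT => nf; apply: nZz; rewrite ZS => f Sf; apply/eqP.
  by apply: contrapT => /negP fz; apply: nf; exists f.
exists (extend h f); apply: alg_indep_extend hind ZZ' Z'irr _ _; last by exists z.
by move=> w; rewrite ZS; apply.
Qed.

End Independence.

(** * Irreducibility by polynomial paths *)

Section Paths.
Variables (K : closedFieldType) (N : nat).
Local Notation A := (affine_space K N).
Local Notation ev z f := (meval (fun i => z 0 i) f).

(** The value of [f] along a curve, as a polynomial in the parameter. *)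
Definition along m (ga : 'I_m -> {poly K}) (f : {mpoly K[m]}) : {poly K} :=
  mmap polyC ga f.

Lemma horner_along m (ga : 'I_m -> {poly K}) (f : {mpoly K[m]}) s :
  (along ga f).[s] = f.@[fun i => (ga i).[s]].
Proof.
rewrite /along /mmap horner_sum mevalE; apply: eq_bigr => l _.
rewrite hornerM hornerC; congr (_ * _); rewrite /mmap1 horner_prod.
by apply: eq_bigr => i _; rewrite horner_exp.
Qed.

Definition at_time (ga : 'I_N -> {poly K}) (s : K) : A := \row_i (ga i).[s].

Lemma ev_along ga (f : {mpoly K[N]}) s : ev (at_time ga s) f = (along ga f).[s].
Proof. by rewrite horner_along; apply: meval_eq => i; rewrite mxE. Qed.

Definition path_between (Z : set A) (a b : A) (ga : 'I_N -> {poly K}) : Prop :=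
  [/\ at_time ga 0 = a, at_time ga 1 = b & forall s, Z (at_time ga s)].

(** If two closed sets cover [Z] and neither contains it, there are two functions
    whose product vanishes on [Z], and a point of [Z] for each of them where it is
    not zero. Along a curve through these points, the product is a nonzero
    polynomial in the parameter, which cannot vanish at all elements of an infinite
    field. *)
Lemma irreducible_path (Z : set A) : Z !=set0 ->
  (forall a b, Z a -> Z b -> exists ga, path_between Z a b ga) -> irreducible_set Z.
Proof.
move=> Z0 Zpath; split=> // F G Fcl Gcl ZFG; apply: contrapT => /not_orP[ZF ZG].
have nz (Y : set A) : closed Y -> ~ Z `<=` Y ->
    exists a f, [/\ Z a, ev a f != 0 & forall z : A, Y z -> ev z f = 0].
  move=> /zariski_closedP[S ->] /existsNP[a /not_implyP[Za /existsNP[f /not_implyP[Sf /eqP fa]]]].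
  by exists a, f; split=> // z; apply.
have [a [f [Za fa fF]]] := nz F Fcl ZF; have [b [g [Zb gb gG]]] := nz G Gcl ZG.
have [ga [ga0 ga1 gaZ]] := Zpath a b Za Zb.
have /closed_nonrootP[s] : along ga f * along ga g != 0.
  rewrite mulf_neq0 //.
    by apply: contraNneq fa => f0; rewrite -ga0 ev_along f0 horner0.
  by apply: contraNneq gb => g0; rewrite -ga1 ev_along g0 horner0.
rewrite rootM negb_or !rootE -!ev_along => /andP[fs gs].
by have [/fF H|/gG H] := ZFG _ (gaZ s); [rewrite H eqxx in fs|rewrite H eqxx in gs].
Qed.

Lemma irreducible_closure (Z : set A) : irreducible_set Z -> irreducible_set (closure Z).
Proof.
case=> Z0 Zirr; split.
  by case: Z0 => z Zz; exists z; apply: subset_closure.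
move=> F G Fcl Gcl ZFG; have [|ZF|ZG] := Zirr F G Fcl Gcl.
- exact: subset_trans (@subset_closure _ Z) ZFG.
- by left; rewrite (closure_id F).1 //; apply: closure_subset.
- by right; rewrite (closure_id G).1 //; apply: closure_subset.
Qed.

(** Choose values of the first variables where the leading coefficient in the last
    variable does not vanish. *)
Lemma mpoly_nonroot m (Q : {mpoly K[m]}) : Q != 0 -> exists v, Q.@[v] != 0.
Proof.
elim: m Q => [|m IH] Q Q0.
  exists (fun=> 0); apply: contraNneq Q0; rewrite [Q in Q == 0]nvar0_mpolyC.
  rewrite [Q in Q.@[_]]nvar0_mpolyC.
  by rewrite mevalC mpolyC_eq0 => ->.
have lQ : lead_coef (muni Q) != 0.
  by rewrite lead_coef_eq0; apply: contraNneq Q0 => /muni_eq0 ->.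
have [v Qv] := IH _ lQ.
have /closed_nonrootP[x xP] : map_poly (meval v) (muni Q) != 0.
  by rewrite -lead_coef_eq0 lead_coef_map_eq.
pose w (i : 'I_m.+1) := if unlift ord_max i is Some j then v j else x.
exists w; rewrite meval_muni /w unlift_none; apply: contraNneq xP => H.
rewrite rootE -[X in _ == X]H; apply/eqP; congr (_.[_]); apply/polyP => i.
rewrite !coef_map; apply: meval_eq => j.
by rewrite widen_lift liftK.
Qed.

End Paths.

(** * Matrices of bounded rank *)

Lemma rank_factor (F : fieldType) m n r (X : 'M[F]_(m, n)) : (\rank X <= r)%N ->
  exists (B : 'M[F]_(m, r)) (C : 'M[F]_(r, n)), X = B *m C.
Proof.
move=> Xr; exists (col_base X *m pid_mx (\rank X)), (pid_mx (\rank X) *m row_base X).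
rewrite mulmxA -(mulmxA (col_base X) (pid_mx _) (pid_mx _)) pid_mx_id //.
by rewrite pid_mx_1 mulmx1 mulmx_base.
Qed.

Lemma rank_mxsub (F : fieldType) m n m' n' (f : 'I_m' -> 'I_m) (g : 'I_n' -> 'I_n)
  (X : 'M[F]_(m, n)) : (\rank (mxsub f g X) <= \rank X)%N.
Proof.
have H p q p' (h : 'I_p' -> 'I_p) (Y : 'M[F]_(p, q)) : (\rank (rowsub h Y) <= \rank Y)%N.
  by rewrite -[Y in rowsub _ Y]mul1mx -mul_rowsub_mx mxrankM_maxr.
have -> : mxsub f g X = rowsub f (rowsub g X^T)^T by apply/matrixP => i j; rewrite !mxE.
by apply: leq_trans (H _ _ _ _ _) _; rewrite mxrank_tr -[X in (_ <= X)%N]mxrank_tr H.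
Qed.

Lemma minor_eq0 (F : fieldType) m n d (f : 'I_d -> 'I_m) (g : 'I_d -> 'I_n)
  (X : 'M[F]_(m, n)) : (\rank X < d)%N -> \det (mxsub f g X) = 0.
Proof.
move=> Xd; apply/eqP; apply: contraTT Xd => H.
have : mxsub f g X \in unitmx by rewrite unitmxE unitfE.
by move/mxrank_unit => <-; rewrite -leqNgt rank_mxsub.
Qed.

Lemma minor_neq0 (F : fieldType) m n (X : 'M[F]_(m, n)) :
  exists (f : 'I_(\rank X) -> 'I_m) (g : 'I_(\rank X) -> 'I_n), \det (mxsub f g X) != 0.
Proof.
pose f := maxrankfun X; pose Y := rowsub f X.
have fY : row_full Y^T by rewrite /row_full mxrank_tr; apply: maxrowsub_free.
exists f, (fullrankfun fY); rewrite -unitfE -unitmxE -unitmx_tr.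
have -> : (mxsub f (fullrankfun fY) X)^T = rowsub (fullrankfun fY) Y^T.
  by apply/matrixP => i j; rewrite !mxE.
exact: fullrowsub_unit.
Qed.


Section Segments.
Variable K : fieldType.

Definition seg (x y : K) : {poly K} := x%:P + (y - x) *: 'X.

Lemma horner_seg0 x y : (seg x y).[0] = x.
Proof. by rewrite /seg hornerD hornerC hornerZ hornerX mulr0 addr0. Qed.

Lemma horner_seg1 x y : (seg x y).[1] = y.
Proof. by rewrite /seg hornerD hornerC hornerZ hornerX mulr1 addrC subrK. Qed.

Definition segmx m n (X Y : 'M[K]_(m, n)) : 'M[{poly K}]_(m, n) :=
  \matrix_(i, j) seg (X i j) (Y i j).

Lemma segmx0 m n (X Y : 'M[K]_(m, n)) : map_mx (horner_eval 0) (segmx X Y) = X.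
Proof. by apply/matrixP => i j; rewrite !mxE /horner_eval horner_seg0. Qed.

Lemma segmx1 m n (X Y : 'M[K]_(m, n)) : map_mx (horner_eval 1) (segmx X Y) = Y.
Proof. by apply/matrixP => i j; rewrite !mxE /horner_eval horner_seg1. Qed.

End Segments.

Section Determinantal.
Variables (K : closedFieldType) (N D : nat) (m n r : 'I_D -> nat).
Hypotheses (rm : forall e, (r e <= m e)%N) (rn : forall e, (r e <= n e)%N).
Local Notation A := (affine_space K N).
Local Notation ev z f := (meval (fun i => z 0 i) f).

Definition entry : finType := {e : 'I_D & ('I_(m e) * 'I_(n e))%type}.
Definition Entry e (i : 'I_(m e)) (j : 'I_(n e)) : entry :=
  existT (fun e => ('I_(m e) * 'I_(n e))%type) e (i, j).

Variable iota : entry -> 'I_N.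
Hypothesis iota_inj : injective iota.

Definition blk (T : Type) (w : 'I_N -> T) e : 'M[T]_(m e, n e) :=
  \matrix_(i, j) w (iota (Entry i j)).

(** The vector whose blocks are the matrices [G e], and whose remaining
    coordinates are those of [d]. *)
Definition fill (T : Type) (G : forall e, 'M[T]_(m e, n e)) (d : 'I_N -> T) (s : 'I_N) : T :=
  if [pick x | iota x == s] is Some x then G (tag x) (tagged x).1 (tagged x).2 else d s.

Lemma fill_iota T (G : forall e, 'M[T]_(m e, n e)) d e i j :
  fill G d (iota (@Entry e i j)) = G e i j.
Proof.
rewrite /fill; case: pickP => [x /eqP/iota_inj -> //|/(_ (Entry i j))].
by rewrite eqxx.
Qed.

Lemma fill_out T (G : forall e, 'M[T]_(m e, n e)) d s :
  (forall x, iota x != s) -> fill G d s = d s.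
Proof. by move=> H; rewrite /fill; case: pickP => // x; rewrite (negbTE (H x)). Qed.

Lemma iotaP s : (exists e i j, s = iota (@Entry e i j)) \/ (forall x, iota x != s).
Proof.
have [/existsP[[e [i j]] /eqP <-]|H] := boolP [exists x, iota x == s].
  by left; exists e, i, j.
by right=> x; apply: contraNneq H => xs; apply/existsP; exists x; rewrite xs.
Qed.

Lemma blk_fill T (G : forall e, 'M[T]_(m e, n e)) d e : blk (fill G d) e = G e.
Proof. by apply/matrixP => i j; rewrite mxE fill_iota. Qed.

Local Notation blkv v := (blk (fun s => v 0 s)).

Definition rank_locus : set A := [set v : A | forall e, (\rank (blkv v e) <= r e)%N].
Definition rank_eq_locus : set A := [set v : A | forall e, \rank (blkv v e) = r e].

(** The points that can be moved into the rank locus by changing the coordinates in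
    [Q]. *)
Definition thick_locus (Q : {set 'I_N}) : set A :=
  [set v : A | exists u w : 'rV[K]_N,
    [/\ v = u + w, (forall s, s \notin Q -> u 0 s = 0) & rank_locus w]].

Definition origin_pt : 'rV[K]_N := \row_s fill (fun e => pid_mx (r e)) (fun=> 0) s.

Lemma blk_row T (w : 'I_N -> T) e : blk (fun s => (\row_s w s) 0 s) e = blk w e.
Proof. by apply/matrixP => i j; rewrite !mxE. Qed.

Lemma blk_origin_pt e : blkv origin_pt e = pid_mx (r e).
Proof. by rewrite blk_row blk_fill. Qed.

Lemma origin_pt_eq : rank_eq_locus origin_pt.
Proof. by move=> e; rewrite blk_origin_pt rank_pid_mx. Qed.

Lemma rank_eq_sub : rank_eq_locus `<=` rank_locus.
Proof. by move=> v Hv e; rewrite Hv. Qed.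

Definition entry_minor e d (f : 'I_d -> 'I_(m e)) (g : 'I_d -> 'I_(n e)) : {mpoly K[N]} :=
  \det (\matrix_(a, b) 'X_(iota (Entry (f a) (g b)))).

Lemma ev_entry_minor e d (f : 'I_d -> 'I_(m e)) (g : 'I_d -> 'I_(n e)) (v : 'rV[K]_N) :
  ev v (entry_minor f g) = \det (mxsub f g (blkv v e)).
Proof.
rewrite /entry_minor -det_map_mx; congr (\det _).
by apply/matrixP => a b; rewrite !mxE /= mevalXU.
Qed.

(** All minors larger than [r e] occur as equations, not only those of size
    [(r e).+1], since a matrix has a nonzero minor of the size of its rank. *)
Lemma closed_rank_locus : closed rank_locus.
Proof.
apply/zariski_closedP.
exists [set h | exists e d (f : 'I_d -> 'I_(m e)) (g : 'I_d -> 'I_(n e)),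
  (r e < d)%N /\ h = entry_minor f g].
apply/seteqP; split=> v.
  move=> Hv _ [e [d [f [g [rd ->]]]]]; rewrite ev_entry_minor.
  by apply: minor_eq0; apply: leq_ltn_trans rd; apply: Hv.
move=> Hv e; rewrite leqNgt; apply/negP => re.
have [f [g]] := minor_neq0 (blkv v e); rewrite -ev_entry_minor Hv ?eqxx //.
by exists e, (\rank (blkv v e)), f, g.
Qed.

Lemma blk_at_time (ga : 'I_N -> {poly K}) x e :
  blkv (at_time ga x) e = map_mx (horner_eval x) (blk ga e).
Proof. by apply/matrixP => i j; rewrite !mxE. Qed.

Lemma blkE (v : 'rV[K]_N) e i j : v 0 (iota (@Entry e i j)) = blkv v e i j.
Proof. by rewrite mxE. Qed.

Lemma eq_blk (v w : 'rV[K]_N) : (forall e, blkv v e = blkv w e) ->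
  (forall s, (forall x, iota x != s) -> v 0 s = w 0 s) -> v = w.
Proof.
move=> vw vw'; apply/rowP => s; have [[e [i [j ->]]]|] := iotaP s; last exact: vw'.
by rewrite !blkE vw.
Qed.

(** Matrices of rank at most [r e] are products of an [m e] by [r e] and an
    [r e] by [n e] matrix; move both factors along segments. *)
Lemma rank_locus_path a b : rank_locus a -> rank_locus b ->
  exists ga, path_between rank_locus a b ga.
Proof.
move=> Ha Hb.
have factor (v : A) : rank_locus v -> forall e,
    exists BC : 'M[K]_(m e, r e) * 'M[K]_(r e, n e), blkv v e = BC.1 *m BC.2.
  by move=> Hv e; have [B [C E]] := rank_factor (Hv e); exists (B, C).
pose BC e := sval (cid (factor a Ha e)); have HBC e := svalP (cid (factor a Ha e)).
pose BC' e := sval (cid (factor b Hb e)); have HBC' e := svalP (cid (factor b Hb e)).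
pose G e := segmx (BC e).1 (BC' e).1 *m segmx (BC e).2 (BC' e).2.
have GE e x : map_mx (horner_eval x) (G e) =
   map_mx (horner_eval x) (segmx (BC e).1 (BC' e).1) *m
   map_mx (horner_eval x) (segmx (BC e).2 (BC' e).2) by rewrite map_mxM.
pose ga := fill G (fun s => seg (a 0 s) (b 0 s)).
exists ga; split=> [||x e].
- apply: eq_blk => [e|s Hs]; last by rewrite mxE /ga fill_out // horner_seg0.
  by rewrite blk_at_time blk_fill GE !segmx0 HBC.
- apply: eq_blk => [e|s Hs]; last by rewrite mxE /ga fill_out // horner_seg1.
  by rewrite blk_at_time blk_fill GE !segmx1 HBC'.
- by rewrite blk_at_time blk_fill GE (leq_trans (mxrankM_maxl _ _)) ?rank_leq_col.
Qed.

Lemma thick_locus_path Q a b : thick_locus Q a -> thick_locus Q b ->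
  exists ga, path_between (thick_locus Q) a b ga.
Proof.
move=> [u [w [-> Hu Hw]]] [u' [w' [-> Hu' Hw']]].
have [ga [ga0 ga1 gaH]] := rank_locus_path Hw Hw'.
pose la s := seg (u 0 s) (u' 0 s).
have E x : at_time (fun s => la s + ga s) x = at_time la x + at_time ga x :> 'rV[K]_N.
  by apply/rowP => s; rewrite !mxE hornerD.
exists (fun s => la s + ga s); split=> [||x]; rewrite E.
- by rewrite ga0; congr (_ + _); apply/rowP => s; rewrite mxE horner_seg0.
- by rewrite ga1; congr (_ + _); apply/rowP => s; rewrite mxE horner_seg1.
- exists (at_time la x), (at_time ga x); split=> // s sQ.
  by rewrite mxE /la Hu // Hu' // /seg subrr scale0r addr0 horner0.
Qed.

Lemma thick_locus0 : thick_locus finset.set0 = rank_locus.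
Proof.
apply/seteqP; split=> v.
  move=> [u [w [-> Hu Hw]]]; suff -> : u = 0 by rewrite add0r.
  by apply/rowP => s; rewrite Hu ?finset.in_set0 // mxE.
by move=> Hv; exists 0, v; split=> // [|s _]; rewrite ?add0r ?mxE.
Qed.

Lemma thick_locusS (Q Q' : {set 'I_N}) : Q \subset Q' -> thick_locus Q `<=` thick_locus Q'.
Proof.
move=> QQ' v [u [w [-> Hu Hw]]]; exists u, w; split=> // s sQ'.
by apply: Hu; apply: contraNN sQ' => /(fintype.subsetP QQ').
Qed.

Lemma thick_locus_irreducible Q : irreducible_set (thick_locus Q).
Proof.
apply: irreducible_path; last exact: thick_locus_path.
exists origin_pt; exists 0, origin_pt.
by split=> [|s _|]; rewrite ?add0r ?mxE //; apply/rank_eq_sub/origin_pt_eq.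
Qed.

Lemma rank_locus_irreducible : irreducible_set rank_locus.
Proof. by rewrite -thick_locus0; apply: thick_locus_irreducible. Qed.

Definition row_low e : 'I_(r e) -> 'I_(m e) := widen_ord (rm e).
Definition col_low e : 'I_(r e) -> 'I_(n e) := widen_ord (rn e).

Definition low_minor (ga : 'I_N -> {poly K}) e : {poly K} :=
  \det (mxsub (@row_low e) (@col_low e) (blk ga e)).

Lemma horner_low_minor ga e x :
  (low_minor ga e).[x] = \det (mxsub (@row_low e) (@col_low e) (blkv (at_time ga x) e)).
Proof.
rewrite -[LHS]/(horner_eval x _) -det_map_mx; congr (\det _).
by apply/matrixP => i j; rewrite !mxE.
Qed.

Lemma low_minor_origin e :
  \det (mxsub (@row_low e) (@col_low e) (blkv origin_pt e)) = 1.
Proof.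
rewrite blk_origin_pt (_ : mxsub _ _ _ = 1%:M) ?det1 //.
apply/matrixP => i j; rewrite !mxE /= ltn_ord andbT.
by rewrite -val_eqE.
Qed.

Lemma prod_low_minor_neq0 ga : at_time ga 1 = origin_pt :> A ->
  \prod_e low_minor ga e != 0.
Proof.
move=> ga1; apply/prodf_neq0 => e _; apply/eqP => /(congr1 (fun p => p.[1])).
by rewrite horner_low_minor ga1 low_minor_origin horner0 => /eqP; rewrite oner_eq0.
Qed.

Lemma prod_low_minor_horner ga x : ~~ root (\prod_e low_minor ga e) x ->
  forall e, \det (mxsub (@row_low e) (@col_low e) (blkv (at_time ga x) e)) != 0.
Proof.
move=> H e; rewrite -horner_low_minor; apply: contraNneq H => He.
by rewrite rootE horner_prod (bigD1 e) //= He mul0r.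
Qed.

(** Join a point of the locus to one of maximal rank: all but finitely many
    points of the path have maximal rank. *)
Lemma closure_rank_eq_locus : closure rank_eq_locus = rank_locus.
Proof.
apply/seteqP; split.
  rewrite [X in _ `<=` X](closure_id _).1; last exact: closed_rank_locus.
  exact/closure_subset/rank_eq_sub.
move=> v Hv; have /zariski_closedP[S SE] := @closed_closure _ rank_eq_locus.
have [ga [ga0 ga1 gaH]] := rank_locus_path Hv (rank_eq_sub origin_pt_eq).
rewrite SE => f Sf; rewrite -ga0 ev_along.
suff : along ga f == 0 by move/eqP->; rewrite horner0.
have : along ga f * \prod_e low_minor ga e == 0.
  apply: contraT => /closed_nonrootP[x]; rewrite rootM negb_or => /andP[fx dx].
  case/negP: fx; rewrite rootE -ev_along; apply/eqP.
  have : closure rank_eq_locus (at_time ga x); last by rewrite SE; apply.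
  apply: subset_closure => e; apply/eqP; rewrite eqn_leq gaH /= leqNgt; apply/negP => re.
  by have := prod_low_minor_horner dx e; rewrite minor_eq0 ?eqxx.
by rewrite mulf_eq0 (negbTE (prod_low_minor_neq0 ga1)) orbF.
Qed.

(** The entries of the lower right corners, which are determined by the others on
    the open subset of the locus where the upper left minors are not zero. *)
Definition free_entries : {set entry} :=
  [set x : entry | (r (tag x) <= (tagged x).1)%N && (r (tag x) <= (tagged x).2)%N]%SET.

Lemma card_ord_geq a b : #|[set i : 'I_a | (b <= i)%N]%SET| = (a - b)%N.
Proof.
rewrite -sum1_card; under eq_bigl do rewrite inE.
by rewrite -(big_geq_mkord b a xpredT (fun=> 1%N)) sum_nat_const_nat muln1.
Qed.

Lemma card_free_entries : #|free_entries| = (\sum_e (m e - r e) * (n e - r e))%N.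
Proof.
rewrite -sum1_card; under eq_bigl do rewrite inE.
rewrite -(sig_big_dep (fun e => true) (fun e (ij : 'I_(m e) * 'I_(n e)) =>
  (r e <= ij.1)%N && (r e <= ij.2)%N) (fun _ _ => 1%N)) /=.
apply: eq_bigr => e _; rewrite -!card_ord_geq -cardsX -sum1_card.
by apply: eq_bigl => -[i j]; rewrite !inE.
Qed.

(** The matrix of rank at most [r e] with the same first [r e] rows and columns
    as [X], when the upper left minor of [X] is not zero. *)
Definition complete e (X : 'M[K]_(m e, n e)) : 'M[K]_(m e, n e) :=
  colsub (@col_low e) X *m invmx (mxsub (@row_low e) (@col_low e) X) *m rowsub (@row_low e) X.

Lemma rank_complete e (X : 'M[K]_(m e, n e)) : (\rank (complete X) <= r e)%N.
Proof. by rewrite (leq_trans (mxrankM_maxr _ _)) ?rank_leq_row. Qed.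

Lemma complete_low e (X : 'M[K]_(m e, n e)) (i : 'I_(m e)) (j : 'I_(n e)) :
  \det (mxsub (@row_low e) (@col_low e) X) != 0 ->
  (i < r e)%N || (j < r e)%N -> complete X i j = X i j.
Proof.
rewrite -unitfE -unitmxE => Uu /orP[ir|jr].
  have -> : i = row_low (Ordinal ir) by apply: val_inj.
  have -> : complete X (row_low (Ordinal ir)) j = (rowsub (@row_low e) (complete X)) (Ordinal ir) j.
    by rewrite [RHS]mxE.
  rewrite /complete -!mul_rowsub_mx (_ : rowsub _ (colsub _ X) = mxsub (@row_low e) (@col_low e) X).
    by rewrite mulmxV // mul1mx mxE.
  by apply/matrixP => i' j'; rewrite !mxE.
have -> : j = col_low (Ordinal jr) by apply: val_inj.
have -> : complete X i (col_low (Ordinal jr)) = (colsub (@col_low e) (complete X)) i (Ordinal jr).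
  by rewrite [RHS]mxE.
rewrite /complete -mulmx_colsub (_ : colsub _ (rowsub _ X) = mxsub (@row_low e) (@col_low e) X).
  by rewrite mulmxKV // mxE.
by apply/matrixP => i' j'; rewrite !mxE.
Qed.

Definition base_coords : {set 'I_N} := (~: (iota @: free_entries))%SET.

(** Outside the lower right corners, the coordinates of a point of the locus can
    be prescribed, as long as the upper left minors are not zero. *)
Lemma base_alg_indep :
  alg_indep rank_locus (fun i : 'I_#|base_coords| => 'X_(enum_val i)).
Proof.
move=> Q HQ; apply/eqP; apply: contraT => /mpoly_nonroot[w Qw].
pose z0 s := if [pick i : 'I_#|base_coords| | enum_val i == s] is Some i then w i else 0.
have z0E (i : 'I_#|base_coords|) : z0 (enum_val i) = w i.
  rewrite /z0; case: pickP => [j /eqP/enum_val_inj -> //|/(_ i)].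
  by rewrite eqxx.
(* On the line from z0, where Q is not zero, to a point where the upper left
   minors are 1, some point has both properties; it can then be completed. *)
pose ga s := seg (z0 s) (origin_pt 0 s).
have ga1 : at_time ga 1 = origin_pt :> A by apply/rowP => s; rewrite mxE horner_seg1.
pose rho := along (fun i : 'I_#|base_coords| => ga (enum_val i)) Q.
have rho0 : rho != 0.
  apply: contraNneq Qw => /(congr1 (fun p => p.[0])); rewrite horner0 horner_along => H.
  by rewrite -[X in _ == X]H; apply/eqP/meval_eq => i; rewrite horner_seg0 z0E.
have /closed_nonrootP[x] : rho * \prod_e low_minor ga e != 0.
  by rewrite mulf_neq0 // prod_low_minor_neq0.
rewrite rootM negb_or => /andP[rx /prod_low_minor_horner dx].
pose z : 'rV[K]_N := at_time ga x.
pose z' : 'rV[K]_N := \row_s fill (fun e => complete (blkv z e)) (fun s => z 0 s) s.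
have Hz' : rank_locus z'.
  by move=> e; rewrite blk_row blk_fill rank_complete.
have zz' s : s \in base_coords -> z' 0 s = z 0 s.
  move=> sb; rewrite mxE; have [[e [i [j sE]]]|H] := iotaP s; last by rewrite fill_out.
  rewrite sE fill_iota [RHS]blkE; apply: complete_low; first exact: dx.
  move: sb; rewrite sE inE mem_imset // inE negb_and -!ltnNge.
  by [].
case/negP: rx; rewrite rootE horner_along -(HQ _ Hz'); apply/eqP/meval_eq => i.
by rewrite mevalXU zz' ?enum_valP // mxE.
Qed.

(** The first [s] coordinates of the lower right corners. *)
Definition chain_coords s : {set 'I_N} :=
  (iota @: [set x in take s (enum free_entries)])%SET.

Lemma chain_coords0 : chain_coords 0 = finset.set0.
Proof.
apply/setP => s; rewrite finset.in_set0; apply/negP => /imsetP[x].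
by rewrite take0 inE.
Qed.

Lemma chain_coordsS s : chain_coords s \subset chain_coords s.+1.
Proof.
apply/imsetS/fintype.subsetP => x; rewrite !inE.
by rewrite -(take_takel _ (leqnSn s)) => /mem_take.
Qed.

(** The upper left minor of size [r e], bordered by the row and the column of
    the entry [s] of the enumeration: it vanishes as long as the entry [s] is
    not free. *)
Lemma chain_strict s : (s < #|free_entries|)%N ->
  closure (thick_locus (chain_coords s)) `<` closure (thick_locus (chain_coords s.+1)).
Proof.
move=> sP; split; first by apply/closure_subset/thick_locusS/chain_coordsS.
have sE : (s < size (enum free_entries))%N by rewrite -cardE.
have /card_gt0P[x0 _] : (0 < #|free_entries|)%N by apply: leq_ltn_trans sP.
pose x := nth x0 (enum free_entries) s.
have xP : x \in free_entries by rewrite -mem_enum mem_nth.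
have [e [i [j xE]]] : exists e i j, x = @Entry e i j.
  by move: (x) => [e [i j]]; exists e, i, j.
rewrite xE inE /= in xP; case/andP: (xP) => ri rj.
pose f (a : 'I_(r e).+1) := if unlift ord_max a is Some a' then row_low a' else i.
pose g (a : 'I_(r e).+1) := if unlift ord_max a is Some a' then col_low a' else j.
pose h := entry_minor f g.
have hcl : thick_locus (chain_coords s) `<=` [set v | ev v h = 0].
  move=> _ [u [w [-> Hu Hw]]]; rewrite /= ev_entry_minor.
  rewrite (_ : mxsub f g _ = mxsub f g (blkv w e)); first by apply: minor_eq0; rewrite ltnS.
  apply/matrixP => a b; rewrite !mxE [X in X + _]Hu ?add0r //.
  rewrite mem_imset // inE; apply/negP => Hin.
  have : Entry (f a) (g b) \in free_entries by rewrite -mem_enum (mem_take Hin).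
  rewrite inE /= /f /g.
  case: unliftP => [a' aE|aE]; first by rewrite /= leqNgt ltn_ord.
  case: unliftP => [b' bE|bE]; first by rewrite /= [X in _ && X]leqNgt ltn_ord andbF.
  move=> _; move: Hin; rewrite aE bE /f /g unlift_none -/(Entry i j) -xE.
  by rewrite in_take ?mem_nth // index_uniq ?enum_uniq // ltnn.
pose u : 'rV[K]_N := delta_mx 0 (iota (Entry i j)).
have Hv : thick_locus (chain_coords s.+1) (u + origin_pt).
  exists u, origin_pt; split=> // [l|]; last exact/rank_eq_sub/origin_pt_eq.
  move=> lQ; rewrite mxE eqxx /=; case: eqP => // lE; case/negP: lQ.
  rewrite lE mem_imset // inE -xE in_take ?mem_nth // index_uniq ?enum_uniq //.
have hv : ev (u + origin_pt) h = 1.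
  rewrite ev_entry_minor (_ : mxsub f g _ = 1%:M) ?det1 //.
  have uE a b : u 0 (iota (Entry (f a) (g b))) = ((a == ord_max) && (b == ord_max))%:R.
    rewrite mxE eqxx /= (inj_eq iota_inj); congr (_ : bool)%:R.
    apply/eqP/andP => [E|[/eqP -> /eqP ->]]; last by rewrite /f /g unlift_none.
    have fi : f a = i :> nat := congr1 (fun x : entry => nat_of_ord (tagged x).1) E.
    have gj : g b = j :> nat := congr1 (fun x : entry => nat_of_ord (tagged x).2) E.
    move: fi gj; rewrite /f /g; case: unliftP => [a' aE|-> _] /=.
      by move=> ai; rewrite -ai leqNgt ltn_ord in ri.
    by case: unliftP => [b' bE|-> _] //= bj; rewrite -bj leqNgt ltn_ord in rj.
  apply/matrixP => a b; rewrite mxE mxE [in LHS]mxE uE.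
  rewrite blkE blk_origin_pt !mxE /f /g.
  case: unliftP => [a' ->|->]; case: unliftP => [b' ->|->]; rewrite /= ?eqxx.
  - rewrite ltn_ord andbT ![lift _ _ == ord_max]eq_sym !(negbTE (neq_lift _ _)) add0r.
    by rewrite (inj_eq lift_inj).
  - rewrite [lift _ _ == ord_max]eq_sym (negbTE (neq_lift _ _)) add0r.
    by rewrite ltn_eqF // (leq_trans _ rj).
  - rewrite [lift _ _ == ord_max]eq_sym (negbTE (neq_lift _ _)) andbF add0r.
    by rewrite [(i < r e)%N]ltnNge ri andbF.
  - by rewrite [(i < r e)%N]ltnNge ri andbF addr0.
move=> H; have /H : closure (thick_locus (chain_coords s.+1)) (u + origin_pt).
  exact: subset_closure.
have: closure (thick_locus (chain_coords s)) `<=` [set v | ev v h = 0].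
  by rewrite [X in _ `<=` X](closure_id _).1; [exact: closure_subset|exact: closed_root].
by move=> Hc /Hc /= /eqP; rewrite hv oner_eq0.
Qed.

Lemma rank_locus_codim : has_codim rank_locus (\sum_e (m e - r e) * (n e - r e))%N.
Proof.
rewrite -card_free_entries; split; last first.
  move=> c Z /(chain_leq base_alg_indep).
  have := cardsC (iota @: free_entries)%SET.
  rewrite card_imset // -/base_coords card_ord => HN H.
  by rewrite -(leq_add2l #|base_coords|) (leq_trans H) // addnC HN.
exists (fun s => closure (thick_locus (chain_coords s))); split=> [|s _|s sP].
- rewrite chain_coords0 thick_locus0 -(closure_id _).1 //; exact: closed_rank_locus.
- split; first exact: closed_closure.
  exact/irreducible_closure/thick_locus_irreducible.
- exact: chain_strict.
Qed.

End Determinantal.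

(** * The Betti strata of a lex-segment ideal *)

Section Strata.
Variables (K : closedFieldType) (P : nat -> nat -> bool) (HP : lex_stair P).
Local Notation E := (stair_ideal K P).
Local Notation t := (ht E).
Local Notation N := #|hS E|.
Local Notation wt := (wt K P).
Local Notation hrows := (hrows K P).
Local Notation hcols := (hcols K P).
Variable be : nat -> nat.
Hypothesis be_rows : forall e, (be e <= #|hrows e|)%N.
Hypothesis be_cols : forall e, (#|hrows e| <= be e + #|hcols e|)%N.

(* No generator has degree above wt 0. *)
Let D := (wt 0).+1.
Let m (e : 'I_D) := #|hrows e|.
Let n (e : 'I_D) := #|hcols e|.
Let r (e : 'I_D) := (#|hrows e| - be e)%N.

(** An entry between a generator and a syzygy of equal degree has degree 0, and it
    lies below the diagonal since the syzygy [j] has larger degree than the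
    generators [i <= j.+1]. *)
Lemma unit_entry_hS e (i : 'I_t.+1) (j : 'I_t) :
  i \in hrows e -> j \in hcols e -> (i, j) \in hS E.
Proof.
rewrite !inE /= => /eqP wi /eqP wj.
have it : (i <= t)%N by rewrite -ltnS.
rewrite huE // wi wj subrr lexx ltz_nat subn_gt0 /= hmS // andbT.
rewrite ltnNge; apply/negP => ij.
have : (wt (t - i) <= wt (t - j.+1))%N by apply: wt_leq => //; lia.
by rewrite wi -wj ltnn.
Qed.

Definition entry_index (x : entry m n) : 'I_t.+1 * 'I_t :=
  (enum_val (tagged x).1, enum_val (tagged x).2).

Lemma entry_index_hS x : entry_index x \in hS E.
Proof. by apply: (@unit_entry_hS (tag x)); apply: enum_valP. Qed.

Lemma entry_index_inj : injective entry_index.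
Proof.
move=> [e [i j]] [e' [i' j']] [] /= ii' jj'.
have ee' : e = e'.
  apply: val_inj; have := enum_valP i; have := enum_valP i'.
  by rewrite -ii' !inE => /eqP we' /eqP we; apply: etrans we'.
by case: e' / ee' i' j' ii' jj' => i' j' /enum_val_inj -> /enum_val_inj ->.
Qed.

Definition coord (x : entry m n) : 'I_N := enum_rank_in (entry_index_hS x) (entry_index x).

Lemma enum_val_coord x : enum_val (coord x) = entry_index x.
Proof. by rewrite /coord enum_rankK_in // entry_index_hS. Qed.

Lemma coord_inj : injective coord.
Proof. by move=> x y /(congr1 enum_val); rewrite !enum_val_coord => /entry_index_inj. Qed.

Lemma pcoef_coord (p : affine_space K N) (x : entry m n) :
  pcoef p (entry_index x).1 (entry_index x).2 = p 0 (coord x).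
Proof.
rewrite /pcoef (big_pred1 (coord x)) // => s.
rewrite /= (_ : (s == coord x) = (enum_val s == entry_index x)).
  by case: (enum_val s) => a b; rewrite /entry_index xpair_eqE.
by rewrite -enum_val_coord (inj_eq enum_val_inj).
Qed.

Lemma betti_blk (p : affine_space K N) (e : 'I_D) :
  betti (hb_ideal p) 0 e = (m e - \rank (blk coord (fun s => p 0%R s) e))%N.
Proof.
rewrite betti_hb_ideal //; congr (_ - \rank _)%N.
by apply/matrixP => i j; rewrite !mxE -pcoef_coord.
Qed.

Lemma betti_large (p : affine_space K N) e : (wt 0 < e)%N ->
  betti (hb_ideal p) 0 e = 0%N /\ be e = 0%N.
Proof.
move=> we; have r0 := card_hrows_eq0 HP we.
split.
  by apply/eqP; rewrite betti_hb_ideal // -leqn0 (leq_trans (leq_subr _ _)) // r0.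
by have := be_rows e; rewrite r0 leqn0 => /eqP.
Qed.

Lemma V_ge_rank_locus : @hb_ideal K E @^-1` V_ge E be = rank_locus r coord.
Proof.
apply/seteqP; split=> p.
  move=> [_ Hp] e; have := Hp e; rewrite betti_blk /r.
  by have := be_rows e; have := rank_leq_row (blk coord (fun s => p 0 s) e); rewrite /m; lia.
move=> Hp; split; first exact: V_hb_ideal.
move=> e; have [we|we] := ltnP (wt 0) e; first by have [-> ->] := betti_large p we.
pose e' : 'I_D := Ordinal (we : e < D)%N.
have := Hp e'; rewrite -[e in betti _ _ e]/(val e') betti_blk.
by have := be_rows e; rewrite /r /m /=; lia.
Qed.

Lemma V_eq_rank_locus : @hb_ideal K E @^-1` V_eq E be = rank_eq_locus r coord.
Proof.
apply/seteqP; split=> p.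
  move=> [_ Hp] e; have := Hp e; rewrite betti_blk /r.
  by have := be_rows e; have := rank_leq_row (blk coord (fun s => p 0 s) e); rewrite /m; lia.
move=> Hp; split; first exact: V_hb_ideal.
move=> e; have [we|we] := ltnP (wt 0) e; first by have [-> ->] := betti_large p we.
pose e' : 'I_D := Ordinal (we : e < D)%N.
have := Hp e'; rewrite -[e in betti _ _ e]/(val e') betti_blk.
by have := be_rows e; rewrite /r /m /=; lia.
Qed.

Let rm e : (r e <= m e)%N. Proof. exact: leq_subr. Qed.
Let rn e : (r e <= n e)%N. Proof. by have := be_cols e; rewrite /r /n; lia. Qed.

Lemma betti_strata :
  [/\ irreducible_set (@hb_ideal K E @^-1` V_ge E be),
      closure (@hb_ideal K E @^-1` V_eq E be) = @hb_ideal K E @^-1` V_ge E be &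
      has_codim (@hb_ideal K E @^-1` V_ge E be)
        (\sum_(e < D) be e * (be e + #|hcols e| - #|hrows e|))%N].
Proof.
rewrite V_ge_rank_locus V_eq_rank_locus; split.
- exact: (rank_locus_irreducible _ rm rn coord_inj).
- exact: (closure_rank_eq_locus _ rm rn coord_inj).
have -> : (\sum_(e < D) be e * (be e + #|hcols e| - #|hrows e|) =
    \sum_e (m e - r e) * (n e - r e))%N.
  apply: eq_bigr => e _; have := be_rows e; have := be_cols e; rewrite /m /n /r => H1 H2.
  by congr (_ * _)%N; lia.
exact: (rank_locus_codim _ rm rn coord_inj).
Qed.

End Strata.

Theorem corollary4p7 (k : fieldType) (K : closedFieldType)
    (iota : {rmorphism k -> K}) (K_alg : forall z : K, algebraicOver iota z)
    (L I : set {mpoly k[2]})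
    (L_lex : lex_segment L) (L_proper : ~ L 1) (L_fin : finite_colength L)
    (I_hom : homogeneous_ideal I)
    (I_L : forall j, hilbert_fun I j = hilbert_fun L j) :
  let LK := ideal_ext iota L in
  let V_eq_beta := @hb_ideal K LK @^-1` V_eq LK (betti I 0) in
  let V_ge_beta := @hb_ideal K LK @^-1` V_ge LK (betti I 0) in
  [/\ irreducible_set V_ge_beta,
      closure V_eq_beta = V_ge_beta &
      has_codim V_ge_beta
        (\big[addn/0%N]_(j \in [set: nat]) (betti I 1 j * betti I 0 j)%N)].
Proof.
have [P HP LP] := lex_segment_stair L_lex L_proper L_fin.
rewrite LP in I_L *; rewrite (ideal_ext_stair iota HP) /=.
have [HI _] := I_hom.
have Hb e : (betti I 0 e <= #|hrows K P e|)%N /\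
    (betti I 1 e + #|hrows K P e| = betti I 0 e + #|hcols K P e|)%N.
  have := betti_same_hilbert e HP HI I_L.
  by rewrite (card_hrowsE k K) (card_hcolsE k K).
have be_rows e := proj1 (Hb e).
have be_cols e : (#|hrows K P e| <= betti I 0 e + #|hcols K P e|)%N.
  by have [_ <-] := Hb e; rewrite leq_addl.
have [irr cl cod] := betti_strata HP be_rows be_cols.
split=> //.
suff -> : \big[addn/0%N]_(j \in [set: nat]) (betti I 1 j * betti I 0 j)%N =
  (\sum_(e < (wt K P 0).+1)
    betti I 0 e * (betti I 0 e + #|hcols K P e| - #|hrows K P e|))%N by exact: cod.
rewrite -(fsbig_widen `I_(wt K P 0).+1) //; last first.
  move=> e [_ /negP]; rewrite /= -leqNgt => we.
  by have := be_rows e; rewrite card_hrows_eq0 // leqn0 => /eqP ->; rewrite muln0.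
rewrite -fsbig_ord; apply: eq_bigr => e _.
by have [_ <-] := Hb e; rewrite addnK mulnC.
Qed.
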